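(* Let $g$ be a dyadic distribution on $\mathbb{R}^n$ and let $\pi_g$ be the dyadic paraproduct with symbol $g$. Then: (i) For all $0<p,q,r<\infty$ with $\frac1q=\frac1p+\frac1r$, $$\|\pi_g\|_{H_d^p(\mathbb{R}^n)\to \dot H_d^q(\mathbb{R}^n)}\simeq \|g\|_{\dot H_d^r(\mathbb{R}^n)} .$$ (ii) For all $0<p<\infty$ and $\alpha$ with $0\le \alpha p<n$, setting $\frac1{p^*}=\frac1p-\frac{\alpha}{n}$, $$\|\pi_g\|_{H_d^p(\mathbb{R}^n)\to \dot H_d^{p^*}(\mathbb{R}^n)}\simeq \|g\|_{\dot\Lambda_d^{\alpha}(\mathbb{R}^n)} .$$ Here $X\simeq Y$ means $C^{-1}Y\le X\le CY$ with a finite constant $C>0$ depending only on the dimension $n$ and the exponents ($p,q,r$ in (i); $p,\alpha$ in (ii)), not on $g$; both sides are allowed to be $+\infty$.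
   Context: Dyadic cubes: cubes $Q=2^k(m+[0,1]^n)$, $k\in\mathbb{Z}$, $m\in\mathbb{Z}^n$; $\mathcal{D}$ is the family of all of them. $|Q|$ is Lebesgue measure, $l(Q)$ side length, $\langle f\rangle_Q=\frac1{|Q|}\int_Q f$. Haar functions: for a dyadic interval $I$ with left and right halves $I^-,I^+$, $h^1_I=|I|^{-1/2}(\chi_{I^-}-\chi_{I^+})$ and $h^0_I=|I|^{-1/2}\chi_I$. For a dyadic cube $Q=\prod_{j=1}^n I_j$ and $i=(i_1,\dots,i_n)\in\{0,1\}^n$, $i\neq0$, $h^i_Q=\prod_{j=1}^n h^{i_j}_{I_j}$ (i.e. $h^i_Q(x)=\prod_j h^{i_j}_{I_j}(x_j)$). Dyadic distribution: a family of complex numbers $\{f^i_Q: Q\in\mathcal{D}, i\neq0\}$, formally written $f=\sum_{Q}\sum_{i\ne0}\langle f,h^i_Q\rangle h^i_Q$ with $\langle f,h^i_Q\rangle:=f^i_Q$. A locally integrable function gives a dyadic distribution through its Haar coefficients. Square function: $S_d(f)(x)=\Big(\sum_{Q\in\mathcal{D}}\sum_{i\neq0}|\langle f,h^i_Q\rangle|^2\frac{\chi_Q(x)}{|Q|}\Big)^{1/2}$. Dyadic maximal function: $M_d(f)(x)=\sup_{x\in Q\in\mathcal{D}}|\langle f\rangle_Q|$. Spaces: for $0<p<\infty$, $H_d^p(\mathbb{R}^n)$ is the completion of the space of locally integrable $f$ with $\|f\|_{H_d^p(\mathbb{R}^n)}:=\|M_d(f)\|_{L^p(\mathbb{R}^n)}<\infty$.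 $\dot H_d^p(\mathbb{R}^n)$ is the space of dyadic distributions $f$ with $\|f\|_{\dot H_d^p(\mathbb{R}^n)}:=\|S_d(f)\|_{L^p(\mathbb{R}^n)}<\infty$. For $\alpha\ge0$, $\dot\Lambda^\alpha_d(\mathbb{R}^n)$ is the space of locally integrable functions $f$, modulo constants, with $\|f\|_{\dot\Lambda^\alpha_d(\mathbb{R}^n)}:=\sup_{Q\in\mathcal{D}}l(Q)^{-\alpha}\,\frac1{|Q|}\int_Q|f-\langle f\rangle_Q|<\infty$ (for $\alpha=0$ this is dyadic $BMO$). For a dyadic distribution $g$, $\|g\|_{\dot\Lambda^\alpha_d(\mathbb{R}^n)}$ is the norm of a locally integrable function having the same Haar coefficients as $g$, and is $+\infty$ if no such function exists. Dyadic paraproduct: for $f\in L^1_{loc}(\mathbb{R}^n)$, $\pi_g(f)$ is the dyadic distribution $\pi_g(f)=\sum_{Q\in\mathcal{D}}\sum_{i\neq0}\langle f\rangle_Q\langle g,h^i_Q\rangle h^i_Q$. Its operator norm $\|\pi_g\|_{H_d^p\to\dot H_d^q}$ is the least $A\in[0,\infty]$ such that $\|\pi_g(f)\|_{\dot H^q_d(\mathbb{R}^n)}\le A\|f\|_{H^p_d(\mathbb{R}^n)}$ for all locally integrable $f$ with $\|f\|_{H^p_d(\mathbb{R}^n)}<\infty$. *)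

(* Defs.v *)
From HB Require Import structures.
From mathcomp Require Import all_boot all_order all_algebra.
From mathcomp Require Import all_classical all_reals all_analysis.
From mathcomp Require Export complex.

Set Implicit Arguments.
Unset Strict Implicit.
Unset Printing Implicit Defensive.

Import Order.TTheory GRing.Theory Num.Theory.
Import numFieldNormedType.Exports.

Local Open Scope classical_set_scope.
Local Open Scope ring_scope.

(** The library has no Lebesgue measure on tuples; it is built by recursion on
    [n] as the image of the product measure [dx_0 (x) dx_1...dx_n] under
    [(t, x) |-> t :: x], starting from the unit mass on [R^0]. *)

Notation Rn R n := (n.-tuple (measurableTypeR R)).

Section lebesgue_tuple.
Context {R : realType}.
Local Open Scope ereal_scope.

Definition tuple_cons n (z : measurableTypeR R * Rn R n) : Rn R n.+1 :=
  [tuple of z.1 :: z.2].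

Lemma measurable_tuple_cons n :
  measurable_fun [set: measurableTypeR R * Rn R n] (@tuple_cons n).
Proof. exact: measurable_cons. Qed.

Section step.
Variables (n : nat) (nu : {sigma_finite_measure set (Rn R n) -> \bar R}).

Definition lebesgue_cons : set (Rn R n.+1) -> \bar R :=
  pushforward (@lebesgue_measure R \x nu) (@tuple_cons n).

Let lebesgue_cons0 : lebesgue_cons set0 = 0.
Proof. by rewrite /lebesgue_cons /pushforward preimage_set0 measure0. Qed.

Let lebesgue_cons_ge0 A : 0 <= lebesgue_cons A.
Proof. exact: integral_ge0. Qed.

Let lebesgue_cons_sigma_additive : semi_sigma_additive lebesgue_cons.
Proof.
move=> F mF tF mUF; rewrite /lebesgue_cons /pushforward preimage_bigcup.
have mcons A : measurable A -> measurable (@tuple_cons n @^-1` A).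
  by move=> mA; rewrite -[X in measurable X]setTI; exact: measurable_tuple_cons.
apply: measure_semi_sigma_additive.
- by move=> k; exact: mcons.
- apply/trivIsetP => /= i j _ _ ij; rewrite -preimage_setI.
  by move/trivIsetP : tF => /(_ _ _ _ _ ij) ->//; rewrite preimage_set0.
- by rewrite -preimage_bigcup; exact: mcons.
Qed.

HB.instance Definition _ := isMeasure.Build _ _ _ lebesgue_cons
  lebesgue_cons0 lebesgue_cons_ge0 lebesgue_cons_sigma_additive.

Let lebesgue_cons_sigma_finite : sigma_finite setT lebesgue_cons.
Proof.
have /sigma_finiteP[F [TF ndF Foo]] := sigma_finiteT (@lebesgue_measure R).
have /sigma_finiteP[G [TG ndG Goo]] := sigma_finiteT nu.
pose uncons (x : Rn R n.+1) : measurableTypeR R * Rn R n :=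
  (thead x, [tuple of behead x]).
have muncons : measurable_fun [set: Rn R n.+1] uncons.
  apply: measurable_fun_pair; first exact: measurable_tnth.
  exact: measurable_behead.
have unconsK A : @tuple_cons n @^-1` (uncons @^-1` A) = A.
  apply/seteqP; split=> -[t x]; rewrite /preimage/= /uncons theadE /=;
    by rewrite (_ : [tuple of _] = x)//; apply/val_inj.
exists (fun k => uncons @^-1` (F k `*` G k)).
  rewrite -preimage_bigcup (_ : \bigcup_k _ = setT) ?preimage_setT//.
  apply/seteqP; split=> // -[t x] _.
  have [k _ Fkt] : (\bigcup_k F k) t by rewrite -TF.
  have [l _ Glx] : (\bigcup_k G k) x by rewrite -TG.
  exists (maxn k l) => //; split=> /=.
  - by move: t Fkt; exact/subsetPset/ndF/leq_maxl.
  - by move: x Glx; exact/subsetPset/ndG/leq_maxr.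
move=> k; have [mF Fk] := Foo k; have [mG Gk] := Goo k; split.
  by rewrite -[X in measurable X]setTI; apply: muncons => //; exact: measurableX.
rewrite /lebesgue_cons /pushforward unconsK product_measure1E//.
by rewrite lte_mul_pinfty// ge0_fin_numE.
Qed.

HB.instance Definition _ := Measure_isSigmaFinite.Build _ _ _ lebesgue_cons
  lebesgue_cons_sigma_finite.

End step.

Fixpoint lebesgue_tuple n : {sigma_finite_measure set (Rn R n) -> \bar R} :=
  match n with
  | 0%N => \d_([tuple] : Rn R 0)
  | n'.+1 => lebesgue_cons (lebesgue_tuple n')
  end.

End lebesgue_tuple.

Lemma lebesgue_tuple_box {R : realType} n (A : 'I_n -> set (measurableTypeR R)) :
  (forall j, measurable (A j)) ->
  lebesgue_tuple n [set x | forall j, A j (tnth x j)]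
  = (\prod_(j < n) lebesgue_measure (A j))%E.
Proof.
elim: n A => [|n IHn] A mA.
  rewrite big_ord0 /= diracE (_ : _ \in _ = true)//.
  by apply/mem_set => /= -[].
rewrite big_ord_recl -IHn//= /lebesgue_cons /pushforward.
rewrite -product_measure1E//; last first.
  rewrite (_ : [set _ | _] = \bigcap_(j in [set: 'I_n])
    ((@tnth n (measurableTypeR R))^~ j @^-1` A (lift ord0 j))).
    apply: fin_bigcap_measurable => // j _.
    by rewrite -[X in measurable X]setTI; exact: measurable_tnth.
  by apply/seteqP; split=> x /=; [move=> + j _|move=> + j]; apply.
congr (_ _); apply/seteqP; split=> -[t x]/=.
  move=> Ax; split=> [|j]; first by have := Ax ord0; rewrite tnth0.
  by have := Ax (lift ord0 j); rewrite tnthS.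
move=> [At Ax] j; have [l ->|->] := unliftP ord0 j; first by rewrite tnthS; exact: Ax.
by rewrite tnth0.
Qed.

Section complex_functions.
Context {R : realType} {n : nat}.
Local Notation mu := (@lebesgue_tuple R n).

(** The norm of [R[i]] in [ssrnum] takes its values in [R[i]]; this one is
    real. *)
Definition cabs (z : R[i]) : R := ComplexField.Normc.normc z.

Definition cintegral (D : set (Rn R n)) (f : Rn R n -> R[i]) : R[i] :=
  Complex (\int[mu]_(x in D) complex.Re (f x)) (\int[mu]_(x in D) complex.Im (f x)).

(** A set is relatively compact iff it lies in some [[-a, a]^n]. Integrability
    includes Borel measurability. *)
Definition locally_integrable_Rn (f : Rn R n -> R[i]) : Prop :=
  forall a : R,
    let K := [set x : Rn R n | forall j, `|tnth x j : R| <= a] in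
    mu.-integrable K (fun x => (complex.Re (f x))%:E) /\
    mu.-integrable K (fun x => (complex.Im (f x))%:E).

End complex_functions.

Definition dyadic_itv {R : realType} (k m : int) : set (measurableTypeR R) :=
  [set t : R | 2 ^ k * m%:~R <= t <= 2 ^ k * (m%:~R + 1)].

(** The pair [(k, m)] stands for the cube [2^k (m + [0, 1]^n)]; for [0 < n]
    distinct pairs give distinct cubes. *)
Definition dyadic_cube n : Type := (int * n.-tuple int)%type.

Definition haar_index n : Type :=
  {i : n.-tuple bool | i != [tuple of nseq n false]}.

Definition dyadic_distribution (R : realType) n : Type :=
  dyadic_cube n -> haar_index n -> R[i].

HB.instance Definition _ n := Choice.on (dyadic_cube n).
HB.instance Definition _ n := Finite.on (haar_index n).

Section haar.
Context {R : realType} {n : nat}.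
Local Notation mu := (@lebesgue_tuple R n).

Definition cube (Q : dyadic_cube n) : set (Rn R n) :=
  [set x | forall j, dyadic_itv Q.1 (tnth Q.2 j) (tnth x j)].

Definition side (Q : dyadic_cube n) : R := 2 ^ Q.1.

Definition vol (Q : dyadic_cube n) : R := fine (mu (cube Q)).

(** [dyadic_itv (k - 1) (2 * m)] and [dyadic_itv (k - 1) (2 * m + 1)] are the
    left and right halves of [dyadic_itv k m]. *)
Definition haar1 (e : bool) (k m : int) (t : R) : R :=
  (Num.sqrt (fine (lebesgue_measure (dyadic_itv (R := R) k m))))^-1 *
  (if e then \1_(dyadic_itv (k - 1) (2 * m)) t
             - \1_(dyadic_itv (k - 1) (2 * m + 1)) t
   else \1_(dyadic_itv k m) t).

Definition haar (Q : dyadic_cube n) (i : haar_index n) (x : Rn R n) : R :=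
  \prod_(j < n) haar1 (tnth (val i) j) Q.1 (tnth Q.2 j) (tnth x j).

Definition haar_coef (f : Rn R n -> R[i]) : dyadic_distribution R n :=
  fun Q i => cintegral setT (fun x => f x * (haar Q i x)%:C%C).

Definition average (f : Rn R n -> R[i]) (Q : dyadic_cube n) : R[i] :=
  (vol Q)^-1%:C%C * cintegral (cube Q) f.

End haar.

Section spaces.
Context {R : realType} {n : nat}.
Local Notation mu := (@lebesgue_tuple R n).
Local Open Scope ereal_scope.

Definition square_function (g : dyadic_distribution R n) (x : Rn R n) : \bar R :=
  (\esum_(Q in [set: dyadic_cube n]) \sum_(i : haar_index n)
     (cabs (g Q i) ^+ 2 * \1_(cube Q) x / vol Q)%:E) `^ 2^-1.

Definition maximal_function (f : Rn R n -> R[i]) (x : Rn R n) : \bar R :=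
  ereal_sup [set (cabs (average f Q))%:E | Q in [set Q | cube Q x]].

Definition Hp_norm (p : R) (f : Rn R n -> R[i]) : \bar R :=
  'N[mu]_p%:E[maximal_function f].

Definition dotHp_norm (p : R) (g : dyadic_distribution R n) : \bar R :=
  'N[mu]_p%:E[square_function g].

Definition dotLambda_fun_norm (alpha : R) (b : Rn R n -> R[i]) : \bar R :=
  ereal_sup [set (side Q `^ (- alpha))%:E *
      ((vol Q)^-1%:E * \int[mu]_(x in cube Q) (cabs (b x - average b Q)%R)%:E)
    | Q in [set: dyadic_cube n]].

(** Two locally integrable functions with the same Haar coefficients differ
    a.e. by a constant on each of the [2^n] orthants, so the set below has at
    most one element; the infimum is [+oo] when it is empty. *)
Definition dotLambda_norm (alpha : R) (g : dyadic_distribution R n) : \bar R :=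
  ereal_inf [set dotLambda_fun_norm alpha b | b in
    [set b | locally_integrable_Rn b /\ haar_coef b = g]].

Definition paraproduct (g : dyadic_distribution R n) (f : Rn R n -> R[i]) :
    dyadic_distribution R n :=
  fun Q i => (average f Q * g Q i)%R.

Definition paraproduct_norm (p q : R) (g : dyadic_distribution R n) : \bar R :=
  ereal_inf [set A : \bar R | 0 <= A /\
    forall f : Rn R n -> R[i], locally_integrable_Rn f -> Hp_norm p f < +oo ->
      dotHp_norm q (paraproduct g f) <= A * Hp_norm p f].

End spaces.

(* Main.v *)
Require Import Defs.
From mathcomp Require Import all_boot all_order all_algebra.
From mathcomp Require Import all_classical all_reals all_analysis.
From mathcomp Require Import measurable_realfun.
From mathcomp Require Import ring lra zify.

(** At almost every point the square of the square function of [pi_g f] is the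
    sum of [|<f>_Q|^2 * c_Q] over the cubes [Q] that contain the point, where
    [c_Q = |Q|^-1 * \sum_i |g_Q^i|^2] is the energy of the symbol. So everything
    happens on the tree in which each cube has its [2 ^ n] children: functions
    enter through their averages, which form martingales, and integrals are
    limits of averages over finite trees ([integral_node],
    [integral_square_sum_le]).

    In (i), pointwise [S (pi_g f) <= M f * S g], and Hoelder's inequality gives
    the upper bound with constant one ([dotHp_paraproduct_le]). For the lower
    bound, write [S_Q] for the part of [S g] that comes from the cubes containing
    [Q], and test on a function [f] with [|<f>_Q| >= S_Q `^ (r / p)]. The sum of
    [S_Q `^ (2 * r / p) * c_Q] over a chain of cubes is comparable to
    [S `^ (2 + 2 * r / p)], so [||pi_g f||_q^q] is at least a multiple of
    [||S||_r^r]. An average can be made large only on one half of a set of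
    siblings if it is made small or negative on the other; jumping to both signs
    of the required size keeps it a martingale, and since siblings have equal
    volumes, [||M f||_p^p] is still at most a multiple of [||S||_r^r]
    ([jump_martingale], [tmean_runmax_le]). Comparing the two powers of
    [||S||_r] yields [dotHp_le_paraproduct].

    In (ii), for the upper bound, let [b] have norm at most [B]. If [alpha] is
    positive, then [c_Q] is at most a multiple of [B^2 * l(Q) `^ (2 * alpha)],
    while [|<f>_Q|] is at most [M f] and at most [||M f||_p * |Q| `^ (- p^-1)];
    summing over the chain, with the first bound on small cubes and the second
    one on large cubes, bounds [S (pi_g f)] by
    [B * (M f) `^ (p / q) * ||M f||_p `^ (1 - p / q)] with [q = pstar]
    ([dotHp_paraproduct_lipschitz]). If [alpha = 0], the John-Nirenberg
    inequality makes the energies a Carleson sequence, and a Carleson embedding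
    in the mean of order [p / 2] applies ([dotHp_paraproduct_bmo]).

    For the lower bound in (ii), a function supported on one cube, constant on
    its children and with values [1] and [-1] there, has averages of modulus one
    below them. Hence the square sums of [g] below any cube are bounded in the
    mean of order [q / 2], a fortiori in distribution, and a second
    John-Nirenberg argument turns this into bounds on the Carleson sums
    ([john_nirenberg_distribution], [carleson_paraproduct]). These make the
    martingale with the Haar coefficients of [g] bounded in mean square on each
    cube, so it converges to a locally integrable function, whose mean
    oscillations the Carleson sums control ([martingale_limit],
    [reconstruction], [haar_reconstruction]). *)

Set Implicit Arguments.
Unset Strict Implicit.
Unset Printing Implicit Defensive.

Import Order.TTheory GRing.Theory Num.Theory.
Import numFieldNormedType.Exports.

Local Open Scope classical_set_scope.
Local Open Scope ring_scope.


(** * Averages over children and Walsh functions *)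

Section children_average.
Context {R : realType} {n : nat}.
Local Notation E := (n.-tuple bool).
Implicit Types (u w : E -> R) (e i : E).

Definition av u : R := (\sum_e u e) / 2 ^+ n.

Let D_gt0 : 0 < 2 ^+ n :> R. Proof. exact: exprn_gt0. Qed.

Lemma eq_av u w : u =1 w -> av u = av w.
Proof. by move=> uw; rewrite /av (eq_bigr _ (fun e _ => uw e)). Qed.

Lemma avD u w : av (fun e => u e + w e) = av u + av w.
Proof. by rewrite /av big_split /= mulrDl. Qed.

Lemma avZ (a : R) u : av (fun e => a * u e) = a * av u.
Proof. by rewrite /av -mulr_sumr mulrA. Qed.

Lemma avB u w : av (fun e => u e - w e) = av u - av w.
Proof. by rewrite avD -mulN1r -avZ; congr (_ + _); apply: eq_av => e; rewrite mulN1r. Qed.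

Lemma av_cst (a : R) : av (fun=> a) = a.
Proof.
rewrite /av sumr_const card_tuple card_bool -[a *+ _]mulr_natr natrX mulfK//.
Qed.

Lemma ler_av u w : (forall e, u e <= w e) -> av u <= av w.
Proof.
by move=> uw; rewrite /av ler_pM2r ?invr_gt0//; apply: ler_sum => e _.
Qed.

Lemma ge0_av_ge u e : (forall e, 0 <= u e) -> u e <= 2 ^+ n * av u.
Proof.
move=> u0; rewrite /av mulrC divfK ?gt_eqF// (bigD1 e)//= lerDl.
by apply: sumr_ge0.
Qed.

(** Up to a normalization, the value on the child [e] of the Haar function of
    index [i]. *)
Definition walsh i e : R := \prod_(j < n) (-1) ^+ (tnth i j && tnth e j).

Lemma walshC i e : walsh i e = walsh e i.
Proof. by rewrite /walsh; apply: eq_bigr => j _; rewrite andbC. Qed.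

Lemma walsh_sq i e : walsh i e * walsh i e = 1.
Proof.
rewrite /walsh -big_split/= big1// => j _.
by case: (_ && _); rewrite ?expr0 ?expr1 ?mulr1// mulrNN mulr1.
Qed.

Lemma norm_walsh i e : `|walsh i e| = 1.
Proof.
by apply: (@pexpIrn _ 2) => //; rewrite ?nnegrE// -normrX expr2 walsh_sq expr1n normr1.
Qed.

Lemma sum_prod_tuple (F : 'I_n -> bool -> R) :
  \sum_(e : E) \prod_j F j (tnth e j) = \prod_j (F j true + F j false).
Proof.
under [RHS]eq_bigr do rewrite -(big_bool _ (F _)).
rewrite bigA_distr_bigA/=.
rewrite (reindex (fun f : {ffun 'I_n -> bool} => [tuple f j | j < n]))/=.
  by apply: eq_bigr => f _; apply: eq_bigr => j _; rewrite tnth_mktuple.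
exists (fun e : E => [ffun j => tnth e j]) => [f _|e _].
  by apply/ffunP => j; rewrite ffunE tnth_mktuple.
by apply: eq_from_tnth => j; rewrite tnth_mktuple ffunE.
Qed.

Lemma walsh_orth i i' :
  \sum_e walsh i e * walsh i' e = if i == i' then 2 ^+ n else 0.
Proof.
under eq_bigr do rewrite /walsh -big_split/=.
rewrite (sum_prod_tuple (fun j b =>
  (-1) ^+ (tnth i j && b) * (-1) ^+ (tnth i' j && b))).
have [<-|neq] := eqVneq i i'.
  rewrite (eq_bigr (fun=> 2)) ?prodr_const ?card_ord// => j _.
  by rewrite !andbF andbT expr0 mulr1; case: (tnth i j); rewrite ?expr0 ?expr1; lra.
have [j ij] : exists j, tnth i j != tnth i' j.
  apply/existsP; rewrite -negb_forall; apply: contra neq => /forallP h.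
  by apply/eqP/eq_from_tnth => j; apply/eqP.
rewrite (bigD1 j)//= !andbF !andbT expr0 mulr1.
by move: ij; case: (tnth i j); case: (tnth i' j) => //= _;
  rewrite ?expr0 ?expr1 ?mulr1 ?mul1r ?addNr ?subrr mul0r.
Qed.

Definition zero_index : E := [tuple of nseq n false].

Lemma walsh0 e : walsh zero_index e = 1.
Proof.
by rewrite /walsh big1// => j _; rewrite tnth_nseq expr0.
Qed.

Lemma av_walsh i : av (walsh i) = (i == zero_index)%:R.
Proof.
rewrite /av; under eq_bigr => e _ do rewrite -[walsh i e]mulr1 -(walsh0 e).
rewrite walsh_orth.
by case: eqP => _; rewrite ?mul0r// divff// gt_eqF.
Qed.

(** Walsh functions form an orthonormal basis for the normalized counting
    measure on the children; symmetry of [walsh] makes its rows and columns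
    orthogonal at once. *)
Lemma walsh_parseval u : \sum_i av (fun e => walsh i e * u e) ^+ 2 =
  av (fun e => u e ^+ 2).
Proof.
rewrite /av; under eq_bigr => i _.
  rewrite exprMn expr2 mulr_suml.
  under eq_bigr do rewrite mulr_sumr.
  over.
rewrite -mulr_suml exchange_big/=.
under eq_bigr => e _.
  rewrite exchange_big/=.
  under eq_bigr => e' _.
    under eq_bigr => i _ do rewrite mulrACA (walshC i e) (walshC i e').
    rewrite -mulr_suml walsh_orth.
    over.
  rewrite (bigD1 e)//= eqxx big1 ?addr0; last first.
    by move=> e' /negPf; rewrite eq_sym => ->; rewrite mul0r.
  over.
rewrite -mulr_sumr -[\sum_e u e * u e]/(\sum_e u e ^+ 2); set S := \sum_e _.
by field; rewrite gt_eqF.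
Qed.

End children_average.

(** * The tree of dyadic cubes *)

Section dyadic_tree.
Context {n : nat}.
Local Notation T := (dyadic_cube n).
Local Notation E := (n.-tuple bool).
Implicit Types (Q : T) (e : E).

Definition child Q e : T :=
  (Q.1 - 1, [tuple 2 * tnth Q.2 j + (tnth e j : nat)%:Z | j < n]).

Definition parent Q : T := (Q.1 + 1, [tuple (tnth Q.2 j %/ 2)%Z | j < n]).

(** Which child of its parent a cube is. *)
Definition digit Q : E := [tuple (tnth Q.2 j %% 2)%Z == 1 | j < n].

Lemma childK Q e : parent (child Q e) = Q.
Proof.
case: Q => k m; rewrite /parent /child/= subrK; congr pair.
apply: eq_from_tnth => j; rewrite !tnth_mktuple.
by case: (tnth e j); lia.
Qed.

Lemma digit_child Q e : digit (child Q e) = e.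
Proof.
by apply: eq_from_tnth => j; rewrite !tnth_mktuple; case: (tnth e j); lia.
Qed.

Lemma parentK Q : child (parent Q) (digit Q) = Q.
Proof.
case: Q => k m; rewrite /parent /child/= addrK; congr pair.
apply: eq_from_tnth => j; rewrite !tnth_mktuple /=.
by case: eqP => /=; lia.
Qed.

Definition anc j Q : T := iter j parent Q.

Lemma anc_gen j Q : (anc j Q).1 = Q.1 + j%:Z.
Proof. by elim: j => [|j IH] /=; rewrite ?addr0// IH; lia. Qed.

Lemma ancSr j Q : anc j.+1 Q = anc j (parent Q).
Proof. exact: iterSr. Qed.

Lemma ancD i j Q : anc (i + j) Q = anc i (anc j Q).
Proof. exact: iterD. Qed.

End dyadic_tree.

Section tree_mean.
Context {R : realType} {n : nat}.
Local Notation T := (dyadic_cube n).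
Local Notation E := (n.-tuple bool).
Implicit Types (F G : T -> R) (Q : T).

Fixpoint tmean N F Q : R :=
  if N is N'.+1 then av (fun e => tmean N' F (child Q e)) else F Q.

Lemma eq_tmean N F G Q : (forall L, anc N L = Q -> F L = G L) ->
  tmean N F Q = tmean N G Q.
Proof.
elim: N Q => [|N IH] Q FG /=; first exact: FG.
apply: eq_av => e; apply: IH => L ancL; apply: FG.
by rewrite /anc iterS -/(anc _ _) ancL childK.
Qed.

Lemma ler_tmean N F G Q : (forall L, anc N L = Q -> F L <= G L) ->
  tmean N F Q <= tmean N G Q.
Proof.
elim: N Q => [|N IH] Q FG /=; first exact: FG.
apply: ler_av => e; apply: IH => L ancL; apply: FG.
by rewrite /anc iterS -/(anc _ _) ancL childK.
Qed.

Lemma tmeanD N F G Q :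
  tmean N (fun L => F L + G L) Q = tmean N F Q + tmean N G Q.
Proof. by elim: N Q => [//|N IH] Q /=; rewrite -avD; apply: eq_av. Qed.

Lemma tmeanZ N (a : R) F Q : tmean N (fun L => a * F L) Q = a * tmean N F Q.
Proof. by elim: N Q => [//|N IH] Q /=; rewrite -avZ; apply: eq_av. Qed.

Lemma tmeanB N F G Q :
  tmean N (fun L => F L - G L) Q = tmean N F Q - tmean N G Q.
Proof. by elim: N Q => [//|N IH] Q /=; rewrite -avB; apply: eq_av. Qed.

Lemma tmean_cst N (a : R) Q : tmean N (fun=> a) Q = a.
Proof.
by elim: N Q => [//|N IH] Q /=; rewrite (eq_av (w := fun=> a)) ?av_cst.
Qed.

Lemma tmean_ge0 N F Q : (forall L, anc N L = Q -> 0 <= F L) ->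
  0 <= tmean N F Q.
Proof. by move=> F0; rewrite -(tmean_cst N 0 Q); apply: ler_tmean. Qed.

Lemma tmeanDn M N F Q : tmean (M + N) F Q = tmean M (tmean N F) Q.
Proof. by elim: M Q => [//|M IH] Q /=; apply: eq_av => e; rewrite IH. Qed.

End tree_mean.

(** * Inequalities on the tree *)

Section power_increments.
Context {R : realType}.
Implicit Types x y a s : R.

(** Tangent-line bound for the convex function [t `^ a], obtained from Young's
    inequality for the product [y * x `^ (a - 1)]. *)
Lemma powR_increment_le x y a : 1 <= a -> 0 <= y -> y <= x ->
  x `^ a - y `^ a <= a * x `^ (a - 1) * (x - y).
Proof.
move=> a1 y0 yx; have x0 : 0 <= x by exact: le_trans yx.
have [->|an1] := eqVneq a 1.
  by rewrite subrr powRr0 !powRr1// !mul1r.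
have a_gt1 : 1 < a by rewrite lt_neqAle eq_sym an1.
have a_gt0 : 0 < a by lra.
have am1 : 0 < a - 1 by lra.
have := @conjugate_powR _ y (x `^ (a - 1)) a (a / (a - 1)) y0 (powR_ge0 _ _) a_gt0.
rewrite divr_gt0// => /(_ isT) h.
have {h} := h ltac:(by field; rewrite !gt_eqF).
rewrite -powRrM (_ : (a - 1) * (a / (a - 1)) = a); last by field; rewrite gt_eqF.
rewrite -(mulr_powRB1 x0 a_gt0); set X := x `^ (a - 1); set Y := y `^ a => h.
have : a * (y * X) <= a * (Y / a + x * X / (a / (a - 1))).
  by rewrite ler_pM2l.
rewrite (_ : a * (Y / a + x * X / (a / (a - 1))) = Y + (a - 1) * (x * X)); last first.
  by field; rewrite !gt_eqF.
nra.
Qed.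

(** Young's inequality with a small constant: the power of [y] can be moved to
    the left of an inequality that bounds [y `^ s]. Either [2 * s * x <= y] and
    the product is a fraction of [y `^ s], or [y] is replaced by [2 * s * x]. *)
Lemma absorb_young x y s : 1 <= s -> 0 <= x -> 0 <= y ->
  s * (x * y `^ (s - 1)) <= y `^ s / 2 + (2 * s) `^ s / 2 * x `^ s.
Proof.
move=> s1 x0 y0; have s0 : 0 < s by lra.
have yx0 : 0 <= y `^ s / 2 by rewrite divr_ge0 ?powR_ge0.
have [h|h] := leP (2 * s * x) y.
  apply: (@le_trans _ _ (y `^ s / 2)); last first.
    by rewrite lerDl mulr_ge0 ?powR_ge0// divr_ge0 ?powR_ge0.
  rewrite -(mulr_powRB1 y0 s0); have := powR_ge0 y (s - 1); nra.
apply: (@le_trans _ _ ((2 * s) `^ s / 2 * x `^ s)); last by rewrite lerDr.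
rewrite mulrAC -powRM//; last by lra.
have sx0 : 0 <= 2 * s * x by apply: mulr_ge0 => //; lra.
rewrite -(mulr_powRB1 sx0 s0).
have : y `^ (s - 1) <= (2 * s * x) `^ (s - 1).
  by apply: ge0_ler_powR; rewrite ?nnegrE//; lra.
have : 0 <= s * x by rewrite mulr_ge0// ltW.
nra.
Qed.

(** The same for exponents below one: whichever of [x `^ s] and [y] is larger
    dominates this geometric mean of the two. *)
Lemma absorb_concave x y s : 0 < s -> s <= 1 -> 0 <= x -> 0 <= y ->
  (x `^ (1 - s) * y) `^ s <= x `^ s + y.
Proof.
move=> s0 s1 x0 y0; rewrite powRM ?powR_ge0//.
have [h|h] := leP y (x `^ s).
  apply: (@le_trans _ _ (x `^ s)); last by rewrite lerDl.
  apply: (@le_trans _ _ ((x `^ (1 - s)) `^ s * (x `^ s) `^ s)).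
    by rewrite ler_wpM2l ?powR_ge0// ge0_ler_powR ?nnegrE ?powR_ge0// ltW.
  rewrite -powRM ?powR_ge0// -powRD ?subrK; last by rewrite oner_eq0.
  by rewrite powRr1.
apply: (@le_trans _ _ y); last by rewrite lerDr powR_ge0.
have y_gt0 : 0 < y by apply: le_lt_trans h; rewrite powR_ge0.
rewrite -powRrM [(1 - s) * s]mulrC powRrM.
apply: (@le_trans _ _ (y `^ (1 - s) * y `^ s)).
  rewrite ler_wpM2r ?powR_ge0// ge0_ler_powR ?nnegrE ?powR_ge0 ?subr_ge0//.
  exact: ltW.
by rewrite -powRD ?subrK ?powRr1// oner_eq0.
Qed.

Lemma le_poweR (r : R) (x y : \bar R) : 0 <= r -> (0 <= x)%E -> (x <= y)%E ->
  (x `^ r <= y `^ r)%E.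
Proof.
move=> r0 x0 xy; apply: gt0_ler_poweR => //; rewrite in_itv/= leey andbT//.
exact: le_trans xy.
Qed.

End power_increments.

Section tree_inequalities.
Context {R : realType} {n : nat}.
Local Notation T := (dyadic_cube n).
Local Notation E := (n.-tuple bool).
Implicit Types (Q L : T) (c : T -> R) (W d t : nat -> T -> R).

Local Notation D := (2 ^+ n : R).

Let D_gt0 : 0 < D. Proof. exact: exprn_gt0. Qed.

(** There are [j] terms, the last of them at [Q] itself. *)
Fixpoint pathsum j c Q : R :=
  if j is j'.+1 then pathsum j' c (parent Q) + c Q else 0.

(** The Carleson sum: [|Q|^-1] times the sum of [c P * |P|] over the cubes [P]
    inside [Q], down to [N] generations below it. *)
Fixpoint carl N c Q : R :=
  c Q + (if N is N'.+1 then av (fun e => carl N' c (child Q e)) else 0).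

(** Here the terms may depend on the depth below the top cube as well. The top
    cube has depth [0], so there are [j + 1] terms. *)
Fixpoint wpathsum d j Q : R :=
  (if j is j'.+1 then wpathsum d j' (parent Q) else 0) + d j Q.

Fixpoint wcarl d N j Q : R :=
  d j Q + (if N is N'.+1 then av (fun e => wcarl d N' j.+1 (child Q e)) else 0).

Lemma pathsumS_top j c Q : pathsum j.+1 c Q = pathsum j c Q + c (anc j Q).
Proof.
elim: j Q => [|j IH] Q; first by rewrite /= add0r.
by rewrite [LHS]/= -/(pathsum j.+1 c _) IH/= addrAC -ancSr.
Qed.

Lemma wpathsumS d j Q :
  wpathsum d j.+1 Q = wpathsum d j (parent Q) + d j.+1 Q.
Proof. by []. Qed.

Lemma carlS N c Q : carl N.+1 c Q = c Q + av (fun e => carl N c (child Q e)).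
Proof. by []. Qed.

Lemma pathsum_ge0 j c Q : (forall Q, 0 <= c Q) -> 0 <= pathsum j c Q.
Proof. by move=> c0; elim: j Q => [//|j IH] Q /=; rewrite addr_ge0. Qed.

Lemma path_mono t j N L : (forall j Q, t j (parent Q) <= t j.+1 Q) ->
  t j (anc N L) <= t (j + N)%N L.
Proof.
move=> tm; elim: N L => [|N IH] L; first by rewrite addn0.
by rewrite ancSr addnS (le_trans (IH _)).
Qed.

Lemma tmean_wpathsum d N j Q :
  tmean N (wpathsum d (j + N)) Q = wpathsum d j Q - d j Q + wcarl d N j Q.
Proof.
elim: N j Q => [|N IH] j Q /=; first by rewrite addn0 addr0 subrK.
under eq_av => e do rewrite -addSnnS IH /= childK addrK.
by rewrite avD av_cst addrA subrK.
Qed.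

Lemma tmean_wpathsum0 d N Q : tmean N (wpathsum d N) Q = wcarl d N 0 Q.
Proof. by have /= -> := tmean_wpathsum d N 0 Q; rewrite add0r subrr add0r. Qed.

(** Summation by parts along the tree: a weight that grows towards the leaves
    is a sum of nonnegative jumps, and each jump sees at most the Carleson
    constant times the volume of the cube where it occurs. The subtracted term
    is what makes the bound pass from the children to the parent. *)
Lemma carleson_embedding c W N Q : (forall Q, 0 <= c Q) ->
  (forall N Q, carl N c Q <= 1) ->
  (forall j Q, W j (parent Q) <= W j.+1 Q) -> (forall j Q, 0 <= W j Q) ->
  tmean N (wpathsum (fun j Q => W j Q * c Q) N) Q <= tmean N (W N) Q.
Proof.
move=> c0 c1 Wm W0; rewrite tmean_wpathsum0; set d := fun _ _ => _.
suff H j : wcarl d N j Q - W j Q * carl N c Q <= tmean N (W (j + N)%N) Q - W j Q.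
  by have := H 0; have := c1 N Q; have := W0 0 Q; rewrite add0n; nra.
elim: N j Q => [|N IH] j Q; first by rewrite /= !addr0 addn0 !subrr.
rewrite /= mulrDr [d j Q]/d opprD addrACA subrr add0r.
rewrite -avZ -avB -[X in _ - X](av_cst (n := n)) -avB.
apply: ler_av => e; rewrite -addSnnS.
have := IH j.+1 (child Q e); have := Wm j (child Q e); rewrite childK.
have := c1 N (child Q e); nra.
Qed.

Let wpath_le c W (s phi : R) j Q : (forall Q, 0 <= c Q) ->
  (forall j Q, W j (parent Q) <= W j.+1 Q) -> (forall j Q, 0 <= W j Q) ->
  s <= 1 -> W j Q <= phi ->
  wpathsum (fun j Q => W j Q * c Q) j Q <=
  phi `^ (1 - s) * wpathsum (fun j Q => W j Q `^ s * c Q) j Q.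
Proof.
move=> c0 Wm W0 s1.
have key i P : W i P <= phi -> W i P * c P <= phi `^ (1 - s) * (W i P `^ s * c P).
  move=> Wphi; rewrite mulrA ler_wpM2r//.
  rewrite -{1}[W i P]powRr1// -{1}(subrK s 1) powRD ?subrK ?oner_eq0//.
  rewrite ler_wpM2r ?powR_ge0// ge0_ler_powR ?nnegrE ?subr_ge0//.
  exact: le_trans Wphi.
elim: j Q => [|j IH] Q Wphi /=; first by rewrite !add0r key.
by rewrite mulrDr lerD ?key// IH// (le_trans (Wm _ _)).
Qed.

(** The Carleson embedding in a mean of any positive order [s]. For [s <= 1] a
    power [1 - s] of the weight at the leaf comes out of the path sum, and the
    order-one embedding applies to what is left. For [1 < s] the increments of
    the [s]-th power of the path sum [z] are at most [s * z `^ (s - 1)] times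
    those of [z], which is an order-one embedding with weight
    [W * z `^ (s - 1)]; Young's inequality then absorbs [z]. *)
Lemma carleson_embedding_pow (s : R) : 0 < s ->
  exists2 C : R, 0 < C & forall c W N Q, (forall Q, 0 <= c Q) ->
  (forall N Q, carl N c Q <= 1) ->
  (forall j Q, W j (parent Q) <= W j.+1 Q) -> (forall j Q, 0 <= W j Q) ->
  tmean N (fun L => wpathsum (fun j Q => W j Q * c Q) N L `^ s) Q <=
  C * tmean N (fun L => W N L `^ s) Q.
Proof.
move=> s0; have [s1|s1] := leP s 1.
  exists 2 => // c W N Q c0 c1 Wm W0.
  pose V := wpathsum (fun j Q => W j Q `^ s * c Q) N.
  have V0 L : 0 <= V L.
    rewrite /V; elim: (N) L => [|k IH] L /=; first by rewrite add0r mulr_ge0 ?powR_ge0.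
    by rewrite addr_ge0// mulr_ge0 ?powR_ge0.
  have z0 L : 0 <= wpathsum (fun j Q => W j Q * c Q) N L.
    elim: (N) L => [|k IH] L /=; first by rewrite add0r mulr_ge0.
    by rewrite addr_ge0// mulr_ge0.
  apply: (@le_trans _ _ (tmean N (fun L => W N L `^ s + V L) Q)).
    apply: ler_tmean => L _; apply: le_trans (absorb_concave s0 s1 (W0 N L) (V0 L)).
    apply: ge0_ler_powR; rewrite ?nnegrE ?(ltW s0)//.
      by rewrite mulr_ge0 ?powR_ge0.
    exact: wpath_le.
  rewrite tmeanD (_ : 2 = 1 + 1 :> R)// mulrDl !mul1r lerD2l.
  apply: (carleson_embedding (W := fun j Q => W j Q `^ s)) => // j P.
    by rewrite ge0_ler_powR ?nnegrE// ltW.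
  exact: powR_ge0.
have s1' := ltW s1.
exists ((2 * s) `^ s) => [|c W N Q c0 c1 Wm W0].
  by rewrite powR_gt0// mulr_gt0.
pose z := wpathsum (fun j Q => W j Q * c Q).
have z0 j L : 0 <= z j L.
  rewrite /z; elim: j L => [|k IH] L /=; first by rewrite add0r mulr_ge0.
  by rewrite addr_ge0// mulr_ge0.
have zm j L : z j (parent L) <= z j.+1 L by rewrite /z/= lerDl mulr_ge0.
pose y := wpathsum (fun j Q => W j Q * z j Q `^ (s - 1) * c Q).
have zy j L : z j L `^ s <= s * y j L.
  elim: j L => [|j IH] L.
    rewrite /y/= add0r mulrAC (_ : z 0 L = W 0 L * c L) ?mulr_powRB1//.
    - by rewrite ler_peMl ?powR_ge0.
    - by rewrite mulr_ge0.
    - by rewrite /z/= add0r.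
  have := powR_increment_le s1' (z0 j (parent L)) (zm j L).
  have := IH (parent L).
  have -> : z j.+1 L - z j (parent L) = W j.+1 L * c L by rewrite /z/= addrC addKr.
  rewrite /y wpathsumS -/y mulrDr.
  set A := z j.+1 L `^ s; set A' := z j.+1 L `^ (s - 1); nra.
have h1 : tmean N (fun L => z N L `^ s) Q <=
    s * tmean N (fun L => W N L * z N L `^ (s - 1)) Q.
  apply: (@le_trans _ _ (tmean N (fun L => s * y N L) Q)); first exact: ler_tmean.
  rewrite tmeanZ ler_pM2l//.
  apply: (carleson_embedding (W := fun j Q => W j Q * z j Q `^ (s - 1))) => // j P.
    apply: ler_pM => //; first exact: powR_ge0.
    by rewrite ge0_ler_powR ?nnegrE ?subr_ge0.
  by rewrite mulr_ge0 ?powR_ge0.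
have h2 : tmean N (fun L => s * (W N L * z N L `^ (s - 1))) Q <=
   tmean N (fun L => 2^-1 * z N L `^ s + (2 * s) `^ s / 2 * W N L `^ s) Q.
  by apply: ler_tmean => L _; rewrite [2^-1 * _]mulrC; exact: absorb_young.
move: h2; rewrite tmeanZ tmeanD !tmeanZ.
move: h1; rewrite -/z; set A := tmean N _ Q; set B := tmean N _ Q; set C := tmean N _ Q.
lra.
Qed.

Definition sibmax t j P : R := \big[Num.max/0]_(e : E) t j.+1 (child P e).

(** Taking all siblings into account makes the value at a cube known already at
    its parent. *)
Fixpoint runmax t j Q : R :=
  if j is j'.+1 then
    Num.max (runmax t j' (parent Q)) (sibmax t j' (parent Q)) else 0.

Lemma sibmax_ge t j P e : t j.+1 (child P e) <= sibmax t j P.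
Proof. exact: (le_bigmax _ (fun e => t j.+1 (child P e))). Qed.

Lemma sibmax_ge0 t j P : 0 <= sibmax t j P.
Proof. exact: bigmax_ge_id. Qed.

Lemma runmax_ge0 t j Q : 0 <= runmax t j Q.
Proof. by elim: j Q => [//|j IH] Q /=; rewrite le_max IH. Qed.

Lemma runmax_mono t j Q : runmax t j (parent Q) <= runmax t j.+1 Q.
Proof. by rewrite /= le_max lexx. Qed.

(** A sibling of a cube where [t] is large has the same volume as that cube, so
    replacing [t] by its maximum over siblings costs at most a factor [2 ^ n].
    The truncation from below by the current maximum keeps the factor from
    being paid once per generation. *)
Lemma tmean_runmax_le t N Q : (forall j Q, 0 <= t j Q) ->
  (forall j Q, t j (parent Q) <= t j.+1 Q) ->
  tmean N (runmax t N) Q <= D * tmean N (t N) Q.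
Proof.
move=> t0 tm.
suff H j : tmean N (runmax t (j + N)) Q - runmax t j Q <=
   D * (tmean N (fun L => Num.max (t (j + N)%N L) (runmax t j Q)) Q - runmax t j Q).
  have := H 0; rewrite add0n /= !subr0 => /le_trans; apply.
  by rewrite ler_pM2l//; apply: ler_tmean => L _; rewrite max_l.
elim: N j Q => [|N IH] j Q.
  by rewrite /= addn0 subrr mulr_ge0 ?(ltW D_gt0)// subr_ge0 le_max lexx orbT.
pose w := runmax t j Q; pose m := sibmax t j Q; pose w' := Num.max w m.
have w'E e : runmax t j.+1 (child Q e) = w' by rewrite /= childK.
rewrite -/w /=.
have IH' e : tmean N (runmax t (j + N.+1)) (child Q e) <= w' +
    D * (tmean N (fun L => Num.max (t (j + N.+1)%N L) w') (child Q e) - w').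
  by have := IH j.+1 (child Q e); rewrite w'E addSnnS; lra.
have {IH'} := ler_av IH'.
rewrite avD av_cst avZ avB av_cst.
set A := av _; set B := av _; set B' := av _ => h.
suff : w' - w <= D * (B' - w - (B - w')) by nra.
pose F e := tmean N (fun L => Num.max (t (j + N.+1)%N L) w) (child Q e) -
  tmean N (fun L => Num.max (t (j + N.+1)%N L) w') (child Q e) + (w' - w).
have FE : B' - w - (B - w') = av F.
  rewrite /F avD av_cst.
  by rewrite avB -/B' -/B; ring.
have FE' e : F e = tmean N (fun L => Num.max (t (j + N.+1)%N L) w -
    Num.max (t (j + N.+1)%N L) w' + (w' - w)) (child Q e).
  by rewrite tmeanD tmeanB tmean_cst.
have ww' : w <= w' by rewrite /w' le_max lexx.
have F0 e : 0 <= F e.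
  rewrite FE'; apply: tmean_ge0 => L _.
  by rewrite /Num.max; do 2 case: ltP => ?; lra.
rewrite FE; have [mw|wm] := leP m w.
  rewrite {1}/w' max_l// subrr mulr_ge0 ?(ltW D_gt0)//.
  by rewrite -(av_cst (n := n) 0); apply: ler_av.
have [e me] : exists e, m = t j.+1 (child Q e).
  have [e _ me] := @eq_bigmax _ R E 0 (zero_index (n := n)) xpredT
    (fun e => t j.+1 (child Q e)) isT (fun e _ => t0 _ _).
  by exists e.
apply: le_trans (ge0_av_ge e F0).
rewrite FE' -[leLHS](tmean_cst N _ (child Q e)); apply: ler_tmean => L ancL.
have w'm : w' = m by rewrite /w' max_r// ltW.
have : m <= t (j + N.+1)%N L by rewrite me -ancL -addSnnS path_mono.
rewrite -w'm => tL; rewrite !max_l//; last exact: le_trans tL.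
by rewrite subrr add0r.
Qed.

(** John-Nirenberg, for a square sum with small distribution function: stop at
    the first cube where the path sum from [Q] exceeds [t]. Before stopping the
    mean of the path sum is at most [t]; the stopped cubes fill at most half of
    [Q], and there the induction hypothesis applies. *)
Lemma john_nirenberg_distribution c (k0 : int) (t : R) : 0 <= t ->
  (forall Q, 0 <= c Q) ->
  (forall N Q, Q.1 <= k0 ->
    tmean N (fun L => (t < pathsum N.+1 c L)%R%:R : R) Q <= 2^-1) ->
  forall N Q, Q.1 <= k0 -> carl N c Q <= 2 * t.
Proof.
move=> t0 c0 H.
pose P N := forall Q, Q.1 <= k0 -> carl N c Q <= 2 * t.
(* [a] is the part of the path sum collected strictly above [Q]; the last term
   pays for the cubes below [Q] at which the sum passes [t] *)
pose bnd N (a : R) Q := carl N c Q <= t - a +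
  2 * t * tmean N (fun L => (t < a + pathsum N.+1 c L)%R%:R : R) Q.
pose A N := forall Q a, Q.1 <= k0 -> a <= t -> bnd N a Q.
have nonstop N Q (a : R) : (forall N', (N' < N)%N -> A N') -> Q.1 <= k0 ->
    a + c Q <= t -> bnd N a Q.
  case: N => [|N] AN Qk acQ; rewrite /bnd.
    have := tmean_ge0 (N := 0) (F := fun L => (t < a + pathsum 1 c L)%R%:R : R) (Q := Q).
    move=> /(_ (fun _ _ => ler0n _ _)); set X := tmean _ _ _.
    by rewrite /= addr0; nra.
  have h e : carl N c (child Q e) <= t - (a + c Q) + 2 * t *
      tmean N (fun L => (t < a + pathsum N.+2 c L)%R%:R : R) (child Q e).
    have ek : (child Q e).1 <= k0 by rewrite /=; lia.
    apply: le_trans (AN N (leqnn _) (child Q e) (a + c Q) ek acQ) _.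
    rewrite lerD2l ler_wpM2l ?mulr_ge0//; apply: ler_tmean => L ancL.
    rewrite (pathsumS_top N.+1).
    by rewrite [anc N.+1 L]iterS -/(anc N L) ancL childK -addrA [c Q + _]addrC.
  have := ler_av h; rewrite avD av_cst avZ.
  rewrite [carl N.+1 c Q]/= [tmean N.+1 _ Q]/=; set X := av _; set Y := av _; lra.
have top N Q (a : R) : t < a + c Q ->
    tmean N (fun L => (t < a + pathsum N.+1 c L)%R%:R : R) Q = 1.
  move=> tac; rewrite -[RHS](tmean_cst N 1 Q); apply: eq_tmean => L ancL.
  rewrite pathsumS_top ancL (lt_le_trans tac)//.
  by rewrite lerD2l lerDr pathsum_ge0.
have Pstep N : (forall N', (N' < N)%N -> A N') -> P N.
  move=> AN Q Qk; have := H N Q Qk; have [cQ|cQ] := leP (c Q) t.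
    have := nonstop N Q 0 AN Qk; rewrite add0r => /(_ cQ); rewrite /bnd.
    under eq_tmean => L _ do rewrite add0r.
    by set X := tmean _ _ _; nra.
  have := top N Q 0; rewrite add0r => /(_ cQ).
  under eq_tmean => L _ do rewrite add0r.
  by move=> -> h; exfalso; lra.
suff AN N : A N by move=> N; apply: Pstep.
elim/ltn_ind: N => N IH Q a Qk ta.
have [h|h] := leP (a + c Q) t; first exact: nonstop.
by rewrite /bnd top//; have := Pstep N IH Q Qk; lra.
Qed.

Lemma cabs_ge0 (z : R[i]) : 0 <= cabs z.
Proof. by case: z => a b; exact: sqrtr_ge0. Qed.

Lemma cabsM (z w : R[i]) : cabs (z * w) = cabs z * cabs w.
Proof. exact: ComplexField.Normc.normcM. Qed.

Lemma cabsD (z w : R[i]) : cabs (z + w) <= cabs z + cabs w.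
Proof. by rewrite -lecR rmorphD/=; exact: (ler_normD z w). Qed.

(** John-Nirenberg from mean oscillations [o]: stop at the first cube whose
    mean [beta] is further than [2 B] from the mean of the starting cube. The
    stopped cubes fill at most half of it, and a mean moves by at most
    [2 ^ n * B] in one generation, so the means up to and including the stopped
    ones stay within [(2 ^ n + 2) * B]. *)
Lemma john_nirenberg_oscillation c (beta : T -> R[i]) (o : R[i] -> T -> R) (B : R) :
  0 < B ->
  (forall z Q, o z Q = av (fun e => o z (child Q e))) ->
  (forall (z : R[i]) Q, cabs (beta Q - z) <= o z Q) ->
  (forall Q, o (beta Q) Q <= B) ->
  (forall (z : R[i]) Q, c Q + cabs (beta Q - z) ^+ 2 =
     av (fun e => cabs (beta (child Q e) - z) ^+ 2)) ->
  forall N Q, carl N c Q <= 2 * ((D + 2) * B) ^+ 2.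
Proof.
move=> B0 oav obeta oB cE; set lam := 2 * B; set Lam := (D + 2) * B.
have o0 z Q : 0 <= o z Q by exact: le_trans (cabs_ge0 _) (obeta _ _).
have Lam0 : 0 <= Lam by rewrite mulr_ge0 ?(ltW B0)// addr_ge0 ?(ltW D_gt0).
have LamE : Lam = lam + D * B by rewrite /Lam /lam; ring.
pose P N := forall Q, carl N c Q <= 2 * Lam ^+ 2.
(* [z] is the mean of the starting cube; by Chebyshev's inequality the last
   term pays for the cubes at which [beta] is further than [lam] from it *)
pose bnd N (z : R[i]) Q := carl N c Q + cabs (beta Q - z) ^+ 2 <=
  Lam ^+ 2 + Lam ^+ 2 / B * o z Q.
pose A N := forall Q (z : R[i]), cabs (beta Q - z) <= Lam -> bnd N z Q.
have LB0 : 0 <= Lam ^+ 2 / B by rewrite divr_ge0 ?sqr_ge0 ?ltW.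
have nonstop N Q z : (forall N', (N' < N)%N -> A N') ->
    cabs (beta Q - z) <= lam -> bnd N z Q.
  move=> AN Qz.
  have ez e : cabs (beta (child Q e) - z) <= Lam.
    rewrite LamE [lam + _]addrC -(subrKA (beta Q)).
    apply: le_trans (cabsD _ _) _; apply: lerD => //.
    apply: le_trans (obeta (beta Q) (child Q e)) _.
    apply: le_trans (ge0_av_ge (u := fun e => o (beta Q) (child Q e)) e _) _ => //.
    by rewrite -oav ler_pM2l.
  case: N AN => [|N] AN; rewrite /bnd.
    rewrite /= addr0 cE; apply: (@le_trans _ _ (Lam ^+ 2)); last first.
      by rewrite lerDl mulr_ge0.
    rewrite -(av_cst (n := n) (Lam ^+ 2)); apply: ler_av => e.
    by rewrite ler_sqr ?nnegrE ?cabs_ge0.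
  rewrite carlS addrAC cE -avD oav -avZ -{1}(av_cst (n := n) (Lam ^+ 2)) -avD.
  by apply: ler_av => e; rewrite addrC; exact: AN.
have Pstep N : (forall N', (N' < N)%N -> A N') -> P N.
  move=> AN Q; have := nonstop N Q (beta Q) AN; rewrite subrr.
  rewrite (_ : cabs 0 = 0); last exact: ComplexField.Normc.normc0.
  rewrite (_ : 0 <= lam); last by rewrite /lam mulr_ge0// ltW.
  move=> /(_ isT); rewrite /bnd subrr.
  rewrite (_ : cabs 0 = 0); last exact: ComplexField.Normc.normc0.
  rewrite expr0n addr0 => /le_trans; apply.
  rewrite mulrDl mul1r lerD2l.
  by apply: le_trans (ler_wpM2l LB0 (oB Q)) _; rewrite divfK ?gt_eqF.
suff AN N : A N by move=> N; apply: Pstep.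
elim/ltn_ind: N => N IH Q z Qz.
have [h|h] := leP (cabs (beta Q - z)) lam; first exact: nonstop.
rewrite /bnd addrC; apply: lerD; first by rewrite ler_sqr ?nnegrE ?cabs_ge0.
apply: le_trans (Pstep N IH Q) _.
have : lam <= o z Q by apply: le_trans (obeta z Q); exact: ltW.
move=> /(ler_wpM2l LB0); rewrite /lam.
rewrite (_ : _ * (2 * B) = 2 * Lam ^+ 2)//; by field; rewrite gt_eqF.
Qed.

End tree_inequalities.

(** * Half-open dyadic cubes *)

Section half_open_cubes.
Context {R : realType} {n : nat}.
Local Notation T := (dyadic_cube n).
Local Notation E := (n.-tuple bool).
Local Notation mu := (@lebesgue_tuple R n).
Implicit Types (Q : T) (x : Rn R n) (k : int).

(** With half-open cubes exactly one cube of each generation contains a given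
    point, so that a point is a branch of the tree of cubes. *)
Definition node k x : T :=
  (k, [tuple Num.floor (2 ^ (- k) * tnth x j : R) | j < n]).

Definition hcube Q : set (Rn R n) := [set x | node Q.1 x = Q].

Let exp2_gt0 k : 0 < (2 ^ k : R). Proof. exact: exprz_gt0. Qed.

Lemma hcubeP Q x : hcube Q x <-> forall j,
  2 ^ Q.1 * (tnth Q.2 j)%:~R <= (tnth x j : R) < 2 ^ Q.1 * ((tnth Q.2 j)%:~R + 1).
Proof.
have flE j (m : int) : (Num.floor (2 ^ (- Q.1) * tnth x j : R) == m) =
    (2 ^ Q.1 * m%:~R <= (tnth x j : R) < 2 ^ Q.1 * (m%:~R + 1)).
  rewrite floor_eq intrD.
  by rewrite -invr_expz ler_pdivlMl// ltr_pdivrMl// rmorph1.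
case: Q flE => k m /= flE; split.
  move=> [xm] j; rewrite -flE.
  by apply/eqP; move: (congr1 (fun t => tnth t j) xm); rewrite tnth_mktuple.
move=> h; congr pair; apply: eq_from_tnth => j; rewrite tnth_mktuple.
by apply/eqP; rewrite flE.
Qed.

Lemma parent_node k x : parent (node k x) = node (k + 1) x.
Proof.
rewrite /parent /node/=; congr pair; apply: eq_from_tnth => j.
rewrite !tnth_mktuple; set y := tnth x j.
set m := Num.floor _.
have /andP[m1 m2] : m%:~R <= (2 ^ (- k) * y : R) < (m + 1)%:~R.
  by rewrite /m floor_le_tmp ?floorD1_gt.
apply/esym/eqP; rewrite floor_eq.
have -> : 2 ^ (- (k + 1)) * y = (2 ^ (- k) * y : R) / 2.
  by rewrite opprD expfzDr// -[2 ^ (-1)]/(2^-1); ring.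
rewrite ler_pdivlMr// ltr_pdivrMr//.
have h1 : 2 * (m %/ 2)%Z <= m by lia.
have h2 : m + 1 <= 2 * (m %/ 2)%Z + 2 by lia.
move: h1 h2; rewrite -(ler_int R) => h1; rewrite -(ler_int R) => h2.
move: h1 h2 m2; rewrite !intrD !intrM; lra.
Qed.

Lemma anc_node j k x : anc j (node k x) = node (k + j%:Z) x.
Proof.
elim: j => [|j IH]; first by rewrite addr0.
by rewrite /anc iterS -/(anc _ _) IH parent_node; congr node; lia.
Qed.

Lemma hcube_node k x : hcube (node k x) x. Proof. by []. Qed.

Lemma hcube_anc j Q x : hcube Q x -> hcube (anc j Q) x.
Proof. by rewrite /hcube/= => <-; rewrite anc_node /=. Qed.

Lemma hcube_child Q x : hcube Q x <-> exists e, hcube (child Q e) x.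
Proof.
split=> [Qx|[e xe]]; last by rewrite -(childK Q e); exact: (@hcube_anc 1).
exists (digit (node (Q.1 - 1) x)).
set P := node (Q.1 - 1) x.
have PQ : parent P = Q by rewrite parent_node subrK.
by rewrite -{1}PQ parentK.
Qed.

Definition box (A : 'I_n -> set (measurableTypeR R)) : set (Rn R n) :=
  [set x | forall j, A j (tnth x j)].

Lemma measurable_box A : (forall j, measurable (A j)) -> measurable (box A).
Proof.
move=> mA; rewrite (_ : box A = \bigcap_(j in [set: 'I_n])
    ((@tnth n (measurableTypeR R))^~ j @^-1` A j)).
  apply: fin_bigcap_measurable => // j _.
  by rewrite -[X in measurable X]setTI; exact: measurable_tnth.
by apply/seteqP; split=> x /=; [move=> + j _|move=> + j]; apply.
Qed.

Let lohi Q j := (2 ^ Q.1 * (tnth Q.2 j)%:~R : R, 2 ^ Q.1 * ((tnth Q.2 j)%:~R + 1) : R).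

Let lohi_lt Q j : (lohi Q j).1 < (lohi Q j).2.
Proof. by rewrite /lohi/= ltr_pM2l// ltrDl. Qed.

Let cubeE Q : cube Q = box (fun j => `[(lohi Q j).1, (lohi Q j).2]%classic).
Proof.
apply/seteqP; split => x /= + j => /(_ j);
  by rewrite /dyadic_itv /= in_itv.
Qed.

Let hcubeE Q : hcube Q = box (fun j => `[(lohi Q j).1, (lohi Q j).2[%classic).
Proof.
apply/seteqP; split => x /=.
  by move=> /hcubeP + j => /(_ j); rewrite /= in_itv.
by move=> h; apply/hcubeP => j; have := h j; rewrite /= in_itv.
Qed.

Lemma measurable_cube Q : measurable (cube Q : set (Rn R n)).
Proof. by rewrite cubeE; apply: measurable_box => j; exact: measurable_itv. Qed.

Lemma measurable_hcube Q : measurable (hcube Q).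
Proof. by rewrite hcubeE; apply: measurable_box => j; exact: measurable_itv. Qed.

Lemma hcube_cube Q : hcube Q `<=` cube Q.
Proof.
move=> x /hcubeP Qx j.
by have /andP[h1 h2] := Qx j; apply/andP; split=> //; exact: ltW.
Qed.

Let mu_box Q (b : bool) :
  mu (box (fun j => [set` Interval (BLeft (lohi Q j).1) (BSide b (lohi Q j).2)]))
  = ((2 ^ Q.1) ^+ n)%:E.
Proof.
rewrite lebesgue_tuple_box; last by move=> j; exact: measurable_itv.
rewrite (eq_bigr (fun=> (2 ^ Q.1 : R)%:E)); last first.
  move=> j _; rewrite lebesgue_measure_itv /= lte_fin lohi_lt -EFinB /lohi/=.
  by congr EFin; ring.
by rewrite prodEFin prodr_const card_ord.
Qed.

Lemma mu_cube Q : mu (cube Q) = ((2 ^ Q.1) ^+ n)%:E.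
Proof. by rewrite cubeE; exact: (mu_box Q false). Qed.

Lemma volE Q : vol Q = (2 ^ Q.1 : R) ^+ n.
Proof. by rewrite /vol mu_cube. Qed.

Lemma mu_hcube Q : mu (hcube Q) = (vol Q)%:E.
Proof. by rewrite hcubeE volE; exact: (mu_box Q true). Qed.

Lemma vol_gt0 Q : 0 < vol Q :> R.
Proof. by rewrite volE exprn_gt0. Qed.

Lemma vol_child Q e : vol (child Q e) = vol Q / 2 ^+ n :> R.
Proof.
by rewrite !volE /= expfzDr// -[2 ^ (-1)]/(2^-1) exprMn exprVn.
Qed.

Lemma vol_side Q : vol Q = side Q ^+ n :> R. Proof. exact: volE. Qed.

(** Off this null set a point lies in the same dyadic cubes whether they are
    taken closed or half-open. *)
Definition dyadic_boundary : set (Rn R n) :=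
  \bigcup_(Q in [set: T]) (cube Q `\` hcube Q).

Lemma countable_dyadic_cube : countable [set: T].
Proof. exact: (@countableP (int * n.-tuple int)%type). Qed.

Let diff0 Q : mu (cube Q `\` hcube Q) = 0%E.
Proof.
rewrite measureD; [|exact: measurable_cube|exact: measurable_hcube|];
  last by rewrite [X in (X < _)%E]mu_cube ltry.
rewrite (setIidr (@hcube_cube Q)) [X in (_ - X)%E]mu_hcube [X in (X - _)%E]mu_cube.
by rewrite volE -EFinB subrr.
Qed.

Lemma measurable_dyadic_boundary : measurable dyadic_boundary.
Proof.
apply: countable_bigcupT_measurable; first exact: countable_dyadic_cube.
move=> Q; apply: measurableD; [exact: measurable_cube|exact: measurable_hcube].
Qed.

Lemma dyadic_boundary0 : mu dyadic_boundary = 0%E.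
Proof.
have : mu.-negligible dyadic_boundary.
  rewrite /dyadic_boundary.
  pose F (i : nat) := if @unpickle (int * n.-tuple int)%type i is Some Q
    then cube Q `\` hcube Q else set0.
  have FE : \bigcup_(Q in [set: T]) (cube Q `\` hcube Q) = \bigcup_i F i.
    apply/seteqP; split=> x [].
      move=> Q _ Qx; exists (@pickle (int * n.-tuple int)%type Q); first by [].
      by rewrite /F pickleK.
    by rewrite /F => i _; case: unpickle => // Q Qx; exists Q.
  rewrite FE; apply: negligible_bigcup => i; rewrite /F.
  case: unpickle => [Q|]; last exact: negligible_set0.
  apply/negligibleP; last exact: diff0.
  by apply: measurableD; [exact: measurable_cube|exact: measurable_hcube].
by move/negligibleP; apply; exact: measurable_dyadic_boundary.
Qed.

Lemma cube_hcube x Q : ~ dyadic_boundary x -> cube Q x -> hcube Q x.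
Proof. by move=> xN Qx; apply: contrapT => nQx; apply: xN; exists Q. Qed.

Lemma ae_cubeE (P : Rn R n -> Prop) :
  (forall x, (forall Q, cube Q x -> hcube Q x) -> P x) -> {ae mu, forall x, P x}.
Proof.
move=> h; exists dyadic_boundary; split; first exact: measurable_dyadic_boundary.
  exact: dyadic_boundary0.
by move=> x nPx; apply: contrapT => xN; apply: nPx; apply: h => Q; exact: cube_hcube.
Qed.

Lemma hcubeU Q : hcube Q = \big[setU/set0]_(e : E) hcube (child Q e).
Proof.
apply/seteqP; split => x.
  move=> /hcube_child[e xe]; rewrite -bigcup_seq; exists e => //=.
  exact: mem_index_enum.
by rewrite -bigcup_seq => -[e _ xe]; apply/hcube_child; exists e.
Qed.

Lemma trivIset_children Q (A : set E) : trivIset A (fun e => hcube (child Q e)).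
Proof.
move=> e e' _ _ [x [/= xe xe']].
by have := congr1 digit (etrans (esym xe) xe'); rewrite !digit_child.
Qed.

Lemma ge0_integral_hcube Q (f : Rn R n -> \bar R) :
  measurable_fun (hcube Q) f -> (forall x, hcube Q x -> 0 <= f x)%E ->
  (\int[mu]_(x in hcube Q) f x = \sum_(e : E) \int[mu]_(x in hcube (child Q e)) f x)%E.
Proof.
move=> mf f0; rewrite {1}hcubeU ge0_integral_bigsetU//.
- by move=> e; exact: measurable_hcube.
- exact: index_enum_uniq.
- exact: trivIset_children.
- by rewrite -hcubeU.
- by move=> x; rewrite -hcubeU; exact: f0.
Qed.

Lemma integral_hcube Q (f : Rn R n -> R) :
  measurable_fun (hcube Q) f ->
  (\int[mu]_(x in hcube Q) (f x)%:E =
   \sum_(e : E) \int[mu]_(x in hcube (child Q e)) (f x)%:E)%E.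
Proof.
move=> mf; rewrite {1}hcubeU integral_bigsetU_EFin//.
- by move=> e; exact: measurable_hcube.
- exact: index_enum_uniq.
- exact: trivIset_children.
- by rewrite -hcubeU; apply/measurable_EFinP.
Qed.

Lemma integral_cube Q (f : Rn R n -> \bar R) :
  mu.-integrable (cube Q) f ->
  (\int[mu]_(x in cube Q) f x = \int[mu]_(x in hcube Q) f x)%E.
Proof.
move=> mf; rewrite (negligible_integral _ _ _ (diff0 Q))//.
- by rewrite setDD (setIidr (@hcube_cube Q)).
- by apply: measurableD; [exact: measurable_cube|exact: measurable_hcube].
- exact: measurable_cube.
Qed.

Lemma measurable_node (F : T -> R) k : measurable_fun [set: Rn R n] (fun x => F (node k x)).
Proof.
move=> _ B mB; rewrite setTI.
have -> : (fun x => F (node k x)) @^-1` B =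
    \bigcup_(Q in [set: T])
      (if asbool (Q.1 = k /\ B (F Q)) then hcube Q else set0).
  apply/seteqP; split=> x /=.
    by move=> Bx; exists (node k x) => //; rewrite asboolT.
  move=> [Q _]; case: asboolP => // -[Qk BQ].
  by rewrite /hcube /= Qk => ->.
apply: countable_bigcupT_measurable; first exact: countable_dyadic_cube.
by move=> Q; case: ifP => _; [exact: measurable_hcube|exact: measurable0].
Qed.

(** The passage from integrals over space to averages over finite trees. *)
Lemma integral_node (F : T -> R) N Q :
  (\int[mu]_(x in hcube Q) (F (node (Q.1 - N%:Z) x))%:E = (vol Q * tmean N F Q)%:E)%E.
Proof.
elim: N Q => [|N IH] Q /=.
  rewrite (eq_integral (fun=> (F Q)%:E)); last first.
    by move=> x; rewrite inE subr0 => ->.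
  rewrite (integral_cst mu (measurable_hcube Q) (F Q)%:E).
  by rewrite [X in (_ * X)%E]mu_hcube -EFinM mulrC.
rewrite integral_hcube; last by apply: measurable_funTS; exact: measurable_node.
under eq_bigr => e _.
  rewrite (_ : Q.1 - N.+1%:Z = (child Q e).1 - N%:Z); last by rewrite /=; lia.
  rewrite IH vol_child.
  over.
rewrite sumEFin /av; congr EFin.
by rewrite -mulr_sumr; ring.
Qed.

End half_open_cubes.

(** * Square and maximal functions along the chain of cubes of a point *)

Section square_maximal.
Context {R : realType} {n : nat}.
Local Notation T := (dyadic_cube n).
Local Notation E := (n.-tuple bool).
Local Notation mu := (@lebesgue_tuple R n).
Implicit Types (Q : T) (x : Rn R n) (k : int) (g : dyadic_distribution R n).

(** The normalization makes the square of the square function the sum of the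
    energies of the cubes that contain the point. *)
Definition energy g Q : R := (\sum_i cabs (g Q i) ^+ 2) / vol Q.

Lemma energy_ge0 g Q : 0 <= energy g Q.
Proof. by rewrite divr_ge0 ?(ltW (vol_gt0 _))// sumr_ge0// => i _; rewrite sqr_ge0. Qed.

Definition square_sum g x : \bar R :=
  (\esum_(Q in [set: T]) (energy g Q * \1_(cube Q) x)%:E)%E.

Lemma square_functionE g x : square_function g x = (square_sum g x `^ 2^-1)%E.
Proof.
rewrite /square_function; congr (_ `^ _)%E; apply: eq_esum => Q _.
rewrite sumEFin /energy !mulr_suml; congr EFin.
by apply: eq_bigr => i _; rewrite mulrAC.
Qed.

Lemma square_sum_ge0 g x : (0 <= square_sum g x)%E.
Proof. by apply: esum_ge0 => Q _; rewrite lee_fin mulr_ge0// energy_ge0. Qed.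

Lemma pathsum_node (c : T -> R) J k x :
  pathsum J c (node k x) = \sum_(0 <= j < J) c (node (k + j%:Z) x).
Proof.
elim: J => [|J IH]; first by rewrite big_geq.
by rewrite pathsumS_top big_nat_recr//= -IH anc_node.
Qed.

Let nodes k J x := [seq node (k + j%:Z) x | j <- iota 0 J].

Let uniq_nodes k J x : uniq (nodes k J x).
Proof. by rewrite map_inj_uniq ?iota_uniq// => i j [] /addrI []. Qed.

Let sum_nodes g k J x :
  (\sum_(Q \in [set` nodes k J x]) (energy g Q * \1_(cube Q) x)%:E)%E =
  (pathsum J (energy g) (node k x))%:E.
Proof.
rewrite -fsbig_seq// big_map pathsum_node -sumEFin /index_iota subn0.
apply: eq_bigr => j _.
by rewrite indicE mem_set ?mulr1//; apply: hcube_cube; exact: hcube_node.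
Qed.

Lemma pathsum_le_square_sum g J k x :
  ((pathsum J (energy g) (node k x))%:E <= square_sum g x)%E.
Proof.
apply: esum_ge; exists [set` nodes k J x]; first by split => //; exact: finite_seq.
by rewrite sum_nodes.
Qed.

(** Off the boundaries of the cubes, only those of the chain of [x] count. *)
Lemma square_sum_le g x (Y : \bar R) : (forall Q, cube Q x -> hcube Q x) ->
  (forall K : nat, (pathsum (K + K) (energy g) (node (- K%:Z) x))%:E <= Y)%E ->
  (square_sum g x <= Y)%E.
Proof.
move=> xN h; apply: ge_ereal_sup => _ [A [finA _] <-].
pose a Q := (energy g Q * \1_(cube Q) x)%:E.
have [K AK] : exists K : nat, forall Q, A Q -> (`|Q.1| < K)%N.
  have /finite_seqP[s AE] := finA.
  exists (\max_(Q <- s) `|Q.1|%N).+1 => Q; rewrite AE /= => Qs.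
  by rewrite ltnS; exact: leq_bigmax_seq.
apply: le_trans (h K); rewrite -sum_nodes.
have finB := finite_seq (nodes (- K%:Z) (K + K) x).
apply: (@le_trans _ _ (\sum_(Q \in A `|` [set` nodes (- K%:Z) (K + K) x]) a Q)%E).
  apply: lee_fsum_nneg_subset => //; first by rewrite finite_setU.
    by move=> Q; rewrite !inE => QA; left.
  by move=> Q _; rewrite lee_fin mulr_ge0// energy_ge0.
rewrite -(fsbig_widen [set` nodes (- K%:Z) (K + K) x])//.
move=> Q [[|//] QA Qn] /=; congr EFin; rewrite indicE.
case: (boolP (x \in cube Q)); last by rewrite mulr0.
rewrite inE => /xN Qx; exfalso; apply: Qn => /=.
have QK := AK Q QA.
apply/mapP; exists (absz (Q.1 + K%:Z)); first by rewrite mem_iota; lia.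
by rewrite -{1}Qx; congr node; lia.
Qed.

(** Enumerating the cubes turns the sum over all of them into a series. *)
Lemma measurable_square_sum g : measurable_fun [set: Rn R n] (square_sum g).
Proof.
pose U := (int * n.-tuple int)%type.
pose Q0 : U := (0, [tuple 0 | j < n]).
pose e i : T := odflt Q0 (@pickle_inv U i).
pose P := [set i | @pickle_inv U i] : set nat.
pose a Q x := (energy g Q * \1_(cube Q) x)%:E.
have ae x : square_sum g x = (\sum_(i <oo | @pickle_inv U i) a (e i) x)%E.
  rewrite nneseries_esum; last first.
    by move=> i _; rewrite lee_fin mulr_ge0// energy_ge0.
  rewrite /square_sum (@reindex_esum _ _ T P [set: T] e)//; split=> //.
    move=> i j; rewrite !inE /P /e /=.
    have := @pickle_invK U i; have := @pickle_invK U j.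
    by case: pickle_inv => [Q|//] /= <-; case: pickle_inv => [Q'|//] /= <- _ _ ->.
  move=> Q _; exists (@pickle U Q); rewrite /P /e /= pickleK_inv//.
rewrite (_ : square_sum g = fun x => (\sum_(i <oo | i \in P) a (e i) x)%E); last first.
  apply/funext => x; rewrite ae; apply: congr_lim; apply/funext => k.
  by apply: eq_bigl => i; rewrite /P mem_setE.
apply: ge0_emeasurable_sum => [i x _ _|i _].
  by rewrite lee_fin mulr_ge0// energy_ge0.
apply/measurable_EFinP; apply: measurable_funM => //.
by apply: measurable_indic; exact: measurable_cube.
Qed.

Lemma dotHp_normE p g : p != 0 ->
  dotHp_norm p g = ((\int[mu]_x square_sum g x `^ (p / 2)) `^ p^-1)%E.
Proof.
move=> p0; rewrite /dotHp_norm unlock; congr (_ `^ _)%E.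
apply: eq_integral => x _; rewrite square_functionE.
by rewrite gee0_abs ?poweR_ge0// -poweRrM mulrC.
Qed.

Lemma ge_maximal_function (f : Rn R n -> R[i]) k x :
  ((cabs (average f (node k x)))%:E <= maximal_function f x)%E.
Proof.
apply: ereal_sup_ubound; exists (node k x) => //=.
by apply: hcube_cube; exact: hcube_node.
Qed.

Lemma maximal_function_ge0 (f : Rn R n -> R[i]) x : (0 <= maximal_function f x)%E.
Proof. by apply: le_trans (ge_maximal_function f 0 x); rewrite lee_fin cabs_ge0. Qed.

Lemma measurable_maximal_function (f : Rn R n -> R[i]) :
  measurable_fun [set: Rn R n] (maximal_function f).
Proof.
pose U := (int * n.-tuple int)%type.
pose F i x : \bar R := if @unpickle U i is Some Q then
  (cabs (average f (Q : T)) * \1_(cube (Q : T)) x)%:E else 0%E.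
have mF i : measurable_fun [set: Rn R n] (F i).
  rewrite /F; case: unpickle => [Q|]; last exact: measurable_cst.
  apply/measurable_EFinP; apply: measurable_funM => //.
  by apply: measurable_indic; exact: measurable_cube.
rewrite (_ : maximal_function f = fun x => esups (F^~ x) 0%N).
  exact: measurable_fun_esups.
apply/funext => x; apply/eqP; rewrite eq_le; apply/andP; split.
  apply: ge_ereal_sup => _ [Q /= Qx <-]; apply: ereal_sup_ubound.
  exists (@pickle U Q) => //; rewrite /F pickleK indicE mem_set// mulr1//.
apply: ge_ereal_sup => _ [i _ <-]; rewrite /F.
case: unpickle => [Q|]; last exact: maximal_function_ge0.
rewrite indicE; case: (boolP (x \in _)) => [|_]; last first.
  by rewrite mulr0; exact: maximal_function_ge0.
by rewrite mulr1 inE => Qx; apply: ereal_sup_ubound; exists Q.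
Qed.

Lemma Hp_normE p (f : Rn R n -> R[i]) :
  Hp_norm p f = ((\int[mu]_x maximal_function f x `^ p) `^ p^-1)%E.
Proof.
rewrite /Hp_norm unlock; congr (_ `^ _)%E.
by apply: eq_integral => x _; rewrite gee0_abs ?maximal_function_ge0.
Qed.

(** The [2 ^ n] cubes of generation [K] that have the origin as a vertex: one
    in each orthant, and together they exhaust the space. *)
Definition corner (K : nat) (e : E) : T := (K%:Z, [tuple - (tnth e j : nat)%:Z | j < n]).

Definition central_box K : set (Rn R n) := \big[setU/set0]_(e : E) hcube (corner K e).

Lemma central_boxP K x : central_box K x <-> exists e, node K%:Z x = corner K e.
Proof.
rewrite /central_box -bigcup_seq; split=> [[e _ xe]|[e xe]]; first by exists e.
by exists e => //=; exact: mem_index_enum.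
Qed.

Lemma parent_corner K e : parent (corner K e) = corner K.+1 e.
Proof.
rewrite /parent /corner/=; congr pair; first by lia.
by apply: eq_from_tnth => j; rewrite !tnth_mktuple; case: (tnth e j).
Qed.

Lemma central_box_mono K x : central_box K x -> central_box K.+1 x.
Proof.
move=> /central_boxP[e xe]; apply/central_boxP; exists e.
by rewrite -parent_corner -xe parent_node; congr node; lia.
Qed.

Lemma central_box_bounded (a : R) : exists K,
  forall x, (forall j, `|tnth x j : R| <= a) -> central_box K x.
Proof.
exists (Num.bound `|a|) => x xa; set K := Num.bound _.
apply/central_boxP; exists [tuple (tnth x j : R) < 0 | j < n].
rewrite /node /corner; congr pair; apply: eq_from_tnth => j.
rewrite !tnth_mktuple; apply/eqP; rewrite floor_eq intrD.
have xK : `|tnth x j : R| < 2 ^+ K.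
  apply: le_lt_trans (xa j) _; apply: le_lt_trans (ler_norm a) _.
  apply: lt_le_trans (archi_boundP (normr_ge0 a)) _.
  by rewrite -natrX ler_nat ltnW// ltn_expl.
have K0 : 0 < (2 ^ K%:Z : R) by exact: exprz_gt0.
rewrite -invr_expz ler_pdivlMl// ltr_pdivrMl//.
move: xK; rewrite -exprnP in K0 *; rewrite lter_norml => /andP[x1 x2].
by case: (ltP (tnth x j : R) 0) => x0 /=; rewrite ?mulr0 ?oppr0 ?rmorph0 ?add0r ?mulr1 ?rmorphN1 ?mulrN1; apply/andP; split; lra.
Qed.

Lemma central_box_cover x : exists K, central_box K x.
Proof.
have [K hK] := central_box_bounded (\sum_j `|tnth x j : R|).
by exists K; apply: hK => j; rewrite (bigD1 j)//= lerDl sumr_ge0.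
Qed.

Lemma integral_central_box K (f : Rn R n -> \bar R) :
  measurable_fun [set: Rn R n] f -> (forall x, 0 <= f x)%E ->
  (\int[mu]_(x in central_box K) f x = \sum_(e : E) \int[mu]_(x in hcube (corner K e)) f x)%E.
Proof.
move=> mf f0; rewrite /central_box ge0_integral_bigsetU//.
- by move=> e; exact: measurable_hcube.
- exact: index_enum_uniq.
- move=> e e' _ _ [x [/= xe xe']]; apply: eq_from_tnth => j.
  have := congr1 (fun t : T => tnth t.2 j) (etrans (esym xe) xe').
  by rewrite !tnth_mktuple; case: (tnth e j); case: (tnth e' j).
- exact: measurable_funTS.
Qed.

Lemma measurable_central_box K : measurable (central_box K).
Proof. by apply: bigsetU_measurable => e _; exact: measurable_hcube. Qed.

(** Monotone convergence, exhausting the space by central boxes and the chain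
    of each point by finite pieces. *)
Lemma integral_square_sum_le g (s : R) (Y : \bar R) : 0 < s ->
  (forall K : nat, \sum_(e : E) \int[mu]_(x in hcube (corner K e))
     (pathsum (K + K) (energy g) (node (- K%:Z) x) `^ s)%:E <= Y)%E ->
  (\int[mu]_x square_sum g x `^ s <= Y)%E.
Proof.
move=> s0 hY.
pose F (K : nat) x := pathsum (K + K) (energy g) (node (- K%:Z) x).
have F0 K x : 0 <= F K x by apply: pathsum_ge0 => Q; exact: energy_ge0.
have FS K x : F K x <= F K.+1 x.
  rewrite /F; set L := node (- K.+1%:Z) x.
  rewrite (_ : pathsum (K.+1 + K.+1) (energy g) L =
    pathsum (K + K).+1 (energy g) (parent L) + energy g L); last by rewrite addnS.
  rewrite parent_node pathsumS_top.
  rewrite (_ : - K.+1%:Z + 1 = - K%:Z); last by lia.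
  by rewrite -addrA lerDl addr_ge0// energy_ge0.
pose G K x := ((F K x `^ s) * \1_(central_box K) x)%:E.
have mFs K : measurable_fun [set: Rn R n] (fun x => F K x `^ s).
  exact: (measurable_node (fun Q => pathsum (K + K) (energy g) Q `^ s)).
have mG K : measurable_fun [set: Rn R n] (G K).
  apply/measurable_EFinP; apply: measurable_funM => //.
  by apply: measurable_indic; exact: measurable_central_box.
have G0 K x : [set: Rn R n] x -> (0 <= G K x)%E by rewrite lee_fin mulr_ge0// powR_ge0.
have ndG x : [set: Rn R n] x -> nondecreasing_seq (G^~ x).
  move=> _; apply/nondecreasing_seqP => K; rewrite lee_fin.
  apply: ler_pM; rewrite ?powR_ge0//.
    by apply: ge0_ler_powR; rewrite ?nnegrE ?F0 ?FS ?ltW.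
  rewrite !indicE; case: (boolP (x \in _)) => //; rewrite inE => /central_box_mono xK.
  by rewrite mem_set.
have GE K : (\int[mu]_x G K x <= Y)%E.
  apply: le_trans (hY K); rewrite -(@integral_central_box K (fun x => (F K x `^ s)%:E)).
  - rewrite [leRHS]integral_mkcond; apply: ge0_le_integral => //.
    + exact: G0.
    + apply/(measurable_restrictT _ (measurable_central_box K)).
      by apply: measurable_funTS; apply/measurable_EFinP.
    + move=> x _; rewrite /G patchE indicE.
      by case: (x \in _); rewrite ?mulr1 ?mulr0.
  - exact/measurable_EFinP.
  - by move=> x; rewrite lee_fin powR_ge0.
apply: (@le_trans _ _ (\int[mu]_x limn (G^~ x))%E); last first.
  rewrite monotone_convergence//; apply: lime_le; last exact: nearW.
  apply: ereal_nondecreasing_is_cvgn => i j ij; apply: ge0_le_integral => //.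
    by move=> x _; exact: G0.
  by move=> x _; exact: ndG.
apply: ae_ge0_le_integral => //.
- by move=> x _; exact: poweR_ge0.
- apply: (measurableT_comp (measurable_poweR s)); exact: measurable_square_sum.
- move=> x _; apply: lime_ge; last by apply: nearW => K; exact: G0.
  exact/ereal_nondecreasing_is_cvgn/ndG.
- apply: (emeasurable_fun_cvg G) => [K|x _]; first exact: mG.
  exact/ereal_nondecreasing_is_cvgn/ndG.
- apply: ae_cubeE => x xN _.
  have Glim K : (G K x <= limn (G^~ x))%E.
    rewrite (cvg_lim _ (ereal_nondecreasing_cvgn (ndG x I)))//.
    by apply: ereal_sup_ubound; exists K.
  have lim0 : (0 <= limn (G^~ x))%E by apply: le_trans (Glim 0%N); exact: G0.
  case E : (limn (G^~ x)) lim0 => [y| |//] y0; last exact: leey.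
  have Fy K : F K x <= y `^ s^-1.
    have [K0 xK0] := central_box_cover x.
    have xK : central_box (K + K0) x.
      elim: (K) => [//|k IH]; rewrite addSn; exact: central_box_mono.
    have FK : F K x <= F (K + K0)%N x.
      elim: (K0) => [|k IH]; first by rewrite addn0.
      by rewrite addnS (le_trans IH).
    apply: le_trans FK _.
    have := Glim (K + K0)%N; rewrite E /G indicE mem_set// mulr1 lee_fin => Gy.
    rewrite -[leLHS](powRr1 (F0 _ _)) -(mulfV (lt0r_neq0 s0)) powRrM.
    by apply: ge0_ler_powR; rewrite ?nnegrE ?powR_ge0 ?invr_ge0 ?(ltW s0)//.
  have : (square_sum g x <= (y `^ s^-1)%:E)%E.
    by apply: square_sum_le => // K; rewrite lee_fin; exact: Fy.
  move=> /(le_poweR (ltW s0) (square_sum_ge0 _ _)) /le_trans; apply.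
  by rewrite poweR_EFin -powRrM mulVf ?gt_eqF// powRr1.
Qed.

End square_maximal.

(** * Averages and test functions *)

Section averages.
Context {R : realType} {n : nat}.
Local Notation T := (dyadic_cube n).
Local Notation E := (n.-tuple bool).
Local Notation mu := (@lebesgue_tuple R n).
Implicit Types (Q : T) (x : Rn R n) (k : int) (f : Rn R n -> R[i]) (h : Rn R n -> R).

Local Notation re f := (fun x => complex.Re (f x)).
Local Notation im f := (fun x => complex.Im (f x)).

Definition mean h Q : R := (vol Q)^-1 * (\int[mu]_(x in hcube Q) h x).

Lemma mean_child h Q : mu.-integrable (hcube Q) (EFin \o h) ->
  mean h Q = av (fun e => mean h (child Q e)).
Proof.
move=> ih; have mh : measurable_fun (hcube Q) h.
  by apply/measurable_EFinP; case/integrableP : ih.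
rewrite /mean /av /Rintegral integral_hcube// -sum_fine.
  rewrite mulr_sumr mulr_suml; apply: eq_bigr => e _.
  rewrite vol_child invfM invrK -!mulrA; congr (_ * _).
  by rewrite mulrCA divff ?mulr1// gt_eqF// exprn_gt0.
move=> e _; apply: integrable_fin_num; first exact: measurable_hcube.
apply: integrableS ih => //; [exact: measurable_hcube|exact: measurable_hcube|].
by move=> x xe; apply/hcube_child; exists e.
Qed.

Lemma cube_bounded Q : exists a : R, cube Q `<=` [set x : Rn R n | forall j, `|tnth x j : R| <= a].
Proof.
pose B j : R := `|2 ^ Q.1 * (tnth Q.2 j)%:~R| + `|2 ^ Q.1 * ((tnth Q.2 j)%:~R + 1)|.
exists (\sum_j B j) => x Qx j.
have B0 i : 0 <= B i by rewrite addr_ge0.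
apply: (@le_trans _ _ (B j)); last by rewrite (bigD1 j)//= lerDl sumr_ge0.
have /andP[x1 x2] : 2 ^ Q.1 * (tnth Q.2 j)%:~R <= (tnth x j : R) <= 2 ^ Q.1 * ((tnth Q.2 j)%:~R + 1) := Qx j.
rewrite /B; move: x1 x2; set a := 2 ^ _ * _; set b := 2 ^ _ * _ => x1 x2.
have := ler_norm b; have := ler_norm (- a); rewrite normrN.
have := normr_ge0 a; have := normr_ge0 b.
by rewrite ler_norml => *; apply/andP; split; lra.
Qed.

Lemma measurable_bounded_box (a : R) :
  measurable [set x : Rn R n | forall j, `|tnth x j : R| <= a].
Proof.
rewrite (_ : [set _ | _] = box (fun j => `[- a, a]%classic)).
  by apply: measurable_box => j; exact: measurable_itv.
apply/seteqP; split => x /= + j => /(_ j);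
  by rewrite /= in_itv /= ler_norml.
Qed.

Lemma locally_integrable_cube f Q : locally_integrable_Rn f ->
  mu.-integrable (cube Q) (EFin \o (re f)) /\
  mu.-integrable (cube Q) (EFin \o (im f)).
Proof.
move=> lf; have [a Qa] := cube_bounded Q; have [ire iim] := lf a.
split; [apply: integrableS ire|apply: integrableS iim] => //;
  by [exact: measurable_bounded_box|exact: measurable_cube].
Qed.

Lemma locally_integrable_hcube f Q : locally_integrable_Rn f ->
  mu.-integrable (hcube Q) (EFin \o (re f)) /\
  mu.-integrable (hcube Q) (EFin \o (im f)).
Proof.
move=> /(locally_integrable_cube Q)[ire iim].
by split; [apply: integrableS ire|apply: integrableS iim] => //;
  [exact: measurable_cube|exact: measurable_hcube|exact: hcube_cube
  |exact: measurable_cube|exact: measurable_hcube|exact: hcube_cube].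
Qed.

Lemma averageE f Q : locally_integrable_Rn f ->
  average f Q = Complex (mean (re f) Q) (mean (im f) Q).
Proof.
move=> /(locally_integrable_cube Q)[ire iim].
rewrite /average /cintegral /mean /Rintegral.
rewrite (integral_cube ire) (integral_cube iim).
by apply/eqP; rewrite eq_complex /= !mul0r subr0 addr0 !eqxx.
Qed.

Lemma energy_paraproduct (g : dyadic_distribution R n) f Q :
  energy (paraproduct g f) Q = cabs (average f Q) ^+ 2 * energy g Q.
Proof.
rewrite /energy mulrA mulr_sumr; congr (_ / _); apply: eq_bigr => i _.
by rewrite /paraproduct cabsM exprMn.
Qed.

Lemma cabs_real (a : R) : cabs (a%:C)%C = `|a|.
Proof. by rewrite /cabs /= expr0n/= addr0 sqrtr_sqr. Qed.

End averages.

Section test_functions.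
Context {R : realType} {n : nat}.
Local Notation T := (dyadic_cube n).
Local Notation E := (n.-tuple bool).
Local Notation mu := (@lebesgue_tuple R n).
Implicit Types (Q L : T) (x : Rn R n) (k : int).
Variables (P0 : T) (N : nat) (v : nat -> T -> R) (W : T -> R).
Hypothesis v0 : forall Q, v 0 Q = 0.
Hypothesis vav : forall j Q, av (fun e => v j.+1 (child Q e)) = v j Q.
Hypothesis vW : forall j L, (j <= N)%N -> anc N L = P0 -> `|v j (anc (N - j) L)| <= W L.

Let leaf := P0.1 - N%:Z.
Let Phi (L : T) : R := if anc N L == P0 then v N L else 0.

(** The function whose averages over the cubes [j] generations below [P0] are
    the numbers [v j], frozen after [N] generations. *)
Definition test_function (x : Rn R n) : R[i] := (Phi (node leaf x))%:C%C.

Let W0 L : anc N L = P0 -> 0 <= W L.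
Proof. by move=> aL; apply: le_trans (vW (leqnn N) aL). Qed.

Let anc_leaf x : anc N (node leaf x) = node P0.1 x.
Proof. by rewrite anc_node /leaf subrK. Qed.

Let tmean_v i j Q : tmean i (v (j + i)) Q = v j Q.
Proof.
elim: i j Q => [|i IH] j Q; first by rewrite addn0.
by rewrite /= -vav; apply: eq_av => e; rewrite -addSnnS IH.
Qed.

Let tmean_Phi i Q : (i <= N)%N ->
  tmean i Phi Q = if anc (N - i) Q == P0 then v (N - i) Q else 0.
Proof.
move=> iN; have ancE L : anc i L = Q -> anc N L = anc (N - i) Q.
  by move=> <-; rewrite -ancD subnK.
case: eqP => aQ.
  rewrite -(tmean_v i) subnK//; apply: eq_tmean => L /ancE.
  by rewrite aQ /Phi => ->; rewrite eqxx.
rewrite -[RHS](tmean_cst i 0 Q); apply: eq_tmean => L /ancE.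
by rewrite /Phi => ->; case: eqP.
Qed.

Let tmean_Phi_top i Q : tmean (N + i) Phi Q = 0.
Proof.
rewrite addnC tmeanDn -[RHS](tmean_cst i 0 Q); apply: eq_tmean => L _.
by rewrite tmean_Phi// subnn v0 /=; case: ifP.
Qed.

Let phi x := Phi (node leaf x).

Let mphi : measurable_fun [set: Rn R n] phi.
Proof. exact: measurable_node. Qed.

Let int_norm_phi : (\int[mu]_x `|(phi x)%:E| < +oo)%E.
Proof.
rewrite (_ : (\int[mu]_x `|(phi x)%:E| = \int[mu]_(x in hcube P0) `|(phi x)%:E|)%E).
  rewrite (integral_node (fun L => `|Phi L|)).
  exact: ltry.
rewrite [RHS]integral_mkcond; apply: eq_integral => x _.
rewrite patchE; case: ifPn => //; rewrite notin_setE /hcube /= => xP.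
by rewrite /phi /Phi anc_leaf; case: eqP => //; rewrite normr0.
Qed.

Lemma test_locally_integrable : locally_integrable_Rn test_function.
Proof.
have ip : mu.-integrable [set: Rn R n] (EFin \o phi).
  by apply/integrableP; split => //; exact/measurable_EFinP.
move=> a; split.
  by apply: integrableS ip => //; exact: measurable_bounded_box.
rewrite (_ : (fun x => _) = cst 0%E) //.
exact: integrable0.
Qed.

Let mean_phi k x : mean phi (node k x) =
  if k <= leaf then phi x else tmean (absz (k - leaf)%R) Phi (node k x).
Proof.
case: ifPn => [kl|].
  rewrite /mean /Rintegral (eq_integral (fun=> (phi x)%:E)); last first.
    move=> y; rewrite inE => yx; congr EFin; rewrite /phi.
    have e z : node leaf z = anc (absz (leaf - k)%R) (node k z).
      by rewrite anc_node; congr node; lia.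
    by rewrite !e -[in RHS]yx.
  rewrite (integral_cst mu (measurable_hcube _) (phi x)%:E).
  rewrite [X in (_ * X)%E]mu_hcube /= mulrCA mulVf ?mulr1//.
  by rewrite gt_eqF// vol_gt0.
rewrite -ltNge => lk.
have -> : phi = fun y => Phi (node ((node k x).1 - (absz (k - leaf)%R)%:Z) y).
  by apply/funext => y; rewrite /phi; congr (Phi (node _ y)); rewrite /=; lia.
rewrite /mean /Rintegral integral_node /= mulrA mulVf ?mul1r//.
by rewrite gt_eqF// vol_gt0.
Qed.

Lemma test_averageE Q : average test_function Q = (mean phi Q)%:C%C.
Proof.
rewrite averageE; last exact: test_locally_integrable.
apply/eqP; rewrite eq_complex /= eqxx /=.
by rewrite /mean /Rintegral integral0 mulr0.
Qed.

Let mean_test_top k x : P0.1 <= k -> mean phi (node k x) = 0.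
Proof.
move=> Pk; rewrite mean_phi; have tP : leaf <= P0.1 by rewrite /leaf; lia.
case: ifPn => [kl|kl]; last first.
  by rewrite (_ : absz (k - leaf)%R = (N + absz (k - P0.1)%R)%N) ?tmean_Phi_top// /leaf; lia.
have NE : N = 0%N by rewrite /leaf in kl; lia.
by rewrite /phi /Phi NE v0; case: ifP.
Qed.

Let mean_test_below j x : (j <= N)%N ->
  mean phi (node (P0.1 - j%:Z) x) =
  if node P0.1 x == P0 then v j (node (P0.1 - j%:Z) x) else 0.
Proof.
move=> jN; rewrite mean_phi; case: ifPn => [kl|kl].
  have -> : j = N by rewrite /leaf in kl; lia.
  by rewrite /phi /Phi anc_leaf.
rewrite (_ : absz (P0.1 - j%:Z - leaf)%R = (N - j)%N); last by rewrite /leaf; lia.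
rewrite tmean_Phi ?leq_subr// subKn// anc_node.
by rewrite (_ : P0.1 - j%:Z + j%:Z = P0.1)//; lia.
Qed.

Lemma test_average j x : (j <= N)%N -> hcube P0 x ->
  average test_function (node (P0.1 - j%:Z) x) = (v j (node (P0.1 - j%:Z) x))%:C%C.
Proof. by move=> jN Px; rewrite test_averageE mean_test_below// Px eqxx. Qed.

Let node_leaf j x : (j <= N)%N -> node (P0.1 - j%:Z) x = anc (N - j) (node leaf x).
Proof. by move=> jN; rewrite anc_node; congr node; rewrite /leaf; lia. Qed.

(** Above the starting cube the averages vanish because [v 0] does, and below
    the last generation the function is constant on cubes. *)
Lemma test_maximal x : (forall Q, cube Q x -> hcube Q x) ->
  (maximal_function test_function x <=
   (if node P0.1 x == P0 then W (node leaf x) else 0)%:E)%E.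
Proof.
move=> xN; apply: ge_ereal_sup => _ [Q /xN Qx <-]; rewrite lee_fin.
rewrite test_averageE cabs_real -Qx.
case: eqP => xP; last first.
  have [/mean_test_top ->|QP] := leP P0.1 Q.1; first by rewrite normr0.
  have [NQ|NQ] := leP (P0.1 - N%:Z) Q.1.
    rewrite (_ : Q.1 = P0.1 - (absz (P0.1 - Q.1)%R)%:Z); last by lia.
    rewrite mean_test_below; last by lia.
    by case: eqP => // _; rewrite normr0.
  rewrite mean_phi (_ : Q.1 <= leaf); last by rewrite /leaf; lia.
  by rewrite /phi /Phi anc_leaf; case: eqP => //; rewrite normr0.
have aN : anc N (node leaf x) = P0 by rewrite anc_leaf.
have [/mean_test_top ->|QP] := leP P0.1 Q.1; first by rewrite normr0 W0.
have [NQ|NQ] := leP (P0.1 - N%:Z) Q.1.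
  rewrite (_ : Q.1 = P0.1 - (absz (P0.1 - Q.1)%R)%:Z); last by lia.
  have jN : (absz (P0.1 - Q.1)%R <= N)%N by lia.
  by rewrite mean_test_below// xP eqxx node_leaf// vW.
rewrite mean_phi (_ : Q.1 <= leaf); last by rewrite /leaf; lia.
rewrite /phi /Phi anc_leaf xP eqxx.
by have := vW (leqnn N) aN; rewrite subnn.
Qed.

Lemma test_maximal_int (p : R) : 0 < p ->
  (\int[mu]_x maximal_function test_function x `^ p <=
   (vol P0 * tmean N (fun L => W L `^ p) P0)%:E)%E.
Proof.
move=> p0; pose G L := if anc N L == P0 then W L `^ p else 0.
have G0 L : 0 <= G L by rewrite /G; case: ifP => // _; exact: powR_ge0.
rewrite (_ : tmean N _ P0 = tmean N G P0); last first.
  by apply: eq_tmean => L aL; rewrite /G aL eqxx.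
rewrite -integral_node -/leaf.
rewrite [leRHS](_ : _ = \int[mu]_x (G (node leaf x))%:E)%E; last first.
  rewrite integral_mkcond; apply: eq_integral => x _.
  rewrite patchE; case: ifPn => //; rewrite notin_setE /hcube /= => xP.
  by rewrite /G anc_leaf; case: eqP.
apply: ae_ge0_le_integral => //.
- by move=> x _; exact: poweR_ge0.
- exact: measurableT_comp (measurable_poweR p) (measurable_maximal_function _).
- by move=> x _; rewrite lee_fin.
- by apply/measurable_EFinP; exact: measurable_node.
- apply: ae_cubeE => x xN _; have := test_maximal xN.
  move=> /(le_poweR (ltW p0) (maximal_function_ge0 _ _)) /le_trans; apply.
  rewrite poweR_EFin lee_fin /G anc_leaf; case: eqP => // _.
  by rewrite powR0 ?gt_eqF.
Qed.

(** What boundedness of a paraproduct says when it is tested on this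
    function. *)
Lemma test_paraproduct (g : dyadic_distribution R n) (p q A : R) :
  0 < p -> 0 < q -> 0 <= A ->
  (forall f : Rn R n -> R[i], locally_integrable_Rn f -> (Hp_norm p f < +oo)%E ->
    (dotHp_norm q (paraproduct g f) <= A%:E * Hp_norm p f)%E) ->
  vol P0 * tmean N (fun L =>
    wpathsum (fun j Q => v j Q ^+ 2 * energy g Q) N L `^ (q / 2)) P0 <=
  A `^ q * (vol P0 * tmean N (fun L => W L `^ p) P0) `^ (q / p).
Proof.
move=> p0 q0 A0 hA; have q20 : 0 < q / 2 by rewrite divr_gt0.
set X := vol P0 * _; set Y := vol P0 * _.
have Y0 : 0 <= Y.
  by rewrite mulr_ge0 ?(ltW (vol_gt0 _))// tmean_ge0// => L _; exact: powR_ge0.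
have intM := test_maximal_int p0; rewrite -/Y in intM.
have MI0 : (0 <= \int[mu]_x maximal_function test_function x `^ p)%E.
  by apply: integral_ge0 => x _; exact: poweR_ge0.
have Hf : (Hp_norm p test_function <= (Y `^ p^-1)%:E)%E.
  rewrite Hp_normE -poweR_EFin; apply: le_poweR => //.
  by rewrite invr_ge0 ltW.
have := hA _ test_locally_integrable (le_lt_trans Hf (ltry _)).
have AY : (A%:E * Hp_norm p test_function <= (A * Y `^ p^-1)%:E)%E.
  by rewrite EFinM lee_wpmul2l.
move=> /le_trans => /(_ _ AY).
have Hq0 : (0 <= dotHp_norm q (paraproduct g test_function))%E by exact: Lnorm_ge0.
move=> /(le_poweR (ltW q0) Hq0).
rewrite poweR_EFin powRM ?powR_ge0// -powRrM [p^-1 * q]mulrC.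
rewrite dotHp_normE ?gt_eqF// -poweRrM mulVf ?gt_eqF// poweRe1; last first.
  by apply: integral_ge0 => x _; exact: poweR_ge0.
move=> h; rewrite -lee_fin; apply: le_trans h.
rewrite /X -integral_node -/leaf integral_mkcond.
apply: ge0_le_integral => //.
- by move=> x _; apply: erestrict_ge0 => y _; rewrite lee_fin powR_ge0.
- apply/(measurable_restrictT _ (measurable_hcube P0)).
  apply: measurable_funTS; apply/measurable_EFinP.
  exact: (measurable_node (fun L => wpathsum _ N L `^ (q / 2))).
- apply: measurableT_comp (measurable_poweR _) _; exact: measurable_square_sum.
move=> x _; rewrite patchE; case: ifPn => [|_]; last exact: poweR_ge0.
rewrite inE => xP; rewrite -poweR_EFin.
have pE j : (j <= N)%N -> pathsum j (energy (paraproduct g test_function))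
    (node (P0.1 - j%:Z) x) =
    wpathsum (fun j Q => v j Q ^+ 2 * energy g Q) j (node (P0.1 - j%:Z) x).
  elim: j => [|j IH] jN; first by rewrite /= v0 expr0n/= !mul0r addr0.
  rewrite wpathsumS [LHS]/= parent_node.
  rewrite (_ : P0.1 - j.+1%:Z + 1 = P0.1 - j%:Z); last first.
    by rewrite -addn1 PoszD opprD addrA subrK.
  rewrite IH 1?ltnW//; congr (_ + _).
  by rewrite energy_paraproduct test_average// cabs_real real_normK ?num_real.
apply: le_poweR; [exact: ltW|..].
  rewrite lee_fin -pE//; apply: pathsum_ge0 => Q; exact: energy_ge0.
by rewrite -pE//; exact: pathsum_le_square_sum.
Qed.

End test_functions.

(** * Hardy space symbols *)

Section running_maximum.
Context {R : realType} {n : nat}.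
Local Notation T := (dyadic_cube n).
Implicit Types (Q : T) (x : Rn R n) (f : Rn R n -> R[i]).

(** The maximal function along the [J] cubes from [Q] upwards. *)
Fixpoint avgmax f J Q : R :=
  if J is J'.+1 then Num.max (avgmax f J' (parent Q)) (cabs (average f Q)) else 0.

Lemma avgmaxS f J Q :
  avgmax f J.+1 Q = Num.max (avgmax f J (parent Q)) (cabs (average f Q)).
Proof. by []. Qed.

Lemma avgmax_ge0 f J Q : 0 <= avgmax f J Q.
Proof. by elim: J Q => [//|J IH] Q /=; rewrite le_max IH. Qed.

Lemma avgmax_le_maximal f J k x :
  ((avgmax f J (node k x))%:E <= maximal_function f x)%E.
Proof.
elim: J k => [|J IH] k; first exact: maximal_function_ge0.
rewrite avgmaxS parent_node /Num.max; case: ifP => _; last exact: IH.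
exact: ge_maximal_function.
Qed.

Lemma pathsum_paraproduct_le (g : dyadic_distribution R n) f J Q :
  pathsum J (energy (paraproduct g f)) Q <=
  avgmax f J Q ^+ 2 * pathsum J (energy g) Q.
Proof.
elim: J Q => [|J IH] Q /=; first by rewrite mulr0.
have m0 := avgmax_ge0 f J (parent Q); have a0 := cabs_ge0 (average f Q).
rewrite mulrDr; apply: lerD.
  apply: le_trans (IH _) _; rewrite ler_wpM2r ?pathsum_ge0//.
    by move=> P; exact: energy_ge0.
  by rewrite ler_sqr ?nnegrE ?le_max ?lexx ?m0.
rewrite energy_paraproduct ler_wpM2r ?energy_ge0//.
by rewrite ler_sqr ?nnegrE ?le_max ?lexx ?a0 ?m0 ?orbT.
Qed.

End running_maximum.

Section hardy_symbols.
Context {R : realType} {n : nat}.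
Local Notation T := (dyadic_cube n).
Local Notation E := (n.-tuple bool).
Local Notation mu := (@lebesgue_tuple R n).
Implicit Types (Q L P : T) (x : Rn R n) (g : dyadic_distribution R n) (f : Rn R n -> R[i]).

Lemma sum_corners_le (K : nat) (h : Rn R n -> \bar R) :
  measurable_fun [set: Rn R n] h -> (forall x, 0 <= h x)%E ->
  (\sum_(e : E) \int[mu]_(x in hcube (corner K e)) h x <= \int[mu]_x h x)%E.
Proof.
move=> mh h0; rewrite -integral_central_box//.
apply: ge0_subset_integral => //; exact: measurable_central_box.
Qed.

(** Hoelder's inequality, after [S (pi_g f) <= M f * S g] pointwise; the finite
    chains keep the functions real-valued. *)
Lemma dotHp_paraproduct_le g f (p q r : R) : 0 < p -> 0 < q -> 0 < r ->
  q^-1 = p^-1 + r^-1 ->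
  (dotHp_norm q (paraproduct g f) <= dotHp_norm r g * Hp_norm p f)%E.
Proof.
move=> p0 q0 r0 pqr.
rewrite -[leRHS]poweRe1; last by rewrite mule_ge0 ?Lnorm_ge0.
rewrite -(mulfV (lt0r_neq0 q0)) poweRrM dotHp_normE ?gt_eqF//.
apply: le_poweR; first by rewrite invr_ge0 ltW.
  by apply: integral_ge0 => x _; exact: poweR_ge0.
apply: integral_square_sum_le => [|K]; first by rewrite divr_gt0.
pose a x := avgmax f (K + K) (node (- K%:Z) x) `^ q.
pose b x := pathsum (K + K) (energy g) (node (- K%:Z) x) `^ (q / 2).
have u0 x : 0 <= pathsum (K + K) (energy g) (node (- K%:Z) x).
  by apply: pathsum_ge0 => Q; exact: energy_ge0.
have ma : measurable_fun [set: Rn R n] a.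
  exact: (measurable_node (fun L => avgmax f (K + K) L `^ q)).
have mb : measurable_fun [set: Rn R n] b.
  exact: (measurable_node (fun L => pathsum (K + K) (energy g) L `^ (q / 2))).
have ab0 x : 0 <= a x * b x by rewrite mulr_ge0 ?powR_ge0.
apply: (@le_trans _ _ (\int[mu]_x (a x * b x)%:E)%E).
  apply: le_trans (sum_corners_le K _ _); last 2 first.
  - by apply/measurable_EFinP; exact: measurable_funM.
  - by move=> x; rewrite lee_fin.
  apply: lee_sum => e _; apply: ge0_le_integral => //.
  - exact: measurable_hcube.
  - by move=> x _; rewrite lee_fin powR_ge0.
  - apply: measurable_funTS; apply/measurable_EFinP.
    exact: (measurable_node (fun L => pathsum (K + K) (energy (paraproduct g f)) L `^ (q / 2))).
  - by apply: measurable_funTS; apply/measurable_EFinP; exact: measurable_funM.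
  move=> x _; rewrite lee_fin /a /b.
  rewrite (_ : avgmax f (K + K) (node (- K%:Z) x) `^ q =
    (avgmax f (K + K) (node (- K%:Z) x) ^+ 2) `^ (q / 2)); last first.
    rewrite -powR_mulrn ?avgmax_ge0// -powRrM; congr (_ `^ _).
    by field.
  rewrite -powRM ?sqr_ge0//; apply: ge0_ler_powR; rewrite ?nnegrE//.
  - by rewrite divr_ge0 ?ltW.
  - by apply: pathsum_ge0 => Q; exact: energy_ge0.
  - by rewrite mulr_ge0 ?sqr_ge0.
  - exact: pathsum_paraproduct_le.
have pq0 : 0 < p / q by rewrite divr_gt0.
have rq0 : 0 < r / q by rewrite divr_gt0.
have conj : (p / q)^-1 + (r / q)^-1 = 1.
  have : q * q^-1 = q * (p^-1 + r^-1) by rewrite pqr.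
  rewrite mulfV ?gt_eqF// => ->.
  by field; rewrite !gt_eqF.
have := hoelder mu ma mb pq0 rq0 conj.
rewrite Lnorm1 (eq_integral (fun x => (a x * b x)%:E)); last first.
  by move=> x _ /=; rewrite ger0_norm.
move=> /le_trans; apply.
rewrite poweRM ?Lnorm_ge0// muleC; apply: lee_pmul; rewrite ?Lnorm_ge0//.
- rewrite dotHp_normE ?gt_eqF// -poweRrM unlock.
  rewrite (_ : (r / q)^-1 = r^-1 * q); last by rewrite invfM invrK.
  apply: le_poweR; first by rewrite mulr_ge0 ?invr_ge0 ?ltW.
    by apply: integral_ge0 => x _; exact: poweR_ge0.
  apply: ge0_le_integral => //.
  + by move=> x _; exact: poweR_ge0.
  + apply: measurableT_comp (measurable_poweR _) _.
    by apply: measurableT_comp => //; exact/measurable_EFinP.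
  + exact: measurableT_comp (measurable_poweR _) (measurable_square_sum g).
  move=> x _; rewrite gee0_abs ?lee_fin ?powR_ge0// poweR_EFin -powRrM.
  rewrite (_ : q / 2 * (r / q) = r / 2); last by field; rewrite gt_eqF.
  rewrite -poweR_EFin; apply: le_poweR; rewrite ?lee_fin ?divr_ge0 ?(ltW r0) ?u0//.
  exact: pathsum_le_square_sum.
- rewrite Hp_normE -poweRrM unlock.
  rewrite (_ : (p / q)^-1 = p^-1 * q); last by rewrite invfM invrK.
  apply: le_poweR; first by rewrite mulr_ge0 ?invr_ge0 ?ltW.
    by apply: integral_ge0 => x _; exact: poweR_ge0.
  apply: ge0_le_integral => //.
  + by move=> x _; exact: poweR_ge0.
  + apply: measurableT_comp (measurable_poweR _) _.
    by apply: measurableT_comp => //; exact/measurable_EFinP.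
  + exact: measurableT_comp (measurable_poweR _) (measurable_maximal_function f).
  move=> x _; rewrite gee0_abs ?lee_fin ?powR_ge0// poweR_EFin -powRrM.
  rewrite (_ : q * (p / q) = p); last by field; rewrite gt_eqF.
  rewrite -poweR_EFin; apply: le_poweR; rewrite ?lee_fin ?(ltW p0) ?avgmax_ge0//.
  exact: avgmax_le_maximal.
Qed.

Lemma vol_tmean_ge0 N (F : T -> R) P : (forall L, 0 <= F L) ->
  0 <= vol P * tmean N F P.
Proof.
move=> F0; apply: mulr_ge0; first exact/ltW/vol_gt0.
by apply: tmean_ge0 => L _.
Qed.

Definition sign (e : E) : R := walsh [tuple of nseq n true] e.

Lemma norm_sign e : `|sign e| = 1. Proof. exact: norm_walsh. Qed.

Lemma av_sign : (0 < n)%N -> av sign = 0.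
Proof.
move=> n0; rewrite /sign av_walsh; case: eqP => // /(congr1 (fun t => tnth t (Ordinal n0))).
by rewrite !tnth_nseq.
Qed.

(** A martingale that jumps only when the majorant [t] of some sibling
    overtakes it, and then, with opposite signs on two halves of the siblings,
    to a size between one and three times the largest of these majorants. *)
Fixpoint jump_martingale (t : nat -> T -> R) j Q : R :=
  if j is j'.+1 then
    let P := parent Q in let w := jump_martingale t j' P in
    if sibmax t j' P <= `|w| then w else w + 2 * sibmax t j' P * sign (digit Q)
  else 0.

Section jump_martingale.
Variable t : nat -> T -> R.
Local Notation v := (jump_martingale t).

Lemma av_jump_martingale j Q : (0 < n)%N ->
  av (fun e => v j.+1 (child Q e)) = v j Q.
Proof.
move=> n0; rewrite /=; under eq_av => e do rewrite childK digit_child.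
case: (sibmax t j Q <= `|v j Q|); first exact: av_cst.
by rewrite avD av_cst avZ av_sign// mulr0 addr0.
Qed.

Lemma jump_martingale_ge j Q : (forall Q, t 0 Q = 0) -> t j Q <= `|v j Q|.
Proof.
move=> t_start; case: j => [|j]; first by rewrite t_start normr0.
rewrite /=; set m := sibmax t j _; set w := jump_martingale t j _.
have tm : t j.+1 Q <= m by rewrite -{1}(parentK Q); exact: sibmax_ge.
case: ifPn => [mw|]; first exact: le_trans mw.
rewrite -ltNge => wm; apply: (le_trans tm).
have m0 : 0 <= m by exact: sibmax_ge0.
have := lerB_normD (2 * m * sign (digit Q)) w.
rewrite [w + _]addrC normrM norm_sign mulr1 (@ger0_norm _ (2 * m)) ?mulr_ge0//; lra.
Qed.

Lemma jump_martingale_le (b : nat -> T -> R) j Q :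
  (forall Q, 0 <= b 0 Q) -> (forall j Q, b j (parent Q) <= b j.+1 Q) ->
  (forall j Q, sibmax t j (parent Q) <= b j.+1 Q) ->
  `|v j Q| <= 3 * b j Q.
Proof.
move=> b0 bm bt; elim: j Q => [|j IH] Q; first by rewrite normr0 mulr_ge0.
rewrite /=; set m := sibmax t j _; set w := jump_martingale t j _.
have wb : `|w| <= 3 * b j.+1 Q.
  by apply: le_trans (IH _) _; rewrite ler_pM2l.
case: ifPn => // ; rewrite -ltNge => wm.
have m0 : 0 <= m by exact: sibmax_ge0.
apply: le_trans (ler_normD _ _) _; rewrite normrM norm_sign mulr1.
rewrite (@ger0_norm _ (2 * m)) ?mulr_ge0//.
have mb : m <= b j.+1 Q := bt j Q.
lra.
Qed.

End jump_martingale.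

(** The chain rule [d (u `^ (1 + s)) = (1 + s) * u `^ s * du] for the path sum,
    as an inequality since its increments are finite. *)
Lemma pathsum_power_le (c : T -> R) (s : R) j Q : 0 <= s -> (forall Q, 0 <= c Q) ->
  pathsum j c Q `^ (1 + s) <=
  (1 + s) * wpathsum (fun j Q => pathsum j c Q `^ s * c Q) j Q.
Proof.
move=> s0 c0; have u0 i P : 0 <= pathsum i c P by exact: pathsum_ge0.
elim: j Q => [|j IH] Q.
  rewrite [X in X `^ _]/= powR0; last by rewrite gt_eqF// ltr_pwDl.
  apply: mulr_ge0; first by rewrite addr_ge0.
  by rewrite /= add0r mulr_ge0 ?powR_ge0.
have := @powR_increment_le _ (pathsum j.+1 c Q) (pathsum j c (parent Q)) (1 + s).
rewrite lerDl s0 u0 => /(_ isT isT).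
have -> : pathsum j.+1 c Q - pathsum j c (parent Q) = c Q by rewrite /= addrC addKr.
have -> : 1 + s - 1 = s by ring.
have hx : pathsum j c (parent Q) <= pathsum j.+1 c Q by rewrite /= lerDl.
move=> /(_ hx).
rewrite wpathsumS mulrDr; have := IH (parent Q).
rewrite -(mulrA (1 + s)); set X := _ `^ _; set Y := _ `^ _; set Z := wpathsum _ _ _; lra.
Qed.

(** The unknown [Y] occurs on the right of the hypothesis with the exponent
    [q / p = 1 - q / r] below one, so it can be divided out. *)
Lemma solve_power (Y A a b q r p : R) : 0 < p -> 0 < q -> 0 < r ->
  q^-1 = p^-1 + r^-1 -> 0 <= Y -> 0 <= A -> 0 < a -> 0 < b ->
  a * Y <= A `^ q * (b * Y) `^ (q / p) ->
  Y <= (a^-1 * b `^ (q / p)) `^ (r / q) * A `^ r.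
Proof.
move=> p0 q0 r0 pqr Y0 A0 a0 b0 h.
have [->|Yn0] := eqVneq Y 0; first by rewrite mulr_ge0 ?powR_ge0.
have Ygt0 : 0 < Y by rewrite lt_neqAle eq_sym Yn0.
have e1 : 1 - q / p = q / r.
  have : q * q^-1 = q * (p^-1 + r^-1) by rewrite pqr.
  by rewrite mulfV ?gt_eqF// mulrDr => ->; rewrite addrAC subrr add0r.
have h1 : Y `^ (q / r) <= (a^-1 * b `^ (q / p)) * A `^ q.
  have Yq0 : 0 < Y `^ (q / p) by rewrite powR_gt0.
  rewrite -(ler_pM2r Yq0) -powRD; last by rewrite Yn0 implybT.
  rewrite -e1 subrK powRr1//.
  rewrite -(ler_pM2l a0); apply: le_trans h _.
  rewrite powRM ?(ltW b0)// !mulrA mulfV ?gt_eqF// mul1r.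
  by rewrite [A `^ q * _]mulrC.
have -> : Y = (Y `^ (q / r)) `^ (r / q).
  rewrite -powRrM (_ : q / r * (r / q) = 1) ?powRr1//.
  by field; rewrite !gt_eqF.
have -> : A `^ r = (A `^ q) `^ (r / q).
  by rewrite -powRrM; congr (_ `^ _); field; rewrite gt_eqF.
rewrite -powRM ?powR_ge0//; last by rewrite mulr_ge0 ?powR_ge0 ?invr_ge0 ?ltW.
apply: ge0_ler_powR => //; rewrite ?nnegrE ?powR_ge0//.
  by rewrite divr_ge0 ?ltW.
by rewrite !mulr_ge0 ?powR_ge0 ?invr_ge0 ?ltW.
Qed.

(** Test on a function whose average over each cube [Q] dominates
    [S_Q `^ (r / p)], where [S_Q] is the part of the square function of [g]
    coming from the cubes that contain [Q]: then [S (pi_g f)] dominates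
    [S `^ (1 + r / p)], while [M f] is controlled by [S `^ (r / p)]. *)
Lemma dotHp_le_paraproduct (p q r : R) : (0 < n)%N -> 0 < p -> 0 < q -> 0 < r ->
  q^-1 = p^-1 + r^-1 ->
  exists2 C : R, 0 < C & forall g (A : R), 0 <= A ->
  (forall f : Rn R n -> R[i], locally_integrable_Rn f -> (Hp_norm p f < +oo)%E ->
    (dotHp_norm q (paraproduct g f) <= A%:E * Hp_norm p f)%E) ->
  (dotHp_norm r g <= (C * A)%:E)%E.
Proof.
move=> n0 p0 q0 r0 pqr.
have D0 : 0 < 2 ^+ n :> R by rewrite exprn_gt0.
pose al := 1 + r / p; have al0 : 0 < al by rewrite addr_gt0// divr_gt0.
pose a : R := al `^ (- (q / 2)); have a0 : 0 < a by rewrite powR_gt0.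
pose b : R := 3 `^ p * 2 ^+ n; have b0 : 0 < b by rewrite mulr_gt0 ?powR_gt0.
pose C0 := (a^-1 * b `^ (q / p)) `^ (r / q).
have C00 : 0 < C0 by rewrite powR_gt0// mulr_gt0 ?invr_gt0 ?powR_gt0.
exists ((2 ^+ n * C0) `^ r^-1) => [|g A A0 hA]; first by rewrite powR_gt0// mulr_gt0.
pose c := energy g; have c0 Q : 0 <= c Q by exact: energy_ge0.
pose u j Q := pathsum j c Q; have u0 j Q : 0 <= u j Q by exact: pathsum_ge0.
have um j Q : u j (parent Q) <= u j.+1 Q by rewrite /u /= lerDl.
(* [t] is what the averages of the test function have to dominate; its [p]-th
   power [t'] has the integral that is to be bounded *)
pose t j Q := u j Q `^ (r / p / 2).
pose t' j Q := u j Q `^ (r / 2).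
have tstart Q : t 0 Q = 0 by rewrite /t /u /= powR0// gt_eqF// !divr_gt0.
have t'0 j Q : 0 <= t' j Q by exact: powR_ge0.
have t'm j Q : t' j (parent Q) <= t' j.+1 Q.
  by apply: ge0_ler_powR; rewrite ?nnegrE// divr_ge0 ?ltW.
have tt' j Q : t j Q = t' j Q `^ p^-1.
  by rewrite /t /t' -powRrM; congr (_ `^ _); field; rewrite gt_eqF.
(* the majorant of the test function, up to the factor three *)
pose b' j Q := runmax t' j Q `^ p^-1.
have p'0 : 0 <= p^-1 by rewrite invr_ge0 ltW.
have b'm j Q : b' j (parent Q) <= b' j.+1 Q.
  by apply: ge0_ler_powR; rewrite ?nnegrE ?runmax_ge0 ?runmax_mono.
have vb j Q : `|jump_martingale t j Q| <= 3 * b' j Q.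
  apply: jump_martingale_le => // [Q'|i Q']; first exact: powR_ge0.
  apply: bigmax_le => [|e _]; first exact: powR_ge0.
  rewrite tt'; apply: ge0_ler_powR; rewrite ?nnegrE ?runmax_ge0//.
  by rewrite /= le_max sibmax_ge orbT.
have key N P : vol P * tmean N (fun L => u N L `^ (r / 2)) P <= C0 * A `^ r.
  apply: (solve_power p0 q0 r0 pqr) => //.
    by apply: vol_tmean_ge0 => L; exact: powR_ge0.
  have vW j L : (j <= N)%N -> anc N L = P ->
      `|jump_martingale t j (anc (N - j) L)| <= 3 * b' N L.
    move=> jN _; apply: le_trans (vb _ _) _; rewrite ler_pM2l//.
    by have := path_mono j (N - j) L b'm; rewrite subnKC.
  have := test_paraproduct (v := jump_martingale t) (fun Q => erefl)
    (fun j Q => av_jump_martingale t j Q n0) vW p0 q0 A0 hA.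
  move=> h; apply: le_trans (le_trans h _).
    rewrite mulrCA ler_pM2l ?vol_gt0// -tmeanZ; apply: ler_tmean => L _.
    apply: (@le_trans _ _ ((al^-1 * u N L `^ al) `^ (q / 2))).
      rewrite powRM ?invr_ge0 ?(ltW al0) ?powR_ge0// -powRrM.
      rewrite (_ : al * (q / 2) = r / 2); last first.
        have : q * q^-1 = q * (p^-1 + r^-1) by rewrite pqr.
        rewrite mulfV ?gt_eqF// => e; rewrite /al.
        have -> : r / 2 = r / 2 * (q * (p^-1 + r^-1)) by rewrite -e mulr1.
        by field; rewrite !gt_eqF.
      have -> // : al^-1 `^ (q / 2) = a.
      by rewrite -powR_inv1 ?(ltW al0)// -powRrM mulN1r.
    apply: ge0_ler_powR; rewrite ?nnegrE ?divr_ge0 ?(ltW q0)//.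
    - by rewrite mulr_ge0 ?powR_ge0// invr_ge0 ltW.
    - elim: (N) L => [|k IH] L /=; first by rewrite expr0n/= mul0r addr0.
      by rewrite addr_ge0// mulr_ge0// sqr_ge0.
    rewrite ler_pdivrMl//.
    have := @pathsum_power_le c (r / p) N L; rewrite divr_ge0 ?(ltW r0) ?(ltW p0)//.
    move=> /(_ isT c0) /le_trans; apply; rewrite ler_pM2l//.
    elim: (N) L => [|k IH] L.
      by rewrite /= !add0r powR0 ?gt_eqF ?divr_gt0// expr0n.
    rewrite !wpathsumS; apply: lerD => //; rewrite ler_wpM2r//.
    rewrite -(real_normK (num_real (jump_martingale t k.+1 L))).
    have -> : pathsum k.+1 c L `^ (r / p) = t k.+1 L ^+ 2.
      rewrite /t -powR_mulrn ?powR_ge0// -powRrM; congr (_ `^ _).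
      by field; rewrite gt_eqF.
    by rewrite ler_sqr ?nnegrE ?powR_ge0 ?normr_ge0// jump_martingale_ge.
  rewrite ler_wpM2l ?powR_ge0//; apply: ge0_ler_powR; rewrite ?nnegrE.
  - by rewrite divr_ge0 ?ltW.
  - by apply: vol_tmean_ge0 => L; exact: powR_ge0.
  - apply: mulr_ge0; first exact: ltW.
    by apply: vol_tmean_ge0 => L; exact: powR_ge0.
  rewrite mulrCA ler_pM2l ?vol_gt0//.
  rewrite (@eq_tmean _ _ _ _ (fun L => 3 `^ p * runmax t' N L)); last first.
    move=> L _; rewrite powRM ?powR_ge0// /b' -powRrM mulVf ?gt_eqF// powRr1//.
    exact: runmax_ge0.
  rewrite tmeanZ /b -mulrA ler_pM2l ?powR_gt0//.
  exact: tmean_runmax_le.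
rewrite dotHp_normE ?gt_eqF//.
have -> : (2 ^+ n * C0) `^ r^-1 * A = (2 ^+ n * (C0 * A `^ r)) `^ r^-1.
  rewrite mulrA [RHS]powRM ?powR_ge0//; last by apply: mulr_ge0; exact: ltW.
  by rewrite -powRrM mulfV ?gt_eqF// powRr1.
rewrite -poweR_EFin; apply: le_poweR; first by rewrite invr_ge0 ltW.
  by apply: integral_ge0 => x _; exact: poweR_ge0.
apply: integral_square_sum_le => [|K]; first by rewrite divr_gt0.
apply: (@le_trans _ _ (\sum_(e : E) (C0 * A `^ r)%:E)%E).
  apply: lee_sum => e _.
  have -> : - K%:Z = (corner K e).1 - (K + K)%N%:Z by rewrite /=; lia.
  by rewrite (integral_node (fun L => u (K + K)%N L `^ (r / 2))) lee_fin.
rewrite sumEFin sumr_const card_tuple card_bool lee_fin -[_ *+ _]mulr_natl natrX.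
by [].
Qed.

End hardy_symbols.

(** * Haar coefficients and averages *)

Section haar_coefficients.
Context {R : realType} {n : nat}.
Local Notation T := (dyadic_cube n).
Local Notation E := (n.-tuple bool).
Local Notation mu := (@lebesgue_tuple R n).
Implicit Types (Q : T) (x : Rn R n) (i : haar_index n) (z : R[i]) (f : Rn R n -> R[i]) (h : Rn R n -> R).

Local Notation re f := (fun x => complex.Re (f x)).
Local Notation im f := (fun x => complex.Im (f x)).

Let side_itv (k m : int) : lebesgue_measure (Defs.dyadic_itv (R := R) k m) = (2 ^ k)%:E.
Proof.
have k0 : 0 < (2 ^ k : R) by exact: exprz_gt0.
rewrite (_ : Defs.dyadic_itv k m = `[2 ^ k * m%:~R, 2 ^ k * (m%:~R + 1)]%classic); last first.
  by apply/seteqP; split => t /=; rewrite /Defs.dyadic_itv /= in_itv.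
rewrite lebesgue_measure_itv /= lte_fin ltr_pM2l// ltrDl ltr01 -EFinB.
by congr EFin; ring.
Qed.

Let scale Q : R := (Num.sqrt (vol Q))^-1.

Let scaleE Q : \prod_(j < n) (Num.sqrt (fine (lebesgue_measure
   (Defs.dyadic_itv (R := R) Q.1 (tnth Q.2 j)))))^-1 = scale Q.
Proof.
under eq_bigr do rewrite side_itv /=.
rewrite prodr_const card_ord /scale volE exprVn; congr (_^-1).
have : 0 <= (2 ^ Q.1 : R) by apply: exprz_ge0.
move: (2 ^ Q.1 : R) => y y0.
by elim: (n) => [|k IH]; rewrite ?expr0 ?sqrtr1// !exprS IH sqrtrM.
Qed.

(** The points in the common boundary of two children lie in the support of
    both terms of the defining difference, and are excluded here. *)
Lemma haar_child Q i e x : (forall Q', cube Q' x -> hcube Q' x) ->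
  hcube (child Q e) x -> haar Q i x = scale Q * walsh (val i) e.
Proof.
move=> xN xe; rewrite /haar /haar1 big_split /= scaleE; congr (_ * _).
rewrite /walsh; apply: eq_bigr => j _.
have xQ : hcube Q x by apply/hcube_child; exists e.
have inQ := hcube_cube xQ; have ine := hcube_cube xe.
have half (b : bool) :
    \1_(Defs.dyadic_itv (Q.1 - 1) (2 * tnth Q.2 j + (b : nat)%:Z)) (tnth x j) =
    (b == tnth e j)%:R :> R.
  rewrite indicE; case: eqP => [->|be].
    by rewrite mem_set//; have := ine j; rewrite /= tnth_mktuple.
  case: (boolP (_ \in _)) => //; rewrite inE => xb; exfalso; apply: be.
  pose e' : E := [tuple if l == j then b else tnth e l | l < n].
  have /xN xe' : cube (child Q e') x.
    move=> l; rewrite /= tnth_mktuple tnth_mktuple.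
    case: eqP => [->//|_]; by have := ine l; rewrite /= tnth_mktuple.
  have := congr1 digit (etrans (esym xe) xe'); rewrite !digit_child => ->.
  by rewrite tnth_mktuple eqxx.
case: (tnth (val i) j) => /=; last by rewrite indicE mem_set// expr0.
have := half false; have := half true; rewrite /= addr0 => -> ->.
by case: (tnth e j); rewrite /= ?expr0 ?expr1 ?subr0 ?sub0r.
Qed.

Lemma haar_out Q i x : ~ cube Q x -> haar Q i x = 0.
Proof.
move=> nQx; have [j nj] : exists j, ~ Defs.dyadic_itv Q.1 (tnth Q.2 j) (tnth x j : R).
  by apply: contrapT => /forallNP h; apply: nQx => j; apply: contrapT; exact: h.
rewrite /haar (bigD1 j)//= {1}/haar1.
have sub (b : bool) (m : int) (t : R) :
    Defs.dyadic_itv (Q.1 - 1) (2 * m + (b : nat)%:Z) t -> Defs.dyadic_itv Q.1 m t.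
  have k0 : 0 < (2 ^ (Q.1 - 1) : R) by exact: exprz_gt0.
  have E2 : 2 ^ Q.1 = 2 * 2 ^ (Q.1 - 1) :> R.
    by rewrite -[X in X * _]expr1z -expfzDr//; congr (_ ^ _); lia.
  move=> /andP[t1 t2]; rewrite /Defs.dyadic_itv /= E2.
  by move: t1 t2; case: b; rewrite !intrD !intrM /= => t1 t2; apply/andP; split; nra.
have [s1 s2] := (@sub false (tnth Q.2 j) (tnth x j), @sub true (tnth Q.2 j) (tnth x j)).
rewrite /= addr0 in s1.
rewrite !indicE !memNset ?subrr ?if_same ?mulr0 ?mul0r//.
- by move=> /s2.
- by move=> /s1.
Qed.

Let measurable_haar1 b (k m : int) : measurable_fun [set: measurableTypeR R] (haar1 b k m).
Proof.
have mi k' m' : measurable (Defs.dyadic_itv (R := R) k' m').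
  rewrite (_ : Defs.dyadic_itv k' m' = `[2 ^ k' * m'%:~R, 2 ^ k' * (m'%:~R + 1)]%classic).
    exact: measurable_itv.
  by apply/seteqP; split => t /=; rewrite /Defs.dyadic_itv /= in_itv.
rewrite /haar1; case: b; apply: measurable_funM => //.
by apply: measurable_funB; apply: measurable_indic; exact: mi.
Qed.

Lemma measurable_haar Q i : measurable_fun [set: Rn R n] (@haar R n Q i).
Proof.
rewrite /haar; elim: (index_enum _) => [|j s IH].
  by under eq_fun do rewrite big_nil; exact: measurable_cst.
under eq_fun do rewrite big_cons.
apply: measurable_funM => //.
apply: (measurableT_comp (measurable_haar1 _ _ _)); exact: measurable_tnth.
Qed.

Lemma integral_haar h Q i : mu.-integrable (cube Q) (EFin \o h) ->
  \int[mu]_x (h x * haar Q i x) =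
  Num.sqrt (vol Q) * av (fun e => walsh (val i) e * mean h (child Q e)).
Proof.
move=> ih; have mh : measurable_fun (cube Q) h.
  by apply/measurable_EFinP; case/integrableP : ih.
pose H P := if parent P == Q then scale Q * walsh (val i) (digit P) else 0.
pose f2 x := h x * H (node (Q.1 - 1) x).
have mH : measurable_fun [set: Rn R n] (fun x => H (node (Q.1 - 1) x)).
  exact: measurable_node.
have mf2 : measurable_fun (cube Q) f2.
  by apply: measurable_funM => //; exact: measurable_funTS.
have if2 : mu.-integrable (cube Q) (EFin \o f2).
  apply: (@le_integrable _ _ _ _ _ (measurable_cube Q) _ (fun x => (scale Q)%:E * (h x)%:E)%E).
  - exact/measurable_EFinP.
  - move=> x _; rewrite -EFinM !abse_EFin lee_fin /f2 !normrM mulrC ler_wpM2r//.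
    rewrite /H; case: ifP => _; last by rewrite normr0.
    by rewrite normrM norm_walsh mulr1.
  - exact: (integrableZl (measurable_cube Q) (scale Q) ih).
have Hchild e x : hcube (child Q e) x -> H (node (Q.1 - 1) x) = scale Q * walsh (val i) e.
  by move=> xe; rewrite /H xe childK eqxx digit_child.
rewrite /Rintegral.
have -> : (\int[mu]_x (h x * haar Q i x)%:E = \int[mu]_(x in cube Q) (f2 x)%:E)%E.
  transitivity (\int[mu]_(x in cube Q) (h x * haar Q i x)%:E)%E.
    rewrite [RHS]integral_mkcond; apply: eq_integral => x _.
    rewrite patchE; case: ifPn => //; rewrite notin_setE => /(haar_out i) ->.
    by rewrite mulr0.
  apply: ae_eq_integral.
  - exact: measurable_cube.
  - apply/measurable_EFinP; apply: measurable_funM => //.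
    by apply: measurable_funTS; exact: measurable_haar.
  - exact/measurable_EFinP.
  - apply: ae_cubeE => x xN /xN/hcube_child[e xe].
    by rewrite /f2 (Hchild e)// (haar_child i xN xe).
rewrite integral_cube// integral_hcube; last first.
  by apply: measurable_funS mf2; [exact: measurable_cube|exact: hcube_cube].
have cc e : hcube (child Q e) `<=` (cube Q : set (Rn R n)).
  by move=> x xe; apply: hcube_cube; apply/hcube_child; exists e.
have ihe e : mu.-integrable (hcube (child Q e)) (EFin \o h).
  apply: integrableS ih => //; [exact: measurable_cube|exact: measurable_hcube].
under eq_bigr => e _.
  rewrite (eq_integral (fun x => (scale Q * walsh (val i) e)%:E * (h x)%:E)%E); last first.
    by move=> x; rewrite inE => xe; rewrite /f2 (Hchild e)// -EFinM mulrC.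
  rewrite integralZl//; last exact: measurable_hcube.
  over.
rewrite -sum_fine; last first.
  move=> e _; rewrite fin_numM//; apply: integrable_fin_num => //; exact: measurable_hcube.
rewrite /av mulr_suml mulr_sumr; apply: eq_bigr => e _.
rewrite fineM//; last by apply: integrable_fin_num => //; exact: measurable_hcube.
rewrite /mean /Rintegral vol_child /scale /=.
set I := fine _; set w := walsh _ _.
have v0 : 0 < vol Q :> R by exact: vol_gt0.
have s0 : 0 < Num.sqrt (vol Q) :> R by rewrite sqrtr_gt0.
have : vol Q = Num.sqrt (vol Q) ^+ 2 :> R by rewrite sqr_sqrtr// ltW.
move: (Num.sqrt (vol Q)) s0 => s s0 ->.
by field; rewrite !gt_eqF// exprn_gt0.
Qed.

Lemma sum_haar_index (F : E -> R) :
  \sum_(i : haar_index n) F (val i) = \sum_i F i - F (zero_index (n := n)).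
Proof.
rewrite [X in _ = X - _](bigD1 (zero_index (n := n)))//= addrAC subrr add0r.
exact/esym/(big_sub [pred i : E | i != zero_index (n := n)] F).
Qed.

(** The pieces of a Haar expansion at one cube carry the variance of the
    averages over its children. *)
Lemma energy_haar_coef f Q (z : R[i]) : locally_integrable_Rn f ->
  energy (haar_coef f) Q + cabs (average f Q - z) ^+ 2 =
  av (fun e => cabs (average f (child Q e) - z) ^+ 2).
Proof.
move=> lf; have [ire iim] := locally_integrable_cube Q lf.
have [hre him] := locally_integrable_hcube Q lf.
pose X e := mean (re f) (child Q e); pose Y e := mean (im f) (child Q e).
have cabs2 (w : R[i]) : cabs w ^+ 2 = complex.Re w ^+ 2 + complex.Im w ^+ 2.
  by case: w => a b; rewrite /cabs /= sqr_sqrtr// addr_ge0 ?sqr_ge0.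
have coef i : cabs (haar_coef f Q i) ^+ 2 = vol Q *
    (av (fun e => walsh (val i) e * X e) ^+ 2 + av (fun e => walsh (val i) e * Y e) ^+ 2).
  rewrite cabs2 /haar_coef /cintegral /=.
  have rr x : complex.Re (f x * (haar Q i x)%:C%C) = complex.Re (f x) * haar Q i x.
    by case: (f x) => a b /=; rewrite mulr0 subr0.
  have ii x : complex.Im (f x * (haar Q i x)%:C%C) = complex.Im (f x) * haar Q i x.
    by case: (f x) => a b /=; rewrite mulr0 add0r.
  rewrite (_ : (fun x => complex.Re _) = fun x => complex.Re (f x) * haar Q i x);
    last exact/funext.
  rewrite (_ : (fun x => complex.Im _) = fun x => complex.Im (f x) * haar Q i x);
    last exact/funext.
  rewrite !integral_haar// !exprMn sqr_sqrtr ?mulrDr//.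
  exact/ltW/vol_gt0.
have -> : energy (haar_coef f) Q = av (fun e => X e ^+ 2) - av X ^+ 2 +
    (av (fun e => Y e ^+ 2) - av Y ^+ 2).
  rewrite /energy; under eq_bigr do rewrite coef.
  rewrite -mulr_sumr mulrAC mulfV ?mul1r; last by rewrite gt_eqF// vol_gt0.
  rewrite (sum_haar_index (fun l : E => av (fun e => walsh l e * X e) ^+ 2 +
    av (fun e => walsh l e * Y e) ^+ 2)).
  rewrite big_split /= !walsh_parseval.
  have w1 (u : E -> R) : av (fun e => walsh (zero_index (n := n)) e * u e) = av u.
    by apply: eq_av => e; rewrite walsh0 mul1r.
  by rewrite !w1; ring.
have meanX : mean (re f) Q = av X by exact: mean_child.
have meanY : mean (im f) Q = av Y by exact: mean_child.
have expand (u : E -> R) (a : R) : av (fun e => (u e - a) ^+ 2) =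
    av (fun e => u e ^+ 2) - 2 * a * av u + a ^+ 2.
  rewrite -(avZ (2 * a)) -avB -[X in _ = _ + X](av_cst (n := n)) -avD.
  by apply: eq_av => e; ring.
case: z => z1 z2; rewrite averageE// meanX meanY cabs2 /=.
have -> : av (fun e => cabs (average f (child Q e) - z1 +i* z2)%C ^+ 2) =
    av (fun e => (X e - z1) ^+ 2 + (Y e - z2) ^+ 2).
  by apply: eq_av => e; rewrite averageE// cabs2.
by rewrite avD !expand; ring.
Qed.

Lemma integrable_const (D : set (Rn R n)) (a : R) : measurable D ->
  (mu D < +oo)%E -> mu.-integrable D (EFin \o cst a).
Proof.
move=> mD Doo; apply/integrableP; split; first exact/measurable_EFinP.
rewrite (integral_cst mu mD `|a%:E|%E) lte_mul_pinfty//.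
Qed.

Definition oscillation f (z : R[i]) Q : R := mean (fun x => cabs (f x - z)) Q.

Let cabsE (w : R[i]) : cabs w = (complex.Re w ^+ 2 + complex.Im w ^+ 2) `^ 2^-1.
Proof. by case: w => a b; rewrite powR12_sqrt// addr_ge0 ?sqr_ge0. Qed.

Lemma ReB (w z : R[i]) : complex.Re (w - z) = complex.Re w - complex.Re z.
Proof. by case: w; case: z. Qed.

Lemma ImB (w z : R[i]) : complex.Im (w - z) = complex.Im w - complex.Im z.
Proof. by case: w; case: z. Qed.

Let cauchy_schwarz (w z : R[i]) :
  complex.Re w * complex.Re z + complex.Im w * complex.Im z <= cabs w * cabs z.
Proof.
case: w => a b; case: z => a' b'; rewrite /cabs /=.
apply: le_trans (ler_norm _) _; rewrite -sqrtrM ?addr_ge0 ?sqr_ge0// -sqrtr_sqr.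
rewrite ler_sqrt; last by rewrite mulr_ge0 ?addr_ge0 ?sqr_ge0.
by rewrite -subr_ge0 (_ : _ - _ = (a * b' - b * a') ^+ 2) ?sqr_ge0//; ring.
Qed.

Lemma cabs_le_ReIm (w : R[i]) : cabs w <= `|complex.Re w| + `|complex.Im w|.
Proof.
case: w => a b; rewrite /cabs /=.
rewrite -[leRHS]ger0_norm ?addr_ge0// -sqrtr_sqr ler_sqrt ?sqr_ge0//.
rewrite sqrrD !real_normK ?num_real//.
have := mulr_ge0 (normr_ge0 a) (normr_ge0 b); lra.
Qed.

Lemma measurable_cabs f (D : set (Rn R n)) : measurable_fun D (re f) ->
  measurable_fun D (im f) -> measurable_fun D (fun x => cabs (f x)).
Proof.
move=> mr mi; under eq_fun do rewrite cabsE.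
apply: (measurableT_comp (measurable_powR _)).
by apply: measurable_funD; apply: measurable_funX.
Qed.

Lemma integrable_oscillation f z Q : locally_integrable_Rn f ->
  mu.-integrable (cube Q) (EFin \o (fun x => cabs (f x - z))).
Proof.
move=> /(locally_integrable_cube Q)[ire iim].
have mr : measurable_fun (cube Q) (re f) by apply/measurable_EFinP; case/integrableP : ire.
have mi : measurable_fun (cube Q) (im f) by apply/measurable_EFinP; case/integrableP : iim.
have mQ := @measurable_cube R n Q.
have icst : mu.-integrable (cube Q) (EFin \o cst (`|complex.Re z| + `|complex.Im z|)).
  by apply: integrable_const => //; rewrite [X in (X < _)%E]mu_cube ltry.
have := integrableD mQ (integrableD mQ (integrable_norm ire) (integrable_norm iim)) icst.
apply: le_integrable => //.
  apply/measurable_EFinP; apply: measurable_cabs.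
    by under eq_fun do rewrite ReB; exact: measurable_funB.
  by under eq_fun do rewrite ImB; exact: measurable_funB.
move=> x _ /=; rewrite lee_fin (ger0_norm (cabs_ge0 _)); apply: le_trans (ler_norm _).
apply: le_trans (cabs_le_ReIm _) _.
rewrite ReB ImB.
have := ler_normB (complex.Re (f x)) (complex.Re z).
have := ler_normB (complex.Im (f x)) (complex.Im z).
lra.
Qed.

Let integrable_oscillation_h f z Q : locally_integrable_Rn f ->
  mu.-integrable (hcube Q) (EFin \o (fun x => cabs (f x - z))).
Proof.
move=> lf; apply: integrableS (integrable_oscillation z Q lf) => //;
  [exact: measurable_cube|exact: measurable_hcube|exact: hcube_cube].
Qed.

Lemma oscillation_child f z Q : locally_integrable_Rn f ->
  oscillation f z Q = av (fun e => oscillation f z (child Q e)).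
Proof. by move=> lf; apply: mean_child; exact: integrable_oscillation_h. Qed.

(** Jensen's inequality for the modulus: pair [f - z] with the direction of its
    average and use the Cauchy-Schwarz inequality pointwise. *)
Lemma oscillation_ge f z Q : locally_integrable_Rn f ->
  cabs (average f Q - z) <= oscillation f z Q.
Proof.
move=> lf; set w := average f Q - z.
have [hre him] := locally_integrable_hcube Q lf.
have io := integrable_oscillation_h z Q lf.
have mQ := @measurable_hcube R n Q.
have v0 : 0 < vol Q :> R by exact: vol_gt0.
have [w0|wn0] := eqVneq (cabs w) 0.
  rewrite w0 /oscillation /mean mulr_ge0 ?invr_ge0 ?(ltW v0)//.
  by apply: Rintegral_ge0 => x _; exact: cabs_ge0.
have w_gt0 : 0 < cabs w by rewrite lt_neqAle eq_sym wn0 cabs_ge0.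
rewrite -(ler_pM2l w_gt0).
set w1 := complex.Re w; set w2 := complex.Im w.
pose lin x := w1 * complex.Re (f x) + w2 * complex.Im (f x).
have ilin : mu.-integrable (hcube Q) (EFin \o lin).
  rewrite (_ : EFin \o lin = (fun x => w1%:E * (complex.Re (f x))%:E) \+
    (fun x => w2%:E * (complex.Im (f x))%:E))%E //.
  by apply: integrableD => //; apply: integrableZl.
have meanlin : mean lin Q = w1 * mean (re f) Q + w2 * mean (im f) Q.
  rewrite /mean /lin RintegralD//; last 2 first.
  - by rewrite (_ : EFin \o _ = (fun x => w1%:E * (complex.Re (f x))%:E)%E)//; exact: integrableZl.
  - by rewrite (_ : EFin \o _ = (fun x => w2%:E * (complex.Im (f x))%:E)%E)//; exact: integrableZl.
  by rewrite !RintegralZl//; ring.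
pose c := w1 * complex.Re z + w2 * complex.Im z.
have le : mean lin Q <= mean (fun x => cabs w * cabs (f x - z) + c) Q.
  rewrite /mean ler_pM2l ?invr_gt0//; apply: le_Rintegral => //.
    rewrite (_ : EFin \o _ = fun x => ((cabs w)%:E * (cabs (f x - z))%:E + c%:E)%E)//.
    apply: (integrableD mQ (integrableZl mQ (cabs w) io)).
    by apply: integrable_const => //; rewrite [X in (X < _)%E]mu_hcube ltry.
  move=> x _; rewrite /lin /c -lerBlDr.
  have -> : w1 * complex.Re (f x) + w2 * complex.Im (f x) -
    (w1 * complex.Re z + w2 * complex.Im z) =
    w1 * complex.Re (f x - z) + w2 * complex.Im (f x - z).
    by rewrite ReB ImB; ring.
  exact: cauchy_schwarz.
have meanr : mean (fun x => cabs w * cabs (f x - z) + c) Q = cabs w * oscillation f z Q + c.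
  have ic : mu.-integrable (hcube Q) (EFin \o cst c).
    by apply: integrable_const => //; rewrite [X in (X < _)%E]mu_hcube ltry.
  rewrite /oscillation /mean RintegralD//; last first.
    rewrite (_ : EFin \o _ = (fun x => (cabs w)%:E * (cabs (f x - z))%:E)%E)//.
    exact: integrableZl.
  rewrite RintegralZl// mulrDr; congr (_ + _); first by ring.
  by rewrite Rintegral_cst// [X in fine X]mu_hcube /= mulrCA mulVf ?mulr1// gt_eqF.
have wE : cabs w * cabs w = w1 * mean (re f) Q + w2 * mean (im f) Q - c.
  have -> : cabs w * cabs w = w1 ^+ 2 + w2 ^+ 2.
    rewrite /w1 /w2; case: (w) => a b.
    by rewrite /cabs /= -expr2 sqr_sqrtr// addr_ge0 ?sqr_ge0.
  have e1 : w1 = mean (re f) Q - complex.Re z.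
    by rewrite /w1 /w averageE//; case: (z).
  have e2 : w2 = mean (im f) Q - complex.Im z.
    by rewrite /w2 /w averageE//; case: (z).
  rewrite /c; move: e1 e2; set m1 := mean _ _; set m2 := mean _ _ => e1 e2.
  rewrite (_ : m1 = w1 + complex.Re z); last by rewrite e1 subrK.
  by rewrite (_ : m2 = w2 + complex.Im z); [ring|rewrite e2 subrK].
by rewrite wE -meanlin lerBlDr -meanr.
Qed.

Lemma dotLambda_fun_norm_le f (alpha B : R) : locally_integrable_Rn f ->
  (dotLambda_fun_norm alpha f <= B%:E)%E <->
  forall Q, oscillation f (average f Q) Q <= B * side Q `^ alpha.
Proof.
move=> lf; have key Q : ((side Q `^ (- alpha))%:E * ((vol Q)^-1%:E *
    \int[mu]_(x in cube Q) (cabs (f x - average f Q)%R)%:E) =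
    (side Q `^ (- alpha) * oscillation f (average f Q) Q)%:E)%E.
  have io := integrable_oscillation (average f Q) Q lf.
  rewrite integral_cube// /oscillation /mean /Rintegral !EFinM fineK//.
  apply: integrable_fin_num; first exact: measurable_hcube.
  exact: integrable_oscillation_h.
have s0 Q : 0 < side Q :> R by rewrite /side exprz_gt0.
have le Q : (side Q `^ (- alpha) * oscillation f (average f Q) Q <= B) =
    (oscillation f (average f Q) Q <= B * side Q `^ alpha).
  by rewrite powRN mulrC ler_pdivrMr ?powR_gt0.
split=> [h Q|h].
  rewrite -le -lee_fin -key; apply: le_trans h.
  by apply: ereal_sup_ubound; exists Q.
by apply: ge_ereal_sup => _ [Q _ <-]; rewrite key lee_fin le.
Qed.

End haar_coefficients.

(** * Lipschitz and BMO symbols: boundedness of the paraproduct *)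

Section lipschitz_upper.
Context {R : realType} {n : nat}.
Local Notation T := (dyadic_cube n).
Local Notation E := (n.-tuple bool).
Local Notation mu := (@lebesgue_tuple R n).
Implicit Types (Q L P : T) (x : Rn R n) (g : dyadic_distribution R n) (f b : Rn R n -> R[i]).

Lemma side_gt0 Q : 0 < side Q :> R. Proof. by rewrite /side exprz_gt0. Qed.

Lemma side_parent Q : side (parent Q) = 2 * side Q :> R.
Proof. by rewrite /side /= expfzDr// mulrC. Qed.

Let two_powR_gt1 (a : R) : 0 < a -> 1 < 2 `^ a.
Proof.
move=> a0; have : (1 : R) `^ a < 2 `^ a.
  by apply: gt0_ltr_powR; rewrite ?nnegrE ?ltr1n.
by rewrite powR1.
Qed.

(** A sum over a chain of terms dominated by a growing and by a decaying power
    of the side length is comparable to its value where the two balance. *)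
Lemma pathsum_geometric (d : T -> R) J Q (tau del gam A1 A2 : R) :
  0 < tau -> 0 < del -> 0 < gam -> 0 <= A1 -> 0 <= A2 ->
  (forall j, (j < J)%N -> d (anc j Q) <= A1 * side (anc j Q) `^ del) ->
  (forall j, (j < J)%N -> d (anc j Q) <= A2 * side (anc j Q) `^ (- gam)) ->
  pathsum J d Q <= A1 * (2 `^ del / (2 `^ del - 1)) * tau `^ del +
                   A2 * (1 - 2 `^ (- gam))^-1 * tau `^ (- gam).
Proof.
move=> tau0 del0 gam0 A10 A20.
have two1 : 1 < 2 `^ del :> R by exact: two_powR_gt1.
have two2 : 2 `^ (- gam) < 1 :> R.
  rewrite powRN invf_lt1 ?powR_gt0//.
  exact: two_powR_gt1.
have two3 : 0 < 2 `^ (- gam) :> R by rewrite powR_gt0.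
set k1 := 2 `^ del / (2 `^ del - 1); set k2 := (1 - 2 `^ (- gam))^-1.
have k20 : 0 < k2 by rewrite invr_gt0 subr_gt0.
(* the two geometric sums over the chain above a cube of side [s], one over the
   sides up to [tau] and one over the sides beyond *)
pose bd (s : R) := A1 * (if s <= tau then (2 `^ del * tau `^ del - s `^ del) / (2 `^ del - 1) else 0)
  + A2 * k2 * Num.max s tau `^ (- gam).
have bd_le s : 0 < s -> bd s <= A1 * k1 * tau `^ del + A2 * k2 * tau `^ (- gam).
  move=> s0; apply: lerD.
    rewrite -mulrA ler_wpM2l//; case: ifP => _; last first.
      by rewrite mulr_ge0 ?powR_ge0// divr_ge0 ?powR_ge0 ?subr_ge0 ?ltW.
    rewrite /k1 mulrAC ler_pM2r ?invr_gt0 ?subr_gt0//.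
    by have := powR_ge0 s del; lra.
  rewrite ler_wpM2l//; first by rewrite mulr_ge0// ltW.
  rewrite !powRN lef_pV2 ?posrE ?powR_gt0// ?lt_max ?s0//.
  by apply: ge0_ler_powR; rewrite ?nnegrE ?(ltW gam0) ?(ltW tau0) ?le_max ?lexx ?(ltW s0) ?orbT.
move=> h1 h2; apply: le_trans (bd_le _ (side_gt0 Q)).
have bd0 s : 0 < s -> 0 <= bd s.
  move=> s0; rewrite addr_ge0// mulr_ge0 ?powR_ge0 ?mulr_ge0 ?(ltW k20)//.
  case: ifP => // stau; apply: divr_ge0; last by rewrite subr_ge0 ltW.
  rewrite subr_ge0.
  have st : s `^ del <= tau `^ del by rewrite ge0_ler_powR ?nnegrE ?(ltW del0) ?(ltW s0) ?(ltW tau0).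
  have := powR_ge0 s del; nra.
elim: J Q h1 h2 => [|J IH] Q h1 h2; first by rewrite bd0// side_gt0.
rewrite /=; apply: (@le_trans _ _ (bd (2 * side Q) + d Q)).
  rewrite lerD2r -side_parent; apply: IH => j jJ; rewrite -ancSr.
    exact: h1.
  exact: h2.
have {h1} := h1 0%N isT; have {h2} := h2 0%N isT; rewrite /=.
set s := side Q; have s0 : 0 < s by exact: side_gt0.
have e1 : (2 * s) `^ del = 2 `^ del * s `^ del by rewrite powRM// ltW.
have e2 : (2 * s) `^ (- gam) = 2 `^ (- gam) * s `^ (- gam) by rewrite powRM// ltW.
move=> h2 h1; rewrite /bd; have [stau|taus] := leP s tau.
  have st : s `^ del <= tau `^ del by rewrite ge0_ler_powR ?nnegrE ?(ltW del0) ?(ltW s0) ?(ltW tau0).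
  have [s2|s2] := leP (2 * s) tau.
    rewrite e1.
    suff : d Q <= A1 * ((2 `^ del * tau `^ del - s `^ del) / (2 `^ del - 1)) -
      A1 * ((2 `^ del * tau `^ del - 2 `^ del * s `^ del) / (2 `^ del - 1)) by lra.
    apply: le_trans h1 _; rewrite -mulrBr -mulrBl ler_wpM2l//.
    rewrite (_ : _ - _ = s `^ del * (2 `^ del - 1)); last by ring.
    by rewrite mulfK// gt_eqF// subr_gt0.
  have m2 : (2 * s) `^ (- gam) <= tau `^ (- gam).
    rewrite !powRN lef_pV2 ?posrE ?powR_gt0// ?mulr_gt0//.
    by apply: ge0_ler_powR; rewrite ?nnegrE ?(ltW gam0) ?(ltW tau0)// ?mulr_ge0 ?ltW.
  rewrite mulr0 add0r addrC; apply: lerD; last first.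
    by rewrite ler_wpM2l// mulr_ge0// ltW.
  apply: le_trans h1 _; rewrite ler_wpM2l// ler_pdivlMr ?subr_gt0//.
  have := powR_ge0 s del; nra.
have s2 : tau < 2 * s by lra.
rewrite (leNgt (2 * s) tau) s2 /= (max_l (ltW s2)) !mulr0 !add0r.
suff : d Q <= A2 * k2 * s `^ (- gam) - A2 * k2 * (2 * s) `^ (- gam) by lra.
apply: le_trans h2 _; rewrite e2.
rewrite (_ : _ - _ = A2 * (k2 * (1 - 2 `^ (- gam)) * s `^ (- gam))); last by ring.
by rewrite /k2 mulVf ?mul1r// gt_eqF// subr_gt0.
Qed.

Lemma avgmax_ge f J j Q : (j < J)%N -> cabs (average f (anc j Q)) <= avgmax f J Q.
Proof.
elim: J j Q => [//|J IH] [|j] Q jJ; rewrite avgmaxS le_max ?lexx ?orbT//.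
by rewrite ancSr IH.
Qed.

Lemma average_powR_le f (p I : R) Q : 0 < p ->
  (\int[mu]_x maximal_function f x `^ p <= I%:E)%E ->
  cabs (average f Q) `^ p * vol Q <= I.
Proof.
move=> p0 hI; rewrite -lee_fin; apply: le_trans hI.
have mM : measurable_fun [set: Rn R n] (fun x => (maximal_function f x `^ p)%E).
  exact: measurableT_comp (measurable_poweR p) (measurable_maximal_function f).
apply: (@le_trans _ _ (\int[mu]_(x in hcube Q) maximal_function f x `^ p)%E); last first.
  apply: ge0_subset_integral => //; first exact: measurable_hcube.
  by move=> x _; exact: poweR_ge0.
have <- : (\int[mu]_(x in hcube Q) (cabs (average f Q) `^ p)%:E =
    (cabs (average f Q) `^ p * vol Q)%:E)%E.
  rewrite (integral_cst mu (measurable_hcube Q) (cabs (average f Q) `^ p)%:E).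
  by rewrite [X in (_ * X)%E]mu_hcube.
apply: ge0_le_integral => //.
- exact: measurable_hcube.
- by move=> x _; rewrite lee_fin powR_ge0.
- exact: measurable_funTS.
move=> x Qx; rewrite -poweR_EFin; apply: le_poweR; rewrite ?lee_fin ?cabs_ge0 ?(ltW p0)//.
by rewrite -Qx; exact: ge_maximal_function.
Qed.

(** A bound in the mean over finite trees, with the same constant for all
    trees, gives the bound for the integrals. *)
Lemma integral_square_sum_avgmax g f (p q C : R) : 0 < p -> 0 < q -> 0 <= C ->
  (forall K e, tmean (K + K) (fun L => pathsum (K + K) (energy g) L `^ (q / 2)) (corner K e) <=
     C * tmean (K + K) (fun L => avgmax f (K + K).+1 L `^ p) (corner K e)) ->
  (\int[mu]_x square_sum g x `^ (q / 2) <= C%:E * \int[mu]_x maximal_function f x `^ p)%E.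
Proof.
move=> p0 q0 C0 h; apply: integral_square_sum_le => [|K]; first by rewrite divr_gt0.
have mM : measurable_fun [set: Rn R n] (fun x => (maximal_function f x `^ p)%E).
  exact: measurableT_comp (measurable_poweR p) (measurable_maximal_function f).
apply: (@le_trans _ _ (\sum_(e : E) C%:E * \int[mu]_(x in hcube (corner K e)) maximal_function f x `^ p)%E); last first.
  rewrite -ge0_sume_distrr; last by move=> e _; apply: integral_ge0 => x _; exact: poweR_ge0.
  apply: lee_wpmul2l; first by rewrite lee_fin.
  by apply: sum_corners_le => // x; exact: poweR_ge0.
apply: lee_sum => e _.
have eK : - K%:Z = (corner K e).1 - (K + K)%N%:Z by rewrite /=; lia.
apply: (@le_trans _ _ (C%:E * \int[mu]_(x in hcube (corner K e))
    (avgmax f (K + K).+1 (node (- K%:Z) x) `^ p)%:E)%E); last first.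
  apply: lee_wpmul2l; first by rewrite lee_fin.
  apply: ge0_le_integral => //.
  - exact: measurable_hcube.
  - by move=> x _; rewrite lee_fin powR_ge0.
  - apply: measurable_funTS; apply/measurable_EFinP.
    exact: (measurable_node (fun L => avgmax f (K + K).+1 L `^ p)).
  - exact: measurable_funTS.
  move=> x _; rewrite -poweR_EFin; apply: le_poweR; rewrite ?lee_fin ?avgmax_ge0 ?(ltW p0)//.
  exact: avgmax_le_maximal.
rewrite eK (integral_node (fun L => pathsum (K + K) (energy g) L `^ (q / 2))).
rewrite (integral_node (fun L => avgmax f (K + K).+1 L `^ p)).
by rewrite -EFinM lee_fin mulrCA ler_pM2l ?vol_gt0.
Qed.

Lemma energy_lipschitz b (alpha B : R) Q : locally_integrable_Rn b -> 0 <= B ->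
  (forall Q, oscillation b (average b Q) Q <= B * side Q `^ alpha) ->
  energy (haar_coef b) Q <= (2 ^+ n * B) ^+ 2 * side Q `^ (2 * alpha).
Proof.
move=> lb B0 hB; have := energy_haar_coef Q (average b Q) lb.
rewrite subrr (_ : cabs 0 = 0); last exact: ComplexField.Normc.normc0.
rewrite expr0n addr0 => ->.
have -> : side Q `^ (2 * alpha) = (side Q `^ alpha) ^+ 2 :> R.
  by rewrite -powR_mulrn ?powR_ge0// -powRrM mulrC.
rewrite -exprMn -[leRHS](av_cst (n := n)); apply: ler_av => e.
rewrite ler_sqr ?nnegrE ?cabs_ge0 ?mulr_ge0 ?powR_ge0 ?exprn_ge0//.
apply: le_trans (oscillation_ge _ _ lb) _.
apply: le_trans (@ge0_av_ge _ _ (fun e => oscillation b (average b Q) (child Q e)) e _) _.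
  by move=> e'; apply: le_trans (cabs_ge0 _) (oscillation_ge _ _ lb).
by rewrite -oscillation_child// -mulrA ler_pM2l ?exprn_gt0.
Qed.

(** For [0 < alpha] the bound is pointwise, as in Hedberg's inequality: the
    energy of the symbol at a cube is at most a power of its side length, and
    the averages of [f] are bounded by [M f] on small cubes and by the decay
    forced by the norm of [f] on large ones. *)
Lemma dotHp_paraproduct_lipschitz (p alpha q : R) : (0 < n)%N ->
  0 < p -> 0 < alpha -> alpha * p < n%:R -> q^-1 = p^-1 - alpha / n%:R ->
  exists2 C : R, 0 < C & forall b f (B : R), locally_integrable_Rn b -> 0 < B ->
  (forall Q, oscillation b (average b Q) Q <= B * side Q `^ alpha) ->
  (Hp_norm p f < +oo)%E ->
  (dotHp_norm q (paraproduct (haar_coef b) f) <= (C * B)%:E * Hp_norm p f)%E.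
Proof.
move=> n0 p0 al0 alp qE.
have n0' : 0 < n%:R :> R by rewrite ltr0n.
have q0 : 0 < q.
  by rewrite -invr_gt0 qE subr_gt0 ltr_pdivrMr// mulrC ltr_pdivlMr.
pose del := 2 * alpha; have del0 : 0 < del by rewrite mulr_gt0.
pose gam := 2 * n%:R / p - del.
have gam0 : 0 < gam.
  rewrite subr_gt0 ltr_pdivlMr// /del; nra.
pose k1 : R := 2 `^ del / (2 `^ del - 1); pose k2 : R := (1 - 2 `^ (- gam))^-1.
have two1 : 1 < 2 `^ del :> R by exact: two_powR_gt1.
have two2 : 2 `^ (- gam) < 1 :> R.
  rewrite powRN invf_lt1 ?powR_gt0//.
  exact: two_powR_gt1.
have k10 : 0 < k1 by rewrite divr_gt0 ?powR_gt0 ?subr_gt0.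
have k20 : 0 < k2 by rewrite invr_gt0 subr_gt0.
have k0 : 0 < k1 + k2 by rewrite addr_gt0.
have D0 : 0 < 2 ^+ n :> R by rewrite exprn_gt0.
exists (2 ^+ n * (k1 + k2) `^ 2^-1) => [|b f B lb B0 hB Hf].
  by rewrite mulr_gt0 ?powR_gt0.
set g := haar_coef b.
have int0 : (0 <= \int[mu]_x maximal_function f x `^ p)%E.
  by apply: integral_ge0 => x _; exact: poweR_ge0.
have : (\int[mu]_x maximal_function f x `^ p < +oo)%E.
  by move: Hf; rewrite Hp_normE; apply: lty_poweRy; rewrite invr_eq0 gt_eqF.
case intE : (\int[mu]_x maximal_function f x `^ p)%E int0 => [I| |] // I0 _.
rewrite lee_fin in I0.
have hI : (\int[mu]_x maximal_function f x `^ p <= I%:E)%E by rewrite intE.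
pose th := alpha / n%:R.
have thp : 1 - p * th = p / q.
  by rewrite qE mulrBr mulfV ?gt_eqF// /th mulrA.
have chain J Q : pathsum J (energy (paraproduct g f)) Q <=
   (2 ^+ n * B) ^+ 2 * (k1 + k2) * (avgmax f J Q `^ (2 * (p / q)) * I `^ (2 * th)).
  set m := avgmax f J Q; have m0 : 0 <= m by exact: avgmax_ge0.
  have [mE|mn0] := eqVneq m 0.
    apply: le_trans (pathsum_paraproduct_le _ _ _ _) _; rewrite -/m mE expr0n mul0r.
    by rewrite !mulr_ge0 ?powR_ge0 ?exprn_ge0 ?(ltW D0) ?(ltW B0) ?(ltW k0).
  have m_gt0 : 0 < m by rewrite lt_neqAle eq_sym mn0.
  have I_gt0 : 0 < I.
    rewrite lt_neqAle I0 andbT eq_sym; apply/eqP => IE; move/eqP: mn0; apply.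
    have z P : cabs (average f P) = 0.
      have := average_powR_le P p0 hI; rewrite IE pmulr_lle0 ?vol_gt0// => h.
      apply/eqP; have : cabs (average f P) `^ p == 0.
        by rewrite eq_le h powR_ge0.
      by rewrite powR_eq0 => /andP[].
    rewrite /m; elim: (J) (Q) => [//|j IH] P.
    by rewrite avgmaxS IH z maxxx.
  (* the side of the cubes of volume [I / m `^ p], on which the largest average
     allowed by [I] is [m] *)
  pose tau := (I * m `^ (- p)) `^ n%:R^-1.
  have tau0 : 0 < tau by rewrite powR_gt0// mulr_gt0// powR_gt0.
  pose DB := (2 ^+ n * B) ^+ 2; have DB0 : 0 <= DB by rewrite sqr_ge0.
  have DB0' : 0 <= 2 ^+ n * B by rewrite mulr_ge0 ?ltW.
  have en P := energy_lipschitz P lb (ltW B0) hB.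
  have s0 P : 0 < side P :> R by exact: side_gt0.
  have d1 j : (j < J)%N -> energy (paraproduct g f) (anc j Q) <=
      DB * m ^+ 2 * side (anc j Q) `^ del.
    move=> jJ; rewrite energy_paraproduct.
    rewrite [leRHS](_ : _ = m ^+ 2 * (DB * side (anc j Q) `^ del)); last by ring.
    apply: ler_pM; rewrite ?sqr_ge0 ?energy_ge0 ?en//.
    by rewrite ler_sqr ?nnegrE ?cabs_ge0// avgmax_ge.
  have d2 j : (j < J)%N -> energy (paraproduct g f) (anc j Q) <=
      DB * I `^ (2 / p) * side (anc j Q) `^ (- gam).
    move=> _; set P := anc j Q; rewrite energy_paraproduct.
    have aP : cabs (average f P) ^+ 2 <= I `^ (2 / p) * side P `^ (- (2 * n%:R / p)).
      have := average_powR_le P p0 hI; rewrite vol_side -ler_pdivlMr ?exprn_gt0// => h.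
      have -> : cabs (average f P) ^+ 2 = (cabs (average f P) `^ p) `^ (2 / p).
        rewrite -powR_mulrn ?cabs_ge0// -powRrM; congr (_ `^ _).
        by field; rewrite gt_eqF.
      have -> : side P `^ (- (2 * n%:R / p)) = (side P ^+ n)^-1 `^ (2 / p) :> R.
        rewrite -powR_mulrn ?(ltW (s0 _))// -powRN -powRrM; congr (_ `^ _); ring.
      rewrite -powRM//; last by rewrite invr_ge0 exprn_ge0// ltW.
      apply: ge0_ler_powR; rewrite ?nnegrE ?powR_ge0 ?divr_ge0 ?(ltW p0)//.
      by rewrite exprn_ge0// ltW.
    have -> : DB * I `^ (2 / p) * side P `^ (- gam) =
        (I `^ (2 / p) * side P `^ (- (2 * n%:R / p))) * (DB * side P `^ del).
      rewrite /gam opprB powRD; last by rewrite (gt_eqF (s0 P)) implybT.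
      by ring.
    by apply: ler_pM; rewrite ?sqr_ge0 ?energy_ge0 ?en.
  have := pathsum_geometric tau0 del0 gam0 _ _ d1 d2.
  move=> /(_ (mulr_ge0 DB0 (sqr_ge0 _)) (mulr_ge0 DB0 (powR_ge0 _ _))) /le_trans; apply.
  rewrite -/k1 -/k2.
  have mexp : 2 * (p / q) = 2 - 2 * p * th by rewrite -thp; ring.
  have IM : (I * m `^ (- p)) `^ th = I `^ th * m `^ (- (p * th)).
    by rewrite powRM ?powR_ge0// -powRrM mulNr.
  have t1 : m ^+ 2 * tau `^ del = m `^ (2 * (p / q)) * I `^ (2 * th).
    rewrite -powRrM (_ : n%:R^-1 * del = 2 * th); last by rewrite /th /del; ring.
    rewrite powRM ?powR_ge0// -powRrM mulrCA mulrC; congr (_ * _).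
    rewrite mexp -powR_mulrn// -powRD; last by rewrite mn0 implybT.
    by congr (_ `^ _); ring.
  have t2 : I `^ (2 / p) * tau `^ (- gam) = m `^ (2 * (p / q)) * I `^ (2 * th).
    rewrite -powRrM (_ : n%:R^-1 * - gam = 2 * th - 2 / p); last first.
      by rewrite /gam /th /del; field; rewrite !gt_eqF.
    rewrite powRM ?powR_ge0// -powRrM mulrA -powRD; last by rewrite (gt_eqF I_gt0) implybT.
    rewrite mulrC; congr (_ * _); last by congr (_ `^ _); ring.
    by congr (_ `^ _); rewrite mexp; field; rewrite gt_eqF.
  rewrite (_ : DB * m ^+ 2 * k1 * tau `^ del = DB * k1 * (m ^+ 2 * tau `^ del)); last by ring.
  rewrite (_ : DB * I `^ (2 / p) * k2 * tau `^ (- gam) = DB * k2 * (I `^ (2 / p) * tau `^ (- gam))); last by ring.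
  by rewrite t1 t2 -mulrDl -mulrDr.
pose K0 := 2 ^+ n * (k1 + k2) `^ 2^-1 * B.
have K00 : 0 <= K0 by rewrite !mulr_ge0 ?powR_ge0 ?(ltW D0) ?(ltW B0).
have q20 : 0 <= q / 2 by rewrite divr_ge0 ?ltW.
have Ith : I `^ (q * th) * I = I `^ (q / p).
  have [->|In0] := eqVneq I 0.
    by rewrite mulr0 powR0// mulf_neq0 ?invr_eq0 ?gt_eqF.
  rewrite -{2}[I]powRr1// -powRD; last by rewrite In0 implybT.
  congr (_ `^ _); have : q * q^-1 = q * (p^-1 - alpha / n%:R) by rewrite qE.
  rewrite mulfV ?gt_eqF// => ->; rewrite /th; ring.
have main : (\int[mu]_x square_sum (paraproduct g f) x `^ (q / 2) <=
    (K0 `^ q * I `^ (q / p))%:E)%E.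
  rewrite -Ith mulrA EFinM -intE.
  apply: integral_square_sum_avgmax => //; first by rewrite mulr_ge0 ?powR_ge0.
  move=> K e; rewrite -tmeanZ; apply: ler_tmean => L _.
  set m := avgmax f (K + K).+1 L.
  have mm : avgmax f (K + K) L <= m.
    rewrite /m; elim: (K + K)%N (L) => [|J IH] P; first exact: avgmax_ge0.
    rewrite (avgmaxS f J.+1) (avgmaxS f J P) ge_max.
    by apply/andP; split; rewrite le_max; apply/orP; [left; exact: IH|right].
  have m0 : 0 <= m by exact: avgmax_ge0.
  have DBk : 0 <= (2 ^+ n * B) ^+ 2 * (k1 + k2).
    by apply: mulr_ge0; [exact: sqr_ge0|exact: ltW].
  apply: (@le_trans _ _ (((2 ^+ n * B) ^+ 2 * (k1 + k2) * (m `^ (2 * (p / q)) * I `^ (2 * th))) `^ (q / 2))).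
    apply: ge0_ler_powR => //; rewrite ?nnegrE.
    - by apply: pathsum_ge0 => P; exact: energy_ge0.
    - exact: mulr_ge0 DBk (mulr_ge0 (powR_ge0 _ _) (powR_ge0 _ _)).
    apply: le_trans (chain _ _) _; rewrite ler_wpM2l//.
    rewrite ler_wpM2r ?powR_ge0// ge0_ler_powR ?nnegrE ?avgmax_ge0//.
    by rewrite mulr_ge0// divr_ge0 ?ltW.
  rewrite (_ : (2 ^+ n * B) ^+ 2 * (k1 + k2) = K0 ^+ 2); last first.
    rewrite /K0 !exprMn -(powR_mulrn 2 (powR_ge0 (k1 + k2) _)) -powRrM.
    by rewrite mulVf// powRr1 ?(ltW k0)//; ring.
  rewrite powRM ?sqr_ge0 ?mulr_ge0 ?powR_ge0// powRM ?powR_ge0//.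
  rewrite -(powR_mulrn 2 K00) -!powRrM.
  rewrite (_ : 2 * (q / 2) = q); last by field.
  rewrite (_ : 2 * (p / q) * (q / 2) = p); last by field; rewrite gt_eqF.
  rewrite (_ : 2 * th * (q / 2) = q * th); last by field.
  by rewrite [m `^ p * _]mulrC mulrA.
rewrite dotHp_normE ?gt_eqF// Hp_normE intE poweR_EFin -EFinM.
rewrite (_ : 2 ^+ n * (k1 + k2) `^ 2^-1 * B * I `^ p^-1 =
  (K0 `^ q * I `^ (q / p)) `^ q^-1); last first.
  rewrite powRM ?powR_ge0// -!powRrM mulfV ?gt_eqF// powRr1//.
  by rewrite -/K0; congr (_ * _ `^ _); field; rewrite !gt_eqF.
rewrite -poweR_EFin; apply: le_poweR => //; first by rewrite invr_ge0 ltW.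
by apply: integral_ge0 => x _; exact: poweR_ge0.
Qed.

(** For [alpha = 0] no single cube decays, but by the John-Nirenberg inequality
    the energies of the symbol form a Carleson sequence, and the embedding
    applies with the maximal function of [f] as the weight. *)
Lemma dotHp_paraproduct_bmo (p : R) : 0 < p ->
  exists2 C : R, 0 < C & forall b f (B : R), locally_integrable_Rn b -> 0 < B ->
  (forall Q, oscillation b (average b Q) Q <= B) ->
  (dotHp_norm p (paraproduct (haar_coef b) f) <= (C * B)%:E * Hp_norm p f)%E.
Proof.
move=> p0; have p20 : 0 < p / 2 by rewrite divr_gt0.
have D0 : 0 < 2 ^+ n :> R by rewrite exprn_gt0.
have [C C0 hC] := @carleson_embedding_pow R n (p / 2) p20.
pose A : R := 2 `^ 2^-1 * (2 ^+ n + 2).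
have A0 : 0 < A by rewrite mulr_gt0 ?powR_gt0// addr_gt0.
exists (C `^ p^-1 * A) => [|b f B lb B0 hB]; first by rewrite mulr_gt0 ?powR_gt0.
set g := haar_coef b.
have Car := john_nirenberg_oscillation B0 (fun z Q => oscillation_child z Q lb)
  (fun z Q => oscillation_ge z Q lb) hB (fun z Q => energy_haar_coef Q z lb).
pose La := (A * B) ^+ 2; have La0 : 0 < La by rewrite exprn_gt0// mulr_gt0.
have LaE : 2 * ((2 ^+ n + 2) * B) ^+ 2 = La.
  rewrite /La /A !exprMn -(powR_mulrn 2 (powR_ge0 2 _)) -powRrM mulVf// powRr1//.
  by ring.
rewrite LaE in Car.
pose c Q := La^-1 * energy g Q.
have c0 Q : 0 <= c Q by rewrite mulr_ge0 ?energy_ge0 ?invr_ge0 ?(ltW La0).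
have carlc N Q : carl N c Q <= 1.
  have -> : carl N c Q = La^-1 * carl N (energy g) Q.
    elim: N Q => [|N IH] Q; first by rewrite /= !addr0.
    by rewrite !carlS mulrDr -avZ; congr (_ + _); apply: eq_av => e.
  by rewrite ler_pdivrMl// mulr1 Car.
(* one more generation than the depth, so that the average over [Q] itself is
   included *)
pose W j Q := La * avgmax f j.+1 Q ^+ 2.
have W0 j Q : 0 <= W j Q by rewrite mulr_ge0 ?sqr_ge0 ?(ltW La0).
have Wm j Q : W j (parent Q) <= W j.+1 Q.
  rewrite /W ler_pM2l// ler_sqr ?nnegrE ?avgmax_ge0//.
  by rewrite [leRHS]avgmaxS le_max lexx.
have main : (\int[mu]_x square_sum (paraproduct g f) x `^ (p / 2) <=
    (C * (A * B) `^ p)%:E * \int[mu]_x maximal_function f x `^ p)%E.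
  apply: integral_square_sum_avgmax => //; first by rewrite mulr_ge0 ?powR_ge0 ?ltW.
  move=> K e; set N := (K + K)%N.
  apply: le_trans (le_trans (hC c W N (corner K e) c0 carlc Wm W0) _).
    apply: ler_tmean => L _; apply: ge0_ler_powR; rewrite ?nnegrE ?(ltW p20)//.
    - by apply: pathsum_ge0 => P; exact: energy_ge0.
    - elim: (N) L => [|k IH] L /=; first by rewrite add0r mulr_ge0.
      by rewrite addr_ge0// mulr_ge0.
    elim: (N) L => [|k IH] L; first by rewrite /= add0r mulr_ge0.
    rewrite wpathsumS [leLHS]/=; apply: lerD => //.
    rewrite (_ : W k.+1 L * c L = avgmax f k.+2 L ^+ 2 * energy g L); last first.
      by rewrite /W /c; field; rewrite gt_eqF.
    rewrite energy_paraproduct.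
    rewrite ler_wpM2r ?energy_ge0// ler_sqr ?nnegrE ?cabs_ge0 ?avgmax_ge0//.
    exact: (@avgmax_ge f _ 0).
  rewrite -mulrA ler_pM2l// -tmeanZ; apply: ler_tmean => L _.
  rewrite /W powRM ?sqr_ge0// /La -!powR_mulrn ?avgmax_ge0 ?mulr_ge0 ?(ltW A0) ?(ltW B0)//.
  by rewrite -!powRrM (_ : 2%:R * (p / 2) = p)//; field.
rewrite dotHp_normE ?gt_eqF// Hp_normE.
have M0 : (0 <= \int[mu]_x maximal_function f x `^ p)%E.
  by apply: integral_ge0 => x _; exact: poweR_ge0.
have AB0 : 0 <= A * B by rewrite mulr_ge0 ?ltW.
have -> : ((C `^ p^-1 * A * B)%:E * (\int[mu]_x maximal_function f x `^ p) `^ p^-1 =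
  ((C * (A * B) `^ p)%:E * \int[mu]_x maximal_function f x `^ p) `^ p^-1)%E.
  rewrite poweRM//; last by rewrite lee_fin mulr_ge0 ?powR_ge0 ?ltW.
  rewrite poweR_EFin powRM ?powR_ge0 ?(ltW C0)// -powRrM mulfV ?gt_eqF// powRr1//.
  by rewrite mulrA.
apply: le_poweR => //; first by rewrite invr_ge0 ltW.
by apply: integral_ge0 => x _; exact: poweR_ge0.
Qed.

End lipschitz_upper.

(** * Martingales bounded in the mean square *)

Section martingale_limit.
Context {R : realType} {n : nat}.
Local Notation T := (dyadic_cube n).
Local Notation E := (n.-tuple bool).
Local Notation mu := (@lebesgue_tuple R n).
Implicit Types (Q L U P : T) (x : Rn R n) (F : T -> R).

(** The Cauchy-Schwarz inequality, linearized with a parameter. *)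
Lemma tmean_norm_le N F Q (s : R) : 0 < s ->
  tmean N (fun L => `|F L|) Q <= (s + s^-1 * tmean N (fun L => F L ^+ 2) Q) / 2.
Proof.
move=> s0; rewrite mulrDl [X in _ + X]mulrAC -tmeanZ.
rewrite -[X in X + _](tmean_cst (n := n) N _ Q) -tmeanD; apply: ler_tmean => L _.
rewrite -(real_normK (num_real (F L))); set y := `|F L|.
rewrite -subr_ge0 (_ : _ - _ = s^-1 / 2 * (y - s) ^+ 2).
  by rewrite mulr_ge0 ?sqr_ge0// divr_ge0// invr_ge0 ltW.
by field; rewrite gt_eqF.
Qed.

Variable beta : T -> R.
Hypothesis beta_av : forall Q, av (fun e => beta (child Q e)) = beta Q.

Lemma tmean_martingale N Q : tmean N beta Q = beta Q.
Proof. by elim: N Q => [//|N IH] Q /=; rewrite (eq_av (w := fun e => beta (child Q e))). Qed.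

Lemma tmean_martingale_shift (z : R) N Q : tmean N (fun L => (beta L - z) ^+ 2) Q =
  tmean N (fun L => beta L ^+ 2) Q - 2 * z * beta Q + z ^+ 2.
Proof.
rewrite -(tmean_martingale N Q) -tmeanZ -tmeanB -[X in _ = _ + X](tmean_cst (n := n) N _ Q).
by rewrite -tmeanD; apply: eq_tmean => L _; ring.
Qed.

(** Orthogonality of martingale increments. *)
Lemma tmean_martingale_increment M i Q :
  tmean (M + i) (fun L => (beta L - beta (anc i L)) ^+ 2) Q =
  tmean (M + i) (fun L => beta L ^+ 2) Q - tmean M (fun L => beta L ^+ 2) Q.
Proof.
rewrite !tmeanDn -tmeanB; apply: eq_tmean => P _.
rewrite (eq_tmean (G := fun L => (beta L - beta P) ^+ 2)); last by move=> L ->.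
by rewrite tmean_martingale_shift; ring.
Qed.

Let sq_mono i j U : (i <= j)%N ->
  tmean i (fun L => beta L ^+ 2) U <= tmean j (fun L => beta L ^+ 2) U.
Proof.
move=> ij; rewrite -subr_ge0 -(subnKC ij) -tmean_martingale_increment.
by apply: tmean_ge0 => L _; exact: sqr_ge0.
Qed.

(** Along a sparse sequence of generations the increments are summable in
    mean, and an upper limit then stays within the tail of the sum of their
    absolute values, wherever that tail is finite. *)
Lemma martingale_limit U (K : R) :
  (forall N, tmean N (fun L => beta L ^+ 2) U <= K) ->
  exists2 b : Rn R n -> R, measurable_fun [set: Rn R n] b &
  forall (eps : R) M, 0 < eps -> exists2 N, (M <= N)%N &
  (\int[mu]_(x in hcube U) `|b x - beta (node (U.1 - N%:Z) x)|%:E <= eps%:E)%E.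
Proof.
move=> aK; pose a N := tmean N (fun L => beta L ^+ 2) U.
have v0 : 0 < vol U :> R by exact: vol_gt0.
(* mean increments whose integrals over [U] sum like powers of [1/2] *)
pose del k : R := (vol U)^-1 / (2 ^ k.+1)%:R.
have del0 k : 0 < del k by rewrite divr_gt0 ?invr_gt0// ltr0n expn_gt0.
have /choice[M hM] : forall k, exists M, forall i, (M <= i)%N -> a i - a M <= del k ^+ 2.
  move=> k; have hs : has_sup (range a).
    split; first by exists (a 0%N); exists 0%N.
    by exists K => _ [N _ <-]; exact: aK.
  have [_ [N _ <-] hN] := sup_adherent (exprn_gt0 2 (del0 k)) hs.
  exists N => i _; have : a i <= sup (range a).
    by apply: sup_upper_bound => //; exists i.
  move: hN; lra.
(* sums of the [M j], for monotonicity; the term [k] makes the sequence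
   unbounded *)
pose N k := ((\sum_(j < k.+1) M j) + k)%N.
have NS k : (N k <= N k.+1)%N by rewrite /N [X in (_ <= X + _)%N]big_ord_recr /=; lia.
have NM k : (M k <= N k)%N by rewrite /N big_ord_recr /=; lia.
have Nk k : (k <= N k)%N by rewrite /N; lia.
have aN k : a (N k.+1) - a (N k) <= del k ^+ 2.
  have := hM k (N k.+1) (leq_trans (NM k) (NS k)).
  have := sq_mono U (NM k); rewrite -/(a _) -/(a _); lra.
pose u k x := beta (node (U.1 - (N k)%:Z) x).
have mu_ k : measurable_fun [set: Rn R n] (u k) by exact: measurable_node.
pose d k x := u k.+1 x - u k x.
have intd k : (\int[mu]_(x in hcube U) `|d k x|%:E <= (1 / (2 ^ k.+1)%:R)%:E)%E.
  have -> : (fun x => `|d k x|%:E) = fun x => ((fun L => `|beta L - beta (anc (N k.+1 - N k) L)|)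
      (node (U.1 - (N k.+1)%:Z) x))%:E.
    apply/funext => x; rewrite /d /u anc_node; congr (`|_ - beta (node _ _)|%:E).
    by have := NS k; lia.
  rewrite (integral_node (fun L => `|beta L - beta (anc (N k.+1 - N k) L)|)) lee_fin.
  have -> : 1 / (2 ^ k.+1)%:R = vol U * del k by rewrite /del mulrA mulfV// gt_eqF.
  rewrite ler_pM2l//; apply: le_trans (tmean_norm_le _ _ _ (del0 k)) _.
  rewrite -{1}(subnKC (NS k)) tmean_martingale_increment subnKC//.
  have : (del k)^-1 * (a (N k.+1) - a (N k)) <= del k.
    by rewrite mulrC ler_pdivrMr// -expr2.
  rewrite -/(a _) -/(a _); lra.
pose b x := fine (limn_esup (fun k => (u k x)%:E)).
pose G m x := (\sum_(0 <= k <oo) `|d (m + k)%N x|%:E)%E.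
have tri m k x : (`|u (m + k)%N x - u m x|%:E <= G m x)%E.
  apply: le_trans (nneseries_lim_ge k _); last by move=> i _ _; rewrite lee_fin.
  rewrite sumEFin lee_fin; elim: k => [|k IH]; first by rewrite addn0 subrr normr0 big_nil.
  rewrite big_nat_recr//= addnS; apply: le_trans _ (lerD IH (lexx _)).
  have -> : u (m + k).+1 x - u m x = (u (m + k)%N x - u m x) + d (m + k)%N x.
    by rewrite /d; ring.
  exact: ler_normD.
have bG m x : (`|b x - u m x|%:E <= G m x)%E.
  case GE : (G m x) => [y| |]; [|by rewrite leey|]; last first.
    by have := tri m 0%N x; rewrite GE.
  have uy k : (m <= k)%N -> u m x - y <= u k x <= u m x + y.
    move=> mk; have := tri m (k - m)%N x; rewrite GE lee_fin subnKC//.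
    by rewrite ler_norml => /andP[? ?]; apply/andP; split; lra.
  have lo : ((u m x - y)%:E <= limn_esup (fun k => (u k x)%:E))%E.
    rewrite limn_esup_lim (cvg_lim _ (@cvg_esups_inf _ _))//.
    apply: le_ereal_inf_tmp => _ [k _ <-].
    apply: (@le_trans _ _ (u (maxn m k) x)%:E).
      by rewrite lee_fin; case/andP: (uy _ (leq_maxl m k)).
    by apply: ereal_sup_ubound; exists (maxn m k) => //=; exact: leq_maxr.
  have hi : (limn_esup (fun k => (u k x)%:E) <= (u m x + y)%:E)%E.
    rewrite limn_esup_lim (cvg_lim _ (@cvg_esups_inf _ _))//.
    apply: le_trans (ereal_inf_lbound _) _; first by exists m.
    apply: ge_ereal_sup => _ [k /= mk <-].
    by rewrite lee_fin; case/andP: (uy _ mk).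
  rewrite lee_fin /b; move: lo hi; case: limn_esup => [w| |] //=.
  by rewrite !lee_fin ler_norml => ? ?; apply/andP; split; lra.
exists b => [|eps M0 eps0].
  apply: (measurableT_comp (fine_measurable measurableT)).
  by apply: measurable_fun_limn_esup => k; exact/measurable_EFinP.
pose m := maxn M0 (Num.bound eps^-1).
exists (N m); first by rewrite (leq_trans _ (Nk m))// leq_maxl.
have md k : measurable_fun (hcube U) (fun x => `|d k x|%:E).
  apply: measurable_funTS; apply/measurable_EFinP.
  by apply: measurableT_comp => //; exact: measurable_funB.
apply: (@le_trans _ _ (\int[mu]_(x in hcube U) G m x)%E).
  apply: ge0_le_integral => //.
  - exact: measurable_hcube.
  - apply: measurable_funTS; apply/measurable_EFinP.
    apply: measurableT_comp => //; apply: measurable_funB; last exact: mu_.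
    apply: (measurableT_comp (fine_measurable measurableT)).
    by apply: measurable_fun_limn_esup => k; exact/measurable_EFinP.
  - by apply: (ge0_emeasurable_sum (P := xpredT)) => // k x _ _; rewrite lee_fin.
  - by move=> x _; exact: bG.
rewrite integral_nneseries//; last exact: measurable_hcube.
apply: (@le_trans _ _ (\sum_(0 <= k <oo) (((2 ^ m)%:R)^-1 / (2 ^ k.+1)%:R)%:E)%E).
  apply: lee_nneseries => [k _ _|k _]; first exact: integral_ge0.
  by apply: le_trans (intd _) _; rewrite lee_fin -addnS expnD natrM invfM mul1r.
apply: le_trans (epsilon_trick0 _ _) _; first by rewrite invr_ge0.
rewrite lee_fin invf_ple ?posrE// ?ltr0n ?expn_gt0//.
apply: le_trans (ltW (archi_boundP _)) _; first by rewrite invr_ge0 ltW.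
rewrite ler_nat (leq_trans (leq_maxr M0 _))//.
exact/ltnW/ltn_expl.
Qed.

End martingale_limit.

(** * Functions with prescribed Haar coefficients *)

Section tree_primitive.
Context {R : realType} {n : nat}.
Local Notation T := (dyadic_cube n).
Implicit Types (Q P : T) (inc : T -> R).

Let pathsumD inc i j Q :
  pathsum (i + j) inc Q = pathsum i inc Q + pathsum j inc (anc i Q).
Proof.
elim: j => [|j IH]; first by rewrite addn0 addr0.
by rewrite addnS !pathsumS_top IH addrA addnC ancD.
Qed.

Let linked P Q := exists i j, anc i P = anc j Q.

Let linked_parent P Q : linked (parent P) Q <-> linked P Q.
Proof.
split=> -[i [j PQ]]; first by exists i.+1, j; rewrite ancSr.
by exists i, j.+1; rewrite -ancSr /anc !iterS -/(anc _ _) PQ.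
Qed.

(** Increments along the tree can be summed: the classes of cubes with a
    common ancestor (one for each orthant) get a base cube each, and the value
    at a cube is the sum of the increments on the way up to a common ancestor
    with the base cube, minus the sum on the way down. *)
Lemma tree_primitive inc : exists beta : T -> R,
  forall Q, beta Q = beta (parent Q) + inc Q.
Proof.
pose base Q := xget (0, [tuple of nseq n 0]) (linked Q).
have base_parent Q : base (parent Q) = base Q.
  by congr xget; apply/funext => P; apply/propext; exact: linked_parent.
have baseP Q : linked Q (base Q) by apply: xgetPex; exists Q, 0%N, 0%N.
pose val Q i j := pathsum i inc Q - pathsum j inc (base Q).
have valE Q i j i' j' : anc i Q = anc j (base Q) -> anc i' Q = anc j' (base Q) ->
    val Q i j = val Q i' j'.
  wlog ii' : i j i' j' / (i <= i')%N.
    by move=> W h h'; case/orP: (leq_total i i') => ?; [|symmetry]; apply: W.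
  move=> h h'.
  have jE : (j' = j + (i' - i))%N.
    have := congr1 fst h; have := congr1 fst h'; rewrite !anc_gen; lia.
  by rewrite /val jE -(subnKC ii') addKn !pathsumD h opprD addrACA subrr addr0.
have /choice[beta betaP] : forall Q, exists y, forall i j,
    anc i Q = anc j (base Q) -> y = val Q i j.
  move=> Q; have [i [j ij]] := baseP Q; exists (val Q i j) => i' j'; exact: valE.
exists beta => Q; have [i [j ij]] := baseP (parent Q).
rewrite (betaP (parent Q) i j ij) (betaP Q i.+1 j); last by rewrite ancSr -base_parent.
by rewrite /val base_parent /= addrAC.
Qed.

End tree_primitive.

Section reconstruction.
Context {R : realType} {n : nat}.
Local Notation T := (dyadic_cube n).
Local Notation E := (n.-tuple bool).
Local Notation mu := (@lebesgue_tuple R n).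
Implicit Types (Q L U P : T) (x : Rn R n).

Variables (inc c : T -> R) (alpha K : R).
Hypothesis alpha0 : 0 <= alpha.
Hypothesis K0 : 0 < K.
Hypothesis inc_av : forall Q, av (fun e => inc (child Q e)) = 0.
Hypothesis inc_sq : forall Q, av (fun e => inc (child Q e) ^+ 2) <= c Q.
Hypothesis carl_le : forall N Q, carl N c Q <= (K * side Q `^ alpha) ^+ 2.

Let measurable_node_dep (F : T -> Rn R n -> R) k :
  (forall Q, measurable_fun [set: Rn R n] (F Q)) ->
  measurable_fun [set: Rn R n] (fun x => F (node k x) x).
Proof.
move=> mF _ B mB; rewrite setTI.
have -> : (fun x => F (node k x) x) @^-1` B =
    \bigcup_(Q in [set: T]) (if Q.1 == k then hcube Q `&` (F Q @^-1` B) else set0).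
  apply/seteqP; split=> x /=.
    by move=> Bx; exists (node k x) => //; rewrite eqxx.
  move=> [Q _]; case: eqP => // Qk [].
  by rewrite /hcube /= Qk => ->.
apply: countable_bigcupT_measurable; first exact: countable_dyadic_cube.
move=> Q; case: ifP => _; last exact: measurable0.
apply: measurableI; first exact: measurable_hcube.
by rewrite -[X in measurable X]setTI; exact: mF.
Qed.

(** A locally integrable real function whose means have the increments [inc]
    and whose mean oscillations are controlled by the Carleson sums. It is
    built on the cubes of side one; a larger cube sees the oscillation on
    these cubes and that of their means, and both are controlled. *)
Lemma reconstruction : exists b : Rn R n -> R,
  [/\ measurable_fun [set: Rn R n] b,
      forall Q, mu.-integrable (hcube Q) (EFin \o b),
      forall Q e, mean b (child Q e) = mean b Q + inc (child Q e) &
      forall Q, mean (fun x => `|b x - mean b Q|) Q <= 2 * K * side Q `^ alpha].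
Proof.
have [beta betaE] := tree_primitive inc.
have beta_child Q e : beta (child Q e) = beta Q + inc (child Q e).
  by rewrite betaE childK.
have beta_av Q : av (fun e => beta (child Q e)) = beta Q.
  rewrite (eq_av (w := fun e => beta Q + inc (child Q e))) => [|e]; last exact: beta_child.
  by rewrite avD av_cst inc_av addr0.
have sq_child (z : R) Q : av (fun e => (beta (child Q e) - z) ^+ 2) <= (beta Q - z) ^+ 2 + c Q.
  rewrite (eq_av (w := fun e => ((beta Q - z) ^+ 2 + 2 * (beta Q - z) * inc (child Q e)) +
    inc (child Q e) ^+ 2)) => [|e]; last by rewrite beta_child; ring.
  by rewrite !avD avZ inc_av av_cst mulr0 addr0 lerD2l.
have sq_tmean (z : R) N Q :
    tmean N.+1 (fun L => (beta L - z) ^+ 2) Q <= (beta Q - z) ^+ 2 + carl N c Q.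
  elim: N Q => [|N IH] Q; first by rewrite /= addr0; exact: sq_child.
  rewrite carlS.
  apply: (@le_trans _ _ (av (fun e => (beta (child Q e) - z) ^+ 2 + carl N c (child Q e)))).
    by apply: ler_av => e; exact: IH.
  by rewrite avD addrA lerD2r.
pose w Q : R := K * side Q `^ alpha.
have w0 Q : 0 < w Q by rewrite mulr_gt0// powR_gt0// side_gt0.
have sq_le (z : R) N Q : tmean N (fun L => (beta L - z) ^+ 2) Q <= (beta Q - z) ^+ 2 + w Q ^+ 2.
  case: N => [|N]; first by rewrite lerDl sqr_ge0.
  by apply: le_trans (sq_tmean z N Q) _; rewrite lerD2l; exact: carl_le.
have /choice[bU hbU] : forall U, exists b : Rn R n -> R, measurable_fun [set: Rn R n] b /\
    forall (eps : R) M, 0 < eps -> exists2 N, (M <= N)%N &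
    (\int[mu]_(x in hcube U) `|b x - beta (node (U.1 - N%:Z) x)|%:E <= eps%:E)%E.
  move=> U; have aK N : tmean N (fun L => beta L ^+ 2) U <= beta U ^+ 2 + w U ^+ 2.
    have := sq_le 0 N U; rewrite subr0; apply: le_trans.
    by rewrite (eq_tmean (G := fun L => (beta L - 0) ^+ 2))// => L _; rewrite subr0.
  by have [b mb hb] := martingale_limit beta_av aK; exists b.
pose b x := bU (node 0 x) x.
have mb : measurable_fun [set: Rn R n] b.
  by apply: measurable_node_dep => Q; case: (hbU Q).
pose bN N x := beta (node (- N%:Z) x).
have mbN N : measurable_fun [set: Rn R n] (bN N) by exact: measurable_node.
have mQ Q := @measurable_hcube R n Q.
have approx U (eps : R) M : U.1 = 0 -> 0 < eps -> exists2 N, (M <= N)%N &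
    (\int[mu]_(x in hcube U) `|b x - bN N x|%:E <= eps%:E)%E.
  move=> U0 /((hbU U).2 _ M)[N MN h]; exists N => //; apply: le_trans h.
  rewrite le_eqVlt; apply/orP; left; apply/eqP; apply: eq_integral => x; rewrite inE.
  by rewrite /b /bN /hcube /= U0 => ->; rewrite sub0r.
have approxQ j Q (eps : R) : (anc j Q).1 = 0 -> 0 < eps -> exists N,
    (\int[mu]_(x in hcube Q) `|b x - bN (j + N)%N x|%:E <= eps%:E)%E.
  move=> Q0 e0; have [N jN h] := approx _ _ j Q0 e0.
  exists (N - j)%N; rewrite subnKC//; apply: le_trans h.
  apply: ge0_subset_integral => //; last by move=> x; exact: hcube_anc.
  apply: measurable_funTS; apply/measurable_EFinP.
  by apply: measurableT_comp => //; exact: measurable_funB.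
have bNE j Q N x : (anc j Q).1 = 0 -> bN (j + N)%N x = beta (node (Q.1 - N%:Z) x).
  by rewrite anc_gen => Q0; rewrite /bN; congr (beta (node _ _)); lia.
have ibN j Q N : (anc j Q).1 = 0 -> mu.-integrable (hcube Q) (EFin \o bN (j + N)%N).
  move=> Q0; apply/integrableP; split.
    by apply: measurable_funTS; exact/measurable_EFinP.
  under eq_integral => x _ do rewrite /= (bNE _ _ _ _ Q0).
  by rewrite (integral_node (fun L => `|beta L|)) ltry.
have idiff j Q (eps : R) N : (\int[mu]_(x in hcube Q) `|b x - bN (j + N)%N x|%:E <= eps%:E)%E ->
    mu.-integrable (hcube Q) (EFin \o (fun x => b x - bN (j + N)%N x)).
  move=> h; apply/integrableP; split; last exact: le_lt_trans h (ltry _).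
  by apply: measurable_funTS; apply/measurable_EFinP; exact: measurable_funB.
have iabs Q (z : R) : mu.-integrable (hcube Q) (EFin \o b) ->
    mu.-integrable (hcube Q) (EFin \o (fun x => `|b x - z|)).
  move=> ib; have icst : mu.-integrable (hcube Q) (EFin \o cst z).
    by apply: integrable_const => //; rewrite [X in (X < _)%E]mu_hcube ltry.
  exact: (integrable_norm (integrableB (mQ Q) ib icst)).
have small j Q : (anc j Q).1 = 0 -> [/\ mu.-integrable (hcube Q) (EFin \o b),
    mean b Q = beta Q & forall z s : R, 0 < s ->
    mean (fun x => `|b x - z|) Q <= (s + s^-1 * ((beta Q - z) ^+ 2 + w Q ^+ 2)) / 2].
  move=> Q0; have v0 : 0 < vol Q :> R by exact: vol_gt0.
  have ib : mu.-integrable (hcube Q) (EFin \o b).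
    have [N h] := approxQ j Q 1 Q0 ltr01.
    rewrite (_ : EFin \o b = (EFin \o (fun x => b x - bN (j + N)%N x)%R) \+ (EFin \o bN (j + N)%N))%E.
      by apply: integrableD (idiff _ _ _ _ h) (ibN _ _ _ Q0).
    by apply/funext => x /=; rewrite -EFinD subrK.
  split=> //.
    apply/eqP; rewrite -subr_eq0 -normr_le0; apply/ler_addgt0Pr => eps eps0.
    rewrite add0r; have [N h] := approxQ j Q (eps * vol Q) Q0 (mulr_gt0 eps0 v0).
    have -> : beta Q = mean (bN (j + N)%N) Q.
      rewrite /mean /Rintegral.
      under eq_integral => x _ do rewrite (bNE _ _ _ _ Q0).
      by rewrite integral_node /= mulrA mulVf ?mul1r ?gt_eqF// tmean_martingale.
    rewrite /mean -mulrBr -RintegralB//; last exact: ibN.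
    rewrite normrM ger0_norm ?invr_ge0 ?(ltW v0)// ler_pdivrMl// [leRHS]mulrC.
    apply: le_trans (le_normr_Rintegral (mQ Q) (idiff _ _ _ _ h)) _.
    rewrite -lee_fin /Rintegral fineK//.
    exact: (integrable_fin_num (mQ Q) (integrable_norm (idiff _ _ _ _ h))).
  move=> z s s0; apply/ler_addgt0Pr => eps eps0.
  have [N h] := approxQ j Q (eps * vol Q) Q0 (mulr_gt0 eps0 v0).
  have hmean : mean (fun x => `|bN (j + N)%N x - z|) Q <=
      (s + s^-1 * ((beta Q - z) ^+ 2 + w Q ^+ 2)) / 2.
    rewrite /mean /Rintegral.
    under eq_integral => x _ do rewrite (bNE _ _ _ _ Q0).
    rewrite (integral_node (fun L => `|beta L - z|)) /= mulrA mulVf ?mul1r ?gt_eqF//.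
    apply: le_trans (tmean_norm_le N (fun L => beta L - z) Q s0) _.
    by rewrite ler_pM2r// lerD2l ler_pM2l ?invr_gt0.
  have icst : mu.-integrable (hcube Q) (EFin \o cst z).
    by apply: integrable_const => //; rewrite [X in (X < _)%E]mu_hcube ltry.
  have i1 := iabs Q z ib.
  have i2 : mu.-integrable (hcube Q) (EFin \o (fun x => `|bN (j + N)%N x - z|)).
    exact: (integrable_norm (integrableB (mQ Q) (ibN _ _ _ Q0) icst)).
  have i3 := integrable_norm (idiff _ _ _ _ h).
  apply: le_trans _ (lerD hmean (lexx _)).
  rewrite /mean -ler_pdivlMl ?invr_gt0// invrK mulrDr mulrA mulfV ?gt_eqF// mul1r.
  rewrite [_ * eps]mulrC.
  apply: (@le_trans _ _ (\int[mu]_(x in hcube Q) (`|bN (j + N)%N x - z| + `|b x - bN (j + N)%N x|))).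
    apply: le_Rintegral => //; first exact: (integrableD (mQ Q) i2 i3).
    move=> x _; rewrite (_ : b x - z = (bN (j + N)%N x - z) + (b x - bN (j + N)%N x)).
      exact: ler_normD.
    by ring.
  rewrite RintegralD// lerD2l -lee_fin /Rintegral fineK//.
  exact: (integrable_fin_num (mQ Q) i3).
(* the oscillation of the means between [Q] and the cubes of side one, and that
   on the cubes of side one *)
pose Y k Q : R := (if k is k'.+1 then carl k' c Q else 0) + K ^+ 2.
have large k Q : Q.1 = k%:Z -> [/\ mu.-integrable (hcube Q) (EFin \o b),
    mean b Q = beta Q & forall z s : R, 0 < s ->
    mean (fun x => `|b x - z|) Q <= (s + s^-1 * ((beta Q - z) ^+ 2 + Y k Q)) / 2].
  elim: k Q => [|k IH] Q Qk.
    have [? ? h] := small 0%N Q Qk; split=> // z s s0; apply: le_trans (h z s s0) _.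
    by rewrite /w /side Qk /Y powR1 mulr1 add0r.
  have ck e : (child Q e).1 = k%:Z by rewrite /= Qk; lia.
  have ib : mu.-integrable (hcube Q) (EFin \o b).
    apply/integrableP; split; first by apply: measurable_funTS; exact/measurable_EFinP.
    rewrite ge0_integral_hcube//; last first.
      by apply: measurable_funTS; apply: measurableT_comp => //; exact/measurable_EFinP.
    by apply: lte_sum_pinfty => e _; have [/integrableP[]] := IH _ (ck e).
  split=> //.
    rewrite mean_child// -beta_av; apply: eq_av => e; by have [_ ->] := IH _ (ck e).
  move=> z s s0; rewrite mean_child; last exact: iabs.
  apply: (@le_trans _ _ (av (fun e =>
      2^-1 * s + (2^-1 * s^-1) * ((beta (child Q e) - z) ^+ 2 + Y k (child Q e))))).
    apply: ler_av => e; have [_ _ h] := IH _ (ck e).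
    by apply: le_trans (h z s s0) _; rewrite le_eqVlt; apply/orP; left; apply/eqP; ring.
  rewrite avD av_cst avZ avD (_ : (s + _) / 2 = 2^-1 * s + 2^-1 * s^-1 *
    ((beta Q - z) ^+ 2 + Y k.+1 Q)); last by ring.
  rewrite lerD2l ler_pM2l ?mulr_gt0 ?invr_gt0//.
  have -> : Y k.+1 Q = c Q + av (fun e => Y k (child Q e)).
    rewrite /Y avD av_cst; case: (k) => [|k'].
      by rewrite av_cst /= addrA.
    by rewrite carlS addrA.
  by rewrite addrA lerD2r.
have all Q : [/\ mu.-integrable (hcube Q) (EFin \o b), mean b Q = beta Q &
    forall z s : R, 0 < s ->
    mean (fun x => `|b x - z|) Q <= (s + s^-1 * ((beta Q - z) ^+ 2 + 2 * w Q ^+ 2)) / 2].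
  have w2 : 0 <= w Q ^+ 2 by exact: sqr_ge0.
  case E : (Q.1) => [k|k].
    have [? ? h] := large k Q E; split=> // z s s0; apply: le_trans (h z s s0) _.
    rewrite ler_pM2r// lerD2l ler_pM2l ?invr_gt0// lerD2l.
    have Kw : K ^+ 2 <= w Q ^+ 2.
      rewrite ler_sqr ?nnegrE ?(ltW K0) ?(ltW (w0 _))// /w ler_peMr ?(ltW K0)//.
      have s1 : 1 <= side Q :> R by rewrite /side E -exprnP exprn_ege1// ler1n.
      have := ge0_ler_powR alpha0 _ _ s1; rewrite powR1; apply; rewrite nnegrE//.
      exact: le_trans s1.
    rewrite /Y; case: (k) => [|k']; first by lra.
    have := carl_le k' Q; rewrite -/(w Q); lra.
  have Q0 : (anc k.+1 Q).1 = 0 by rewrite anc_gen E; lia.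
  have [? ? h] := small _ Q Q0; split=> // z s s0; apply: le_trans (h z s s0) _.
  rewrite ler_pM2r// lerD2l ler_pM2l ?invr_gt0// lerD2l; lra.
exists b; split=> [//|Q|Q e|Q].
- by case: (all Q).
- by have [_ -> _] := all (child Q e); have [_ -> _] := all Q; exact: beta_child.
- have [_ -> h] := all Q; apply: le_trans (h _ _ (w0 Q)) _.
  rewrite subrr expr0n/= add0r -mulrA -/(w Q).
  have := w0 Q; move: (w Q) => y y0.
  rewrite (_ : y^-1 * _ = 2 * y); last by field; rewrite gt_eqF.
  lra.
Qed.

End reconstruction.

(** * Symbols of bounded paraproducts *)

Section walsh_sums.
Context {R : realType} {n : nat}.
Local Notation E := (n.-tuple bool).
Implicit Types (a : haar_index n -> R).

Definition walsh_sum a (e : E) : R := \sum_(i : haar_index n) a i * walsh (val i) e.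

Let av_sum (F : haar_index n -> E -> R) :
  av (fun e => \sum_i F i e) = \sum_i av (F i).
Proof. by rewrite /av exchange_big mulr_suml. Qed.

Lemma av_walsh_sum a : av (walsh_sum a) = 0.
Proof.
rewrite av_sum big1// => i _; rewrite avZ av_walsh.
by rewrite (negbTE (valP i)) mulr0.
Qed.

Lemma av_walshM a i : av (fun e => walsh (val i) e * walsh_sum a e) = a i.
Proof.
rewrite (eq_av (w := fun e => \sum_j a j * (walsh (val i) e * walsh (val j) e))).
  rewrite av_sum (bigD1 i)//= avZ /av walsh_orth eqxx divff ?mulr1 ?gt_eqF ?exprn_gt0//.
  rewrite big1 ?addr0// => j ji; rewrite -/(av _) avZ /av walsh_orth.
  by rewrite (inj_eq val_inj) eq_sym (negbTE ji) mul0r mulr0.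
by move=> e; rewrite /walsh_sum mulr_sumr; apply: eq_bigr => j _; ring.
Qed.

Lemma av_walsh_sum_sq a : av (fun e => walsh_sum a e ^+ 2) = \sum_i a i ^+ 2.
Proof.
rewrite (eq_av (w := fun e => \sum_i a i * (walsh (val i) e * walsh_sum a e))).
  by rewrite av_sum; apply: eq_bigr => i _; rewrite avZ av_walshM.
move=> e; rewrite expr2 {1}/walsh_sum mulr_suml.
by apply: eq_bigr => i _; rewrite mulrA.
Qed.

End walsh_sums.

Section symbols.
Context {R : realType} {n : nat}.
Local Notation T := (dyadic_cube n).
Local Notation E := (n.-tuple bool).
Local Notation mu := (@lebesgue_tuple R n).
Implicit Types (Q L P : T) (x : Rn R n) (g : dyadic_distribution R n) (b : Rn R n -> R[i]).

Lemma locally_integrable_hcubes (h : Rn R n -> R) (a : R) :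
  measurable_fun [set: Rn R n] h ->
  (forall Q, mu.-integrable (hcube Q) (EFin \o h)) ->
  mu.-integrable [set x : Rn R n | forall j, `|tnth x j : R| <= a] (EFin \o h).
Proof.
move=> mh ih; have [K hK] := @central_box_bounded R n a.
apply: (@integrableS _ _ _ _ (central_box K)).
- exact: measurable_central_box.
- exact: measurable_bounded_box.
- exact: hK.
apply/integrableP; split; first by apply: measurable_funTS; exact/measurable_EFinP.
rewrite integral_central_box//; last first.
  by apply: measurableT_comp => //; exact/measurable_EFinP.
by apply: lte_sum_pinfty => e _; have /integrableP[] := ih (corner K e).
Qed.

Let scaled (part : R[i] -> R) g Q (i : haar_index n) : R := part (g Q i) / Num.sqrt (vol Q).

Let cabs2 (w : R[i]) : cabs w ^+ 2 = complex.Re w ^+ 2 + complex.Im w ^+ 2.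
Proof. by case: w => a b; rewrite /cabs /= sqr_sqrtr// addr_ge0 ?sqr_ge0. Qed.

Let scaled_energy (part : R[i] -> R) g Q : (forall z, part z ^+ 2 <= cabs z ^+ 2) ->
  \sum_i scaled part g Q i ^+ 2 <= energy g Q.
Proof.
move=> hpart; rewrite /energy mulr_suml; apply: ler_sum => i _.
rewrite /scaled expr_div_n sqr_sqrtr ?(ltW (vol_gt0 _))//.
by rewrite ler_pM2r ?invr_gt0 ?vol_gt0.
Qed.

(** Real and imaginary parts are reconstructed separately from the increments
    that a function with these Haar coefficients would have; Walsh functions
    are orthogonal, so the increments determine the coefficients. *)
Lemma haar_reconstruction g (alpha K : R) : 0 <= alpha -> 0 < K ->
  (forall N Q, carl N (energy g) Q <= (K * side Q `^ alpha) ^+ 2) ->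
  exists b, [/\ locally_integrable_Rn b, haar_coef b = g &
    (dotLambda_fun_norm alpha b <= (4 * K)%:E)%E].
Proof.
move=> al0 K0 hK.
have component (part : R[i] -> R) : (forall z, part z ^+ 2 <= cabs z ^+ 2) ->
    exists h : Rn R n -> R, [/\ forall a : R, mu.-integrable
        [set x : Rn R n | forall j, `|tnth x j : R| <= a] (EFin \o h),
      forall Q i, \int[mu]_x (h x * haar Q i x) = part (g Q i) &
      forall Q, mean (fun x => `|h x - mean h Q|) Q <= 2 * K * side Q `^ alpha].
  move=> hpart; pose inc Q := walsh_sum (scaled part g (parent Q)) (digit Q).
  have incE Q e : inc (child Q e) = walsh_sum (scaled part g Q) e.
    by rewrite /inc childK digit_child.
  have inc_av Q : av (fun e => inc (child Q e)) = 0.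
    by rewrite (eq_av (incE Q)) av_walsh_sum.
  have inc_sq Q : av (fun e => inc (child Q e) ^+ 2) <= energy g Q.
    under eq_av => e do rewrite incE.
    by rewrite av_walsh_sum_sq; exact: scaled_energy.
  have [h [mh ih hmean hosc]] := reconstruction al0 K0 inc_av inc_sq hK.
  have il a := locally_integrable_hcubes a mh ih.
  exists h; split=> // Q i; have [a Qa] := @cube_bounded R n Q.
  rewrite integral_haar; last first.
    apply: integrableS (il a) => //; [exact: measurable_bounded_box|exact: measurable_cube].
  rewrite (eq_av (w := fun e => mean h Q * walsh (val i) e +
      walsh (val i) e * walsh_sum (scaled part g Q) e)); last first.
    by move=> e; rewrite hmean incE mulrDr [mean h Q * _]mulrC.
  rewrite avD avZ av_walsh (negbTE (valP i)) mulr0 add0r av_walshM.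
  by rewrite /scaled mulrCA divff ?mulr1// gt_eqF// sqrtr_gt0 vol_gt0.
have re_le (z : R[i]) : complex.Re z ^+ 2 <= cabs z ^+ 2 by rewrite cabs2 lerDl sqr_ge0.
have im_le (z : R[i]) : complex.Im z ^+ 2 <= cabs z ^+ 2 by rewrite cabs2 lerDr sqr_ge0.
have [br [ir coefr oscr]] := component (@complex.Re R) re_le.
have [bi [ii coefi osci]] := component (@complex.Im R) im_le.
pose b x : R[i] := Complex (br x) (bi x).
have lb : locally_integrable_Rn b by move=> a; split; [exact: ir|exact: ii].
exists b; split=> //.
  apply/funext => Q; apply/funext => i; rewrite /haar_coef /cintegral.
  rewrite (_ : (fun x => complex.Re _) = fun x => br x * haar Q i x); last first.
    by apply/funext => x /=; rewrite mulr0 subr0.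
  rewrite (_ : (fun x => complex.Im _) = fun x => bi x * haar Q i x); last first.
    by apply/funext => x /=; rewrite mulr0 add0r.
  by rewrite coefr coefi; case: (g Q i).
apply/(dotLambda_fun_norm_le alpha (4 * K) lb) => Q.
have [hr hi] := locally_integrable_hcube Q lb.
have mQ := @measurable_hcube R n Q.
have iabs (h : Rn R n -> R) : mu.-integrable (hcube Q) (EFin \o h) ->
    mu.-integrable (hcube Q) (EFin \o (fun x => `|h x - mean h Q|)).
  move=> ih; have icst : mu.-integrable (hcube Q) (EFin \o cst (mean h Q)).
    by apply: integrable_const => //; rewrite [X in (X < _)%E]mu_hcube ltry.
  exact: (integrable_norm (integrableB mQ ih icst)).
apply: (@le_trans _ _ (mean (fun x => `|br x - mean br Q| + `|bi x - mean bi Q|) Q)).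
  rewrite /oscillation /mean ler_pM2l ?invr_gt0 ?vol_gt0//.
  apply: le_Rintegral => //.
  - apply: integrableS (integrable_oscillation _ _ lb) => //;
      [exact: measurable_cube|exact: hcube_cube].
  - exact: (integrableD mQ (iabs _ hr) (iabs _ hi)).
  by move=> x _; apply: le_trans (cabs_le_ReIm _) _; rewrite averageE// ReB ImB.
rewrite /mean RintegralD//; [|exact: iabs|exact: iabs].
rewrite mulrDr; apply: le_trans (lerD (oscr Q) (osci Q)) _.
by rewrite le_eqVlt; apply/orP; left; apply/eqP; ring.
Qed.

(** A function that oscillates between the children of one cube and is constant
    on them does not see the size of its own averages, and the square function
    of its paraproduct is that of the symbol. This bounds the square sums
    below a cube in a mean of some positive order, hence in distribution, and
    for Carleson sums a bound in distribution is enough. *)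
Lemma carleson_paraproduct (p alpha q : R) : (0 < n)%N -> 0 < p -> 0 <= alpha ->
  0 < q -> q^-1 = p^-1 - alpha / n%:R ->
  exists2 C : R, 0 < C & forall g (A : R), 0 < A ->
  (forall f : Rn R n -> R[i], locally_integrable_Rn f -> (Hp_norm p f < +oo)%E ->
    (dotHp_norm q (paraproduct g f) <= A%:E * Hp_norm p f)%E) ->
  forall N Q, carl N (energy g) Q <= (C * A * side Q `^ alpha) ^+ 2.
Proof.
move=> n0 p0 al0 q0 qE.
have n0' : 0 < n%:R :> R by rewrite ltr0n.
have D0 : 0 < 2 ^+ n :> R by rewrite exprn_gt0.
pose B : R := (2 ^+ n) `^ p^-1; have B0 : 0 < B by rewrite powR_gt0.
exists (Num.sqrt 2 * (2 `^ q^-1 * B)) => [|g A A0 hA N Q].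
  by rewrite mulr_gt0 ?sqrtr_gt0// mulr_gt0// powR_gt0.
set c := energy g; have c0 P : 0 <= c P by exact: energy_ge0.
have mean_le M P : tmean M (fun L => pathsum M.+1 c L `^ (q / 2)) P <=
    (A * B * side P `^ alpha) `^ q.
  pose v j L : R := if j is j'.+1 then sign (digit (anc j' L)) else 0.
  have v0 L : v 0%N L = 0 by [].
  have vav j L : av (fun e => v j.+1 (child L e)) = v j L.
    case: j => [|j].
      by rewrite (eq_av (w := sign)) ?av_sign// => e; rewrite /= digit_child.
    rewrite (eq_av (w := fun=> v j.+1 L)) ?av_cst// => e.
    by rewrite /v ancSr childK.
  have vW j L : (j <= M.+1)%N -> anc M.+1 L = parent P -> `|v j (anc (M.+1 - j) L)| <= 1.
    by case: j => [|j] _ _ /=; rewrite ?normr0 ?norm_sign.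
  have := test_paraproduct v0 vav vW p0 q0 (ltW A0) hA.
  have -> : tmean M.+1 (fun L => (1 : R) `^ p) (parent P) = 1.
    by rewrite powR1 tmean_cst.
  rewrite mulr1 /=.
  have -> : av (fun e => tmean M (fun L => wpathsum (fun j Q => v j Q ^+ 2 * energy g Q) M.+1 L
        `^ (q / 2)) (child (parent P) e)) =
      av (fun e => tmean M (fun L => pathsum M.+1 c L `^ (q / 2)) (child (parent P) e)).
    apply: eq_av => e; apply: eq_tmean => L _; congr (_ `^ _).
    elim: (M.+1) L => [|k IH] L; first by rewrite /= expr0n/= mul0r addr0.
    rewrite wpathsumS IH /=; congr (_ + _).
    by rewrite -(real_normK (num_real (sign _))) norm_sign expr1n mul1r.
  set F := fun e => tmean M _ _ => hF.
  have F0 e : 0 <= F e by apply: tmean_ge0 => L _; exact: powR_ge0.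
  have := ge0_av_ge (digit P) F0; rewrite {1}/F parentK => h.
  apply: le_trans h _.
  have vP : vol (parent P) = 2 ^+ n * vol P :> R.
    by rewrite -{2}(parentK P) vol_child mulrC divfK// gt_eqF.
  have v0P : 0 < vol P :> R by exact: vol_gt0.
  have volE2 : vol P = side P `^ n%:R :> R.
    by rewrite vol_side powR_mulrn// ltW// side_gt0.
  move: hF; rewrite vP mulrAC -ler_pdivlMr// => /le_trans; apply.
  rewrite powRM ?(ltW D0) ?(ltW v0P)// powRM ?powR_ge0//; last by rewrite mulr_ge0 ?ltW.
  rewrite powRM ?(ltW A0) ?(ltW B0)// -!mulrA ler_pM2l ?powR_gt0//.
  rewrite /B -powRrM [p^-1 * q]mulrC ler_pM2l ?powR_gt0// ler_pdivrMr//.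
  rewrite volE2 -!powRrM -powRD; last by rewrite (gt_eqF (side_gt0 _)) implybT.
  rewrite (_ : n%:R * (q / p) = alpha * q + n%:R)//.
  have e2 : q * (p^-1 - alpha / n%:R) = 1 by rewrite -qE mulfV// gt_eqF.
  have -> : q / p = 1 + q * (alpha / n%:R).
    by apply/eqP; rewrite -subr_eq -mulrBr e2.
  by field; rewrite gt_eqF.
(* the height that the square sums below [Q], and below smaller cubes, exceed on
   at most half of the cube, by Chebyshev's inequality *)
pose lam : R := 2 `^ q^-1 * B * A * side Q `^ alpha.
have lam0 : 0 < lam by rewrite !mulr_gt0 ?powR_gt0 ?side_gt0.
have t0 : 0 < lam ^+ 2 by rewrite exprn_gt0.
have -> : (Num.sqrt 2 * (2 `^ q^-1 * B) * A * side Q `^ alpha) ^+ 2 = 2 * lam ^+ 2.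
  by rewrite -!mulrA exprMn sqr_sqrtr// /lam !mulrA.
apply: (john_nirenberg_distribution (k0 := Q.1) (ltW t0) c0) => // M P PQ.
have sPQ : side P `^ alpha <= side Q `^ alpha.
  apply: ge0_ler_powR => //; rewrite ?nnegrE ?(ltW (side_gt0 _))//.
  by rewrite /side ler_weXz2l// ler1n.
have lamq : (lam ^+ 2) `^ (q / 2) = lam `^ q.
  rewrite -powR_mulrn ?(ltW lam0)// -powRrM; congr (_ `^ _).
  by field.
apply: (@le_trans _ _ (tmean M (fun L => (lam `^ q)^-1 * pathsum M.+1 c L `^ (q / 2)) P)).
  apply: ler_tmean => L _; case: ltP => [h|_]; last first.
    by rewrite mulr_ge0 ?invr_ge0 ?powR_ge0.
  rewrite ler_pdivlMl ?powR_gt0// mulr1 -lamq; apply: ge0_ler_powR.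
  - by rewrite divr_ge0 ?ltW.
  - by rewrite nnegrE ltW.
  - by rewrite nnegrE; exact: pathsum_ge0.
  - exact: ltW.
rewrite tmeanZ ler_pdivrMl ?powR_gt0//.
apply: le_trans (mean_le M P) _.
have -> : lam `^ q / 2 = (A * B * side Q `^ alpha) `^ q.
  rewrite (_ : lam = 2 `^ q^-1 * (A * B * side Q `^ alpha)); last by rewrite /lam; ring.
  rewrite powRM ?powR_ge0//; last by rewrite !mulr_ge0 ?powR_ge0 ?ltW.
  by rewrite -powRrM mulVf ?gt_eqF// powRr1// mulrAC divff// mul1r.
apply: ge0_ler_powR; rewrite ?nnegrE ?(ltW q0) ?mulr_ge0 ?powR_ge0 ?(ltW A0) ?(ltW B0)//.
by rewrite ler_pM2l// mulr_gt0.
Qed.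

End symbols.


(** * Equivalence of norms *)

Section operator_norm.
Context {R : realType} {n : nat}.
Implicit Types (g : dyadic_distribution R n) (f : Rn R n -> R[i]) (X Y : \bar R).
Local Open Scope ereal_scope.

Lemma paraproduct_norm_le p q g X : 0 <= X ->
  (forall f, locally_integrable_Rn f -> Hp_norm p f < +oo ->
    dotHp_norm q (paraproduct g f) <= X * Hp_norm p f) ->
  paraproduct_norm p q g <= X.
Proof. by move=> X0 hX; apply: ereal_inf_lbound; split. Qed.

(** An infinite operator bound is no constraint, and a zero bound is a limit
    of positive ones. *)
Lemma le_paraproduct_norm p q g X (C : R) : (0 < C)%R ->
  (forall A : R, (0 < A)%R ->
    (forall f, locally_integrable_Rn f -> Hp_norm p f < +oo ->
      dotHp_norm q (paraproduct g f) <= A%:E * Hp_norm p f) ->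
    X <= (C * A)%:E) ->
  (C^-1)%:E * X <= paraproduct_norm p q g.
Proof.
move=> C0 hX; apply: le_ereal_inf_tmp => -[A| |] [// A0 hA]; last by rewrite leey.
apply/lee_addgt0Pr => eps eps0; rewrite lee_pdivrMl// -EFinD -EFinM.
apply: hX => [|f lf Hf]; first by rewrite ltr_wpDl.
apply: le_trans (hA f lf Hf) _; apply: lee_wpmul2r; first exact: Lnorm_ge0.
by rewrite lee_fin lerDl ltW.
Qed.

End operator_norm.

Theorem theorem3p1 (R : realType) (n : nat) (n_gt0 : (0 < n)%N) :
  (forall p q r : R, 0 < p -> 0 < q -> 0 < r -> q^-1 = p^-1 + r^-1 ->
    exists C : R, 0 < C /\
      forall g : dyadic_distribution R n,
        ((C^-1)%:E * dotHp_norm r g <= paraproduct_norm p q g)%E /\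
        (paraproduct_norm p q g <= C%:E * dotHp_norm r g)%E) /\
  (forall p alpha pstar : R,
    0 < p -> 0 <= alpha * p < n%:R -> pstar^-1 = p^-1 - alpha / n%:R ->
    exists C : R, 0 < C /\
      forall g : dyadic_distribution R n,
        ((C^-1)%:E * dotLambda_norm alpha g <= paraproduct_norm p pstar g)%E /\
        (paraproduct_norm p pstar g <= C%:E * dotLambda_norm alpha g)%E).
Proof.
split=> [p q r p0 q0 r0 pqr|p alpha q p0 /andP[alp0 alpn] qE].
  have [C C0 hC] := @dotHp_le_paraproduct R n p q r n_gt0 p0 q0 r0 pqr.
  have C10 : 0 < C + 1 by rewrite addr_gt0.
  exists (C + 1); split=> // g; split.
    apply: le_paraproduct_norm => // A A0 hA.
    apply: le_trans (hC g A (ltW A0) hA) _.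
    by rewrite lee_fin ler_pM2r// lerDl.
  apply: (@le_trans _ _ (dotHp_norm r g)).
    by apply: paraproduct_norm_le => [|f _ _]; [exact: Lnorm_ge0|exact: dotHp_paraproduct_le].
  rewrite -[leLHS]mul1e; apply: lee_wpmul2r; first exact: Lnorm_ge0.
  by rewrite lee_fin lerDr ltW.
have n0 : 0 < n%:R :> R by rewrite ltr0n.
have al0 : 0 <= alpha by rewrite -(pmulr_lge0 _ p0).
have q0 : 0 < q.
  by rewrite -invr_gt0 qE subr_gt0 ltr_pdivrMr// mulrC ltr_pdivlMr.
have [C1 C10 upper] : exists2 C : R, 0 < C &
    forall (b f : Rn R n -> R[i]) (B : R), locally_integrable_Rn b -> 0 < B ->
    (forall Q, oscillation b (average b Q) Q <= B * side Q `^ alpha) ->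
    (Hp_norm p f < +oo)%E ->
    (dotHp_norm q (paraproduct (haar_coef b) f) <= (C * B)%:E * Hp_norm p f)%E.
  move: al0; rewrite le_eqVlt => /orP[/eqP al0|al0].
    have [C C0 hC] := @dotHp_paraproduct_bmo R n p p0; exists C => // b f B lb B0 hB _.
    have -> : q = p by apply: invr_inj; rewrite qE -al0 mul0r subr0.
    apply: hC => // Q; have := hB Q.
    by rewrite -al0 powRr0 mulr1.
  exact: dotHp_paraproduct_lipschitz.
have [C2 C20 carleson] := @carleson_paraproduct R n p alpha q n_gt0 p0 al0 q0 qE.
pose C := C1 + 4 * C2; have C0 : 0 < C by rewrite addr_gt0// mulr_gt0.
exists C; split=> // g; split.
  apply: le_paraproduct_norm => // A A0 hA.
  have [b [lb bg hb]] := haar_reconstruction al0 (mulr_gt0 C20 A0) (carleson g A A0 hA).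
  apply: (@le_trans _ _ (dotLambda_fun_norm alpha b)).
    by apply: ereal_inf_lbound; exists b.
  by apply: le_trans hb _; rewrite lee_fin mulrA ler_pM2r// lerDr ltW.
rewrite -lee_pdivrMl//; apply: le_ereal_inf_tmp => _ [b [lb bg] <-].
have b0 : (0 <= dotLambda_fun_norm alpha b)%E.
  pose Q0 : dyadic_cube n := (0, [tuple of nseq n 0]).
  apply: le_trans (ereal_sup_ubound _); last by exists Q0.
  rewrite mule_ge0 ?lee_fin ?powR_ge0// mule_ge0 ?lee_fin ?invr_ge0 ?(ltW (vol_gt0 _))//.
  by apply: integral_ge0 => x _; rewrite lee_fin cabs_ge0.
case E : (dotLambda_fun_norm alpha b) b0 => [B| |//] B0; last by rewrite leey.
apply/lee_addgt0Pr => eps eps0; rewrite lee_pdivrMl// -EFinD -EFinM.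
have B1 : 0 < B + eps by rewrite ltr_wpDl.
apply: paraproduct_norm_le => [|f lf Hf].
  by rewrite lee_fin mulr_ge0 ?ltW.
rewrite -bg; apply: le_trans (upper b f (B + eps) lb B1 _ Hf) _.
  by apply/dotLambda_fun_norm_le => //; rewrite E lee_fin lerDl ltW.
apply: lee_wpmul2r; first exact: Lnorm_ge0.
by rewrite lee_fin ler_pM2r// lerDl mulr_ge0 ?ltW.
Qed.
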